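(* There exist an infinite connected simple graph $G$ with bounded degrees that is uniformly weakly recurrent and a vertex $o$ of $G$ such that for the simple random walk on $G$, $$\liminf_{n\to\infty}\frac{\log n}{n}E^o[R_n]<\limsup_{n\to\infty}\frac{\log n}{n}E^o[R_n],$$ and for some constants $c_{\inf}$ and $c_{\sup}$, $$0<\liminf_{n\to\infty}\frac{\log n}{n}R_n=c_{\inf}<c_{\sup}=\limsup_{n\to\infty}\frac{\log n}{n}R_n<+\infty,\quad P^o\text{-a.s.}$$
   Context: The simple random walk $(S_n)_{n\ge 0}$ on $G$ under $P^x$ is the Markov chain with $P^x(S_0=x)=1$ that at each step moves from its current vertex $z$ to each neighbour of $z$ with probability $1/\deg(z)$; $E^x$ is the expectation under $P^x$, and $p_n(x,y)=P^x(S_n=y)$. The range is $R_n=|\{S_0,\dots,S_n\}|$. $G$ is uniformly weakly recurrent if there exist positive constants $c,C$ such that for every $n\ge 1$ and every $x\in V(G)$, $c\le n\,(p_n(x,x)+p_{n+1}(x,x))\le C$. *)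

(* Defs.v *)
From HB Require Import structures.
From mathcomp Require Import all_boot all_order all_algebra.
From mathcomp Require Import finmap.
From mathcomp Require Import all_classical all_reals all_analysis.

Set Implicit Arguments.
Unset Strict Implicit.
Unset Printing Implicit Defensive.

Import Order.TTheory GRing.Theory Num.Theory.
Local Open Scope classical_set_scope.
Local Open Scope ring_scope.

(* The vertex type is pointed (nonempty) because measurable types have to be;
   the distinguished point plays no role. *)
Record simple_graph := SimpleGraph {
  vertex :> pointedType;
  adj : rel vertex;
  adj_sym : symmetric adj;
  adj_irr : irreflexive adj }.

Arguments adj {_}.

Section Graph.
Variable G : simple_graph.
Implicit Types x y z : G.

Definition infinite_graph := infinite_set [set: G].

Definition connected_graph :=
  forall x y, exists2 s : seq G, path adj x s & last x s = y.

Definition neighbours x : set G := [set y | adj x y].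

(* fset_set is empty on infinite sets, so deg x = 0 when x has infinitely many
   neighbours; bounded_degree therefore also requires finiteness. *)
Definition deg x : nat := #|` fset_set (neighbours x)|%fset.

Definition bounded_degree :=
  exists D : nat, forall x, finite_set (neighbours x) /\ (deg x <= D)%N.

End Graph.

(* Path space V^nat with the product of the discrete sigma-algebras; S_n is the
   n-th coordinate map. *)
Definition coordinate_events (G : simple_graph) : set (set (nat -> G)) :=
  [set E | exists (n : nat) (A : set G), E = [set w | A (w n)]].
Arguments coordinate_events : clear implicits.

Definition path_space (G : simple_graph) :=
  g_sigma_algebraType (coordinate_events G).

Section Walk.
Variables (R : realType) (G : simple_graph).

Definition step (z y : G) : R := if adj z y then (deg z)%:R^-1 else 0.

(* P x is the law of the walk started at x.  The second clause is the Markov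
   property, P(S_{n+1} = y | S_0 = h_0, ..., S_n = h_n) = step (h_n) y,
   multiplied out so as to make sense for null histories.  On a connected graph
   with bounded degrees (V is then countable) these clauses determine P. *)
Definition is_srw (P : G -> probability (path_space G) R) :=
  forall x,
    P x [set w | w 0%N = x] = 1%E /\
    forall (n : nat) (h : nat -> G) (y : G),
      P x [set w | (forall k, (k <= n)%N -> w k = h k) /\ w n.+1 = y] =
      (P x [set w | forall k, (k <= n)%N -> w k = h k] * (step (h n) y)%:E)%E.

Variable P : G -> probability (path_space G) R.

Definition trans_prob (n : nat) (x y : G) : R := fine (P x [set w | w n = y]).

Definition uniformly_weakly_recurrent :=
  exists c C : R, [/\ 0 < c, 0 < C &
    forall (n : nat) (x : G), (1 <= n)%N ->
      c <= n%:R * (trans_prob n x x + trans_prob n.+1 x x) <= C].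

End Walk.

Definition range_size (G : simple_graph) (n : nat) (w : path_space G) : nat :=
  size (undup (mkseq w n.+1)).

(* Main.v *)
Require Import Defs.
From HB Require Import structures.
From mathcomp Require Import all_boot all_order all_algebra finmap.
From mathcomp Require Import all_classical all_reals all_analysis measurable_realfun.
From mathcomp Require Import ring lra zify.

(* To every point of Z^2 attach either two pendant paths of length two (type
   true) or a four-cycle through the point (type false), obtaining sites with
   five, respectively four, vertices.  The pair formed by the site and the
   distance to its lattice point is a Markov chain which does not depend on the
   types, and neither do the Green function at lattice points and the law of the
   visited lattice points; hence the walk is uniformly weakly recurrent for any
   choice of types, with constants independent of it.  The mean number of visited
   lattice points at time n = 2^k is about n / (2 g_k), where g_k is the Green
   function at time n, which is of order k.  Almost all the vertices of a visited
   site are visited, so the mean range is about 5, respectively 4, times this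
   number if all the relevant sites have the same type.  Choose the types
   constant on annuli so wide that the inner ones are negligible, alternately
   true and false, at radii 2^k for which k / g_k is almost constant: the rescaled
   mean range then oscillates.

   Chebyshev's inequality, independence of pieces of the path and Borel-Cantelli
   bound the rescaled range almost surely.  Its upper and lower limits do not
   change when a vertex is put in front of the path, so they are constants by a
   zero-one law.  Markov's inequality and a second moment bound along the two
   subsequences of times separate them. *)

Set Implicit Arguments.
Unset Strict Implicit.
Unset Printing Implicit Defensive.

Import Order.TTheory GRing.Theory Num.Theory numFieldNormedType.Exports.
Local Open Scope classical_set_scope.
Local Open Scope ring_scope.

(** * Finite chains driven by independent digits *)

(** The two decorations are matched so that only the number of vertices tells them apart. In both,
    the lattice point has degree 6, its two neighbours within the site have degree 2, and the
    vertices at distance two have total degree 2. A site thus has total degree 12, and the walk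
    spends about half of its time at lattice points: this is the 2 in [n / (2 g_k)]. All degrees
    divide 6, so every expectation is a finite average over strings of six-valued digits. The
    obstacle is that [g_k] is controlled only up to constant factors, together with a bounded
    increment at each doubling of the time, so [k / g_k] might oscillate by itself. The means are
    therefore compared only at times where it lies within two per cent of a fixed value; the ratio 5
    : 4 absorbs this and all other losses. For the almost sure bounds, Chebyshev's inequality at
    time [2 ^ k] only gives a probability of order [k ^ (-1/2)], which is not summable. Four
    independent blocks improve it to [k ^ (-2)] for the lower bound; for the upper bound the path is
    cut into about as many pieces as the square root of its length. These bounds may be crude: they
    only keep the limits positive and finite. *)

Section Average.
Variable R : realType.
Implicit Types g h : 'I_6 -> R.

Definition avg g : R := (\sum_a g a) / 6%:R.

Lemma eq_avg g h : g =1 h -> avg g = avg h.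
Proof. by move=> gh; rewrite /avg (eq_bigr h). Qed.

Lemma ler_avg g h : (forall a, g a <= h a) -> avg g <= avg h.
Proof. by move=> gh; rewrite /avg ler_wpM2r ?invr_ge0// ler_sum. Qed.

Lemma avg_cst (c : R) : avg (fun=> c) = c.
Proof.
by rewrite /avg sumr_const card_ord -[c *+ 6]mulr_natr mulfK ?pnatr_eq0.
Qed.

Lemma avgD g h : avg (fun a => g a + h a) = avg g + avg h.
Proof. by rewrite /avg big_split mulrDl. Qed.

Lemma avgB g h : avg (fun a => g a - h a) = avg g - avg h.
Proof. by rewrite /avg sumrB mulrBl. Qed.

Lemma avgZ (c : R) g : avg (fun a => c * g a) = c * avg g.
Proof. by rewrite /avg -mulr_sumr mulrA. Qed.

Lemma avgZr (c : R) g : avg (fun a => g a * c) = avg g * c.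
Proof. by rewrite /avg -mulr_suml mulrAC. Qed.

Lemma avg_sum (I : Type) (r : seq I) (g : I -> 'I_6 -> R) :
  avg (fun a => \sum_(i <- r) g i a) = \sum_(i <- r) avg (g i).
Proof. by rewrite /avg exchange_big/= mulr_suml. Qed.

Lemma avg_ge0 g : (forall a, 0 <= g a) -> 0 <= avg g.
Proof. by move=> g0; rewrite -[0]avg_cst; apply: ler_avg. Qed.

Lemma avg_le1 g : (forall a, g a <= 1) -> avg g <= 1.
Proof. by move=> g1; rewrite -[leRHS]avg_cst; apply: ler_avg. Qed.

Lemma avg_ge_term g a : (forall b, 0 <= g b) -> g a / 6%:R <= avg g.
Proof.
move=> g0; rewrite /avg ler_wpM2r ?invr_ge0// (bigD1 a)//= lerDl.
by apply: sumr_ge0 => b _.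
Qed.

End Average.

Section Mean.
Variable R : realType.
Implicit Types f g : seq 'I_6 -> R.

(* Expectation of [f] under [n] independent uniform digits. *)
Fixpoint mean n f : R :=
  if n is m.+1 then avg (fun a => mean m (fun s => f (a :: s))) else f [::].

Lemma eq_mean n f g : (forall s, size s = n -> f s = g s) -> mean n f = mean n g.
Proof.
elim: n f g => [|n IH] f g fg /=; first exact: fg.
by apply: eq_avg => a; apply: IH => s sn; apply: fg; rewrite /= sn.
Qed.

Lemma ler_mean n f g :
  (forall s, size s = n -> f s <= g s) -> mean n f <= mean n g.
Proof.
elim: n f g => [|n IH] f g fg /=; first exact: fg.
by apply: ler_avg => a; apply: IH => s sn; apply: fg; rewrite /= sn.
Qed.

Lemma mean_cst n (c : R) : mean n (fun=> c) = c.
Proof.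
elim: n => [//|n IH] /=; rewrite -[RHS]avg_cst.
by apply: eq_avg => a; rewrite IH.
Qed.

Lemma meanD n f g : mean n (fun s => f s + g s) = mean n f + mean n g.
Proof.
elim: n f g => [//|n IH] f g /=; rewrite -avgD.
by apply: eq_avg => a; rewrite IH.
Qed.

Lemma meanZ n (c : R) f : mean n (fun s => c * f s) = c * mean n f.
Proof.
elim: n f => [//|n IH] f /=; rewrite -avgZ.
by apply: eq_avg => a; rewrite IH.
Qed.

Lemma meanZr n (c : R) f : mean n (fun s => f s * c) = mean n f * c.
Proof. by rewrite mulrC -meanZ; apply: eq_mean => s _; rewrite mulrC. Qed.

Lemma meanB n f g : mean n (fun s => f s - g s) = mean n f - mean n g.
Proof.
by rewrite -mulN1r -meanZ -meanD; apply: eq_mean => s _; rewrite mulN1r.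
Qed.

Lemma mean_sum n (I : Type) (r : seq I) (f : I -> seq 'I_6 -> R) :
  mean n (fun s => \sum_(i <- r) f i s) = \sum_(i <- r) mean n (f i).
Proof.
elim: n f => [//|n IH] f /=; rewrite -avg_sum.
by apply: eq_avg => a; rewrite IH.
Qed.

Lemma mean_ge0 n f : (forall s, 0 <= f s) -> 0 <= mean n f.
Proof. by move=> f0; rewrite -(mean_cst n 0); apply: ler_mean. Qed.

Lemma mean_cat m n f :
  mean (m + n) f = mean m (fun s => mean n (fun t => f (s ++ t))).
Proof.
elim: m f => [//|m IH] f /=.
by apply: eq_avg => a; rewrite IH.
Qed.

Lemma mean_rcons n f :
  mean n.+1 f = mean n (fun s => avg (fun a => f (rcons s a))).
Proof.
rewrite -addn1 mean_cat; apply: eq_mean => s _ /=.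
by apply: eq_avg => a; rewrite cats1.
Qed.

End Mean.

Section Chain.
Variables (R : realType) (S : eqType) (F : S -> 'I_6 -> S).
Implicit Types (x y z : S) (f g : S -> R).

Fixpoint iter_op n f x : R :=
  if n is m.+1 then avg (fun a => iter_op m f (F x a)) else f x.

Lemma ler_iter_op n f g x : (forall z, f z <= g z) ->
  iter_op n f x <= iter_op n g x.
Proof. by elim: n x => [|n IH] x fg //=; apply: ler_avg => a; exact: IH. Qed.

Lemma eq_iter_op n f g x : f =1 g -> iter_op n f x = iter_op n g x.
Proof. by move=> fg; elim: n x => [|n IH] x //=; apply: eq_avg => a. Qed.

Lemma iter_opD n f g x :
  iter_op n (fun z => f z + g z) x = iter_op n f x + iter_op n g x.
Proof. by elim: n x => [//|n IH] x /=; rewrite -avgD; apply: eq_avg => a. Qed.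

Lemma iter_opZ n (c : R) f x :
  iter_op n (fun z => c * f z) x = c * iter_op n f x.
Proof. by elim: n x => [//|n IH] x /=; rewrite -avgZ; apply: eq_avg => a. Qed.

Lemma iter_op_cst n (c : R) x : iter_op n (fun=> c) x = c.
Proof.
by elim: n x => [//|n IH] x /=; rewrite -[RHS]avg_cst; apply: eq_avg => a.
Qed.

Lemma iter_op_sum n (I : Type) (r : seq I) (f : I -> S -> R) x :
  iter_op n (fun z => \sum_(i <- r) f i z) x = \sum_(i <- r) iter_op n (f i) x.
Proof. by elim: n x => [//|n IH] x /=; rewrite -avg_sum; apply: eq_avg => a. Qed.

Lemma iter_op_add m n f x : iter_op (m + n) f x = iter_op m (iter_op n f) x.
Proof. by elim: m x => [//|m IH] x /=; apply: eq_avg => a. Qed.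

Lemma iter_op_ge0 n f x : (forall z, 0 <= f z) -> 0 <= iter_op n f x.
Proof. by move=> f0; rewrite -(iter_op_cst n 0 x); apply: ler_iter_op. Qed.

Definition trp n x y : R := iter_op n (fun z => (z == y)%:R) x.

Lemma trp_ge0 n x y : 0 <= trp n x y.
Proof. by apply: iter_op_ge0 => z. Qed.

Lemma trp_chain m n x y z : trp m x y * trp n y z <= trp (m + n) x z.
Proof.
rewrite /trp iter_op_add mulrC -iter_opZ; apply: ler_iter_op => w.
case: eqP => [->|_]; first by rewrite mulr1.
by rewrite mulr0; apply: trp_ge0.
Qed.

Fixpoint hit n x y : R :=
  if x == y then 1 else
  if n is m.+1 then avg (fun a => hit m (F x a) y) else 0.

Lemma hit_refl n x : hit n x x = 1.
Proof. by case: n => [|n] /=; rewrite eqxx. Qed.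

Lemma hit_ge0 n x y : 0 <= hit n x y.
Proof.
elim: n x => [|n IH] x /=; case: ifP => // _.
by apply: avg_ge0 => a; apply: IH.
Qed.

Lemma hit_le1 n x y : hit n x y <= 1.
Proof.
elim: n x => [|n IH] x /=; case: ifP => // _.
by apply: avg_le1 => a; apply: IH.
Qed.

Lemma hit_leS n x y : hit n x y <= hit n.+1 x y.
Proof.
elim: n x => [|n IH] x; rewrite [leRHS]/= [leLHS]/=; case: ifP => // _.
  by apply: avg_ge0 => a; apply: (hit_ge0 0).
by apply: ler_avg => a; apply: IH.
Qed.

Lemma le_hit m n x y : (m <= n)%N -> hit m x y <= hit n x y.
Proof.
move=> /subnKC <-; elim: (n - m)%N => [|k IH]; first by rewrite addn0.
by apply: (le_trans IH); rewrite addnS; apply: hit_leS.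
Qed.

Lemma hit_trans m n x y z : hit m x z * hit n z y <= hit (m + n) x y.
Proof.
elim: m x => [|m IH] x.
  by rewrite add0n /=; case: eqP => [->|_]; rewrite ?mul1r ?mul0r ?hit_ge0.
have [<-|xz] := eqVneq x z.
  by rewrite hit_refl mul1r; apply: le_hit; rewrite leq_addl.
have [->|xy] := eqVneq x y.
  by rewrite hit_refl mulr_ile1 ?hit_ge0 ?hit_le1.
rewrite addSn /= (negbTE xz) (negbTE xy) -avgZr.
by apply: ler_avg => a; apply: IH.
Qed.

Definition green n x y : R := \sum_(k < n.+1) trp k x y.

Lemma greenS n x y :
  green n.+1 x y = (x == y)%:R + avg (fun a => green n (F x a) y).
Proof. by rewrite /green big_ord_recl avg_sum. Qed.

Lemma green_ge0 n x y : 0 <= green n x y.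
Proof. by apply: sumr_ge0 => k _; apply: trp_ge0. Qed.

Lemma le_green m n x y : (m <= n)%N -> green m x y <= green n x y.
Proof.
move=> mn; rewrite /green -(subnKC (mn : (m.+1 <= n.+1)%N)) big_split_ord/=.
by rewrite lerDl; apply: sumr_ge0 => k _; apply: trp_ge0.
Qed.

Lemma green_ge1 n x : 1 <= green n x x.
Proof.
by apply: le_trans (le_green x x (leq0n n)); rewrite /green big_ord1 /trp/= eqxx.
Qed.

(** After the first visit to [y] at most [n] steps remain, with at most [green n y y] expected
    visits. With the converse [hit_green_le], which grants [h] more steps after time [n], this
    converts sums of Green functions into sums of hitting probabilities. *)
Lemma green_le_hit n x y : green n x y <= hit n x y * green n y y.
Proof.
elim: n x => [|n IH] x.
  by rewrite /green !big_ord1 /trp/= eqxx mulr1; case: eqP.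
have [->|xy] := eqVneq x y; first by rewrite hit_refl mul1r.
rewrite greenS (negbTE xy) add0r /= (negbTE xy) -avgZr; apply: ler_avg => a.
apply: (le_trans (IH _)); apply: ler_wpM2l; first exact: hit_ge0.
exact: le_green.
Qed.

Lemma hit_green_le n h x y : hit n x y * green h y y <= green (n + h) x y.
Proof.
elim: n x => [|n IH] x /=; case: eqP => [->|xy]; rewrite ?mul1r ?mul0r.
- by rewrite add0n.
- exact: green_ge0.
- by apply: le_green; rewrite leq_addl.
rewrite addSn greenS (introF eqP xy) add0r -avgZr.
by apply: ler_avg => a; apply: IH.
Qed.

Definition no_return n y : R :=
  if n is m.+1 then 1 - avg (fun a => hit m (F y a) y) else 1.

Lemma no_return_leS n y : no_return n.+1 y <= no_return n y.
Proof.
case: n => [|n] /=.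
  by rewrite gerBl; apply: avg_ge0 => a; apply: (hit_ge0 0).
by rewrite lerB//; apply: ler_avg => a; apply: hit_leS.
Qed.

Lemma le_no_return m n y : (m <= n)%N -> no_return n y <= no_return m y.
Proof.
move=> /subnKC <-; elim: (n - m)%N => [|k IH]; first by rewrite addn0.
by rewrite addnS; apply: le_trans IH; apply: no_return_leS.
Qed.

(* Decomposition according to the last visit to [y] before time [n]. *)
Lemma last_exit n x y :
  \sum_(k < n.+1) trp k x y * no_return (n - k) y = hit n x y.
Proof.
elim: n x => [|n IH] x.
  by rewrite big_ord1 /trp/= mulr1; case: eqP.
rewrite big_ord_recl subn0.
under eq_bigr => k _ do rewrite lift0 subSS -avgZr.
rewrite -avg_sum (eq_avg (h := fun a => hit n (F x a) y)); last exact: (fun a => IH (F x a)).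
rewrite /trp /=; case: eqP => [->|_]; last by rewrite mul0r add0r.
by rewrite mul1r subrK.
Qed.

(** [last_exit] started at [y]: each factor [no_return (n - k) y] is at least [no_return n y]. *)
Lemma no_return_green n y : no_return n y * green n y y <= 1.
Proof.
rewrite -(hit_refl n y) -last_exit /green mulr_sumr; apply: ler_sum => k _.
by rewrite mulrC ler_wpM2l ?trp_ge0// le_no_return// leq_subr.
Qed.

(** [no_return] averages over six digits the probability of missing [y], so a single digit costs a
    factor 6. Once the Green function is known to diverge, this gives recurrence uniformly in
    [y]. *)
Lemma escape_le n y a : (1 - hit n (F y a) y) * green n.+1 y y <= 6%:R.
Proof.
have g0 := green_ge0 n.+1 y y.
have : (1 - hit n (F y a) y) / 6%:R <= no_return n.+1 y.
  rewrite (_ : no_return n.+1 y = avg (fun b => 1 - hit n (F y b) y)); last first.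
    by rewrite avgB avg_cst.
  apply: (avg_ge_term (g := fun a => 1 - hit n (F y a) y)) => b.
  by rewrite subr_ge0 hit_le1.
rewrite ler_pdivrMr// => e6.
apply: (le_trans (ler_wpM2r g0 e6)).
rewrite mulrAC -[leRHS]mul1r; apply: ler_wpM2r => //.
exact: no_return_green.
Qed.

(* Probability of visiting [y] by time [n], and [z] after the first visit to
   [y] and by time [n]. *)
Fixpoint hit_then n x y z : R :=
  if x == y then hit n y z else
  if n is m.+1 then avg (fun a => hit_then m (F x a) y z) else 0.

Lemma hit_then_ge0 n x y z : 0 <= hit_then n x y z.
Proof.
elim: n x => [|n IH] x /=; case: ifP => // _.
- exact: (hit_ge0 0).
- exact: (hit_ge0 n.+1).
- by apply: avg_ge0 => a; apply: IH.
Qed.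

(** If the first visit to [y] happens at time [t <= n], then [n - t] steps are left and the
    hypothesis bounds the sum by [b (n - t + c)]. The mean of [n - t] on this event is the sum over
    [m < n] of the probabilities that [t <= m]. *)
Lemma sum_hit_then_le n x y (r : seq S) (b c : R) :
  (forall m, (m <= n)%N -> \sum_(z <- r) hit m y z <= b * (m%:R + c)) ->
  \sum_(z <- r) hit_then n x y z
    <= b * (c * hit n x y + \sum_(m < n) hit m x y).
Proof.
elim: n x => [|n IH] x hb.
  rewrite big_ord0 addr0 /=; case: eqP => _; last first.
    by rewrite big1 ?mulr0.
  by have /= := hb 0%N (leqnn _); rewrite add0r mulr1.
have [->|xy] := eqVneq x y.
  under eq_bigr do rewrite /= eqxx -/(hit n.+1 _ _).
  have -> : \sum_(m < n.+1) hit m y y = n.+1%:R.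
    under eq_bigr => m _ do rewrite hit_refl.
    by rewrite sumr_const card_ord.
  by rewrite hit_refl mulr1 addrC; apply: hb.
have -> : \sum_(m < n.+1) hit m x y =
          avg (fun a => \sum_(m < n) hit m (F x a) y).
  rewrite big_ord_recl avg_sum [hit ord0 _ _]/= (negbTE xy) add0r.
  by apply: eq_bigr => m _; rewrite lift0 /= (negbTE xy).
under eq_bigr do rewrite /= (negbTE xy).
rewrite -avg_sum /= (negbTE xy) -avgZ -avgD -avgZ; apply: ler_avg => a.
by apply: IH => m mn; apply: hb; rewrite leqW.
Qed.

Fixpoint trace x (s : seq 'I_6) :=
  x :: (if s is a :: t then trace (F x a) t else [::]).

Lemma trace_cons x a s : trace x (a :: s) = x :: trace (F x a) s.
Proof. by []. Qed.

Lemma size_trace x s : size (trace x s) = (size s).+1.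
Proof. by elim: s x => [//|a s IH] x /=; rewrite IH. Qed.

Lemma trace_rcons x s a :
  trace x (rcons s a) = rcons (trace x s) (F (foldl F x s) a).
Proof. by elim: s x => [//|b s IH] x; rewrite rcons_cons !trace_cons IH. Qed.

Lemma mem_trace_head x s : x \in trace x s.
Proof. by case: s => [|a s]; rewrite inE eqxx. Qed.

Lemma mem_trace_cat x s t :
  trace x (s ++ t) =i [predU trace x s & trace (foldl F x s) t].
Proof.
elim: s x => [|b s IH] x y.
  rewrite !inE /=; case: eqP => [->|//].
  by rewrite mem_trace_head.
by rewrite cat_cons !trace_cons !inE IH !inE orbA.
Qed.

Lemma mean_foldl n f x : mean n (fun s => f (foldl F x s)) = iter_op n f x.
Proof. by elim: n x => [//|n IH] x /=; apply: eq_avg => a; rewrite -IH. Qed.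

Lemma mean_mem_trace n x y : mean n (fun s => (y \in trace x s)%:R) = hit n x y.
Proof.
elim: n x => [|n IH] x /=; first by rewrite inE eq_sym; case: eqP.
have [->|xy] := eqVneq x y.
  rewrite -[RHS]avg_cst; apply: eq_avg => a; rewrite -[RHS](mean_cst n).
  by apply: eq_mean => s _; rewrite inE eqxx.
apply: eq_avg => a; rewrite -IH; apply: eq_mean => s _.
by rewrite !inE eq_sym (negbTE xy).
Qed.

Lemma mean_mem_trace2 n x y z :
  mean n (fun s => ((y \in trace x s) && (z \in trace x s))%:R)
    <= hit_then n x y z + hit_then n x z y.
Proof.
have h0 m u v w : 0 <= hit_then m u v w := hit_then_ge0 m u v w.
elim: n x => [|n IH] x.
  have p0 : 0 <= hit_then 0 x y z + hit_then 0 x z y by rewrite addr_ge0.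
  have [yx|yx] := eqVneq y x; last by rewrite /= !inE (negbTE yx).
  have [zx|zx] := eqVneq z x; last by rewrite /= !inE (negbTE zx) andbF.
  by rewrite /= yx zx !inE eqxx lerDl.
have [->|yx] := eqVneq y x.
  rewrite ler_wpDr// (_ : hit_then n.+1 x x z = hit n.+1 x z); last first.
    by rewrite /= eqxx.
  by rewrite -mean_mem_trace; apply: ler_mean => s _; rewrite mem_trace_head.
have [->|zx] := eqVneq z x.
  rewrite ler_wpDl// (_ : hit_then n.+1 x x y = hit n.+1 x y); last first.
    by rewrite /= eqxx.
  by rewrite -mean_mem_trace; apply: ler_mean => s _; rewrite mem_trace_head andbT.
rewrite /= !(eq_sym x) (negbTE yx) (negbTE zx) -avgD.
apply: ler_avg => a; apply: le_trans (IH (F x a)); apply: ler_mean => s _.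
by rewrite !inE (negbTE yx) (negbTE zx).
Qed.

(** Optional stopping of the martingale [h (S_k)] at the first visit to [y] or at time [n]; on paths
    that miss [y], [h] is bounded by 1. *)
Lemma harmonic_hit (h : S -> R) n x y :
  (forall z, 0 <= h z <= 1) -> (forall z, h z = avg (fun a => h (F z a))) ->
  h x <= hit n x y * h y + (1 - hit n x y).
Proof.
move=> h01 hh; elim: n x => [|n IH] x.
  rewrite /=; case: eqP => [->|_]; first by rewrite mul1r subrr addr0.
  by rewrite mul0r add0r subr0; have /andP[] := h01 x.
have [->|xy] := eqVneq x y; first by rewrite hit_refl mul1r subrr addr0.
rewrite hh /= (negbTE xy) -avgZr -[X in _ + (X - _)](avg_cst 1) -avgB -avgD.
by apply: ler_avg => a; apply: IH.
Qed.

End Chain.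

(** * Return probabilities of the planar walk *)

Section Binomial.
Variable R : realType.

(* Law of the one-dimensional walk with fair steps +1 and -1. *)
Fixpoint walk1 n (u : int) : R :=
  if n is m.+1 then (walk1 m (u - 1) + walk1 m (u + 1)) / 2%:R else (u == 0)%:R.

Lemma walk1S n u :
  walk1 n.+1 u = (walk1 n (u - 1) + walk1 n (u + 1)) / 2%:R.
Proof. by []. Qed.

Lemma walk1_ge0 n u : 0 <= walk1 n u.
Proof. by elim: n u => [|n IH] u //=; rewrite divr_ge0 ?addr_ge0. Qed.

Lemma walk1_lt n (u : int) : u < - n%:Z -> walk1 n u = 0.
Proof.
elim: n u => [|n IH] u /= un; first by case: eqP un => // ->.
by rewrite !IH ?addr0 ?mul0r//; lia.
Qed.

Lemma walk1_binE n m :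
  walk1 n (m.*2%:Z - n%:Z) = 'C(n, m)%:R / (2%:R ^+ n).
Proof.
elim: n m => [|n IH] m.
  rewrite /= subr0 expr0 divr1; case: m => [|m]; first by rewrite bin0 eqxx.
  by rewrite bin0n; case: eqP => //; lia.
rewrite walk1S; case: m => [|m].
  rewrite walk1_lt ?add0r; last by lia.
  rewrite (_ : _ + 1 = 0.*2%:Z - n%:Z)%R; last by lia.
  by rewrite IH !bin0 exprS invfM !mul1r mulrC.
rewrite (_ : _ - 1 = m.*2%:Z - n%:Z)%R; last by lia.
rewrite (_ : _ + 1 = m.+1.*2%:Z - n%:Z)%R; last by lia.
rewrite !IH binS natrD exprS invfM.
by rewrite -mulrDl [(2%:R)^-1 * _]mulrC mulrA [in RHS]addrC.
Qed.

Lemma walk1_odd n (u : int) : odd (`|u| + n)%N -> walk1 n u = 0.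
Proof.
elim: n u => [|n IH] u /= un; first by case: eqP un => // ->.
by rewrite !IH ?addr0 ?mul0r//; lia.
Qed.

Lemma walk1_return i : walk1 i.*2 0 = 'C(i.*2, i)%:R / 2%:R ^+ i.*2.
Proof. by rewrite -walk1_binE subrr. Qed.

Lemma walk1_returnS i :
  walk1 i.+1.*2 0 = walk1 i.*2 0 * (i.*2.+1%:R / i.*2.+2%:R).
Proof.
rewrite !walk1_return.
have e : ('C(i.+1.*2, i.+1) * i.+1 = 'C(i.*2, i) * 2 * i.*2.+1)%N.
  have h1 := mul_bin_diag i.*2.+2 i; have h2 := mul_bin_down i.*2.+1 i.
  rewrite /= (_ : i.*2.+1 - i = i.+1)%N in h1 h2; last by lia.
  rewrite doubleS [LHS]mulnC -h1 (_ : i.*2.+2 = 2 * i.+1)%N; last by lia.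
  by rewrite -mulnA -h2 mulnA mulnC mulnA.
have e' := congr1 (fun k => k%:R : R) e; rewrite !natrM in e'.
rewrite doubleS !exprS.
have p0 : 2%:R ^+ i.*2 != 0 :> R by rewrite expf_neq0.
have -> : i.*2.+2%:R = 2%:R * i.+1%:R :> R by rewrite -natrM; congr _%:R; lia.
have i0 : i.+1%:R != 0 :> R by rewrite pnatr_eq0.
rewrite doubleS in e'.
have -> : 'C(i.*2.+2, i.+1)%:R = 'C(i.*2, i)%:R * 2%:R * i.*2.+1%:R / i.+1%:R :> R.
  by rewrite -e' mulfK.
by field; rewrite nat1r i0 p0.
Qed.

(** A step of the simple planar walk changes the sum and the difference of the coordinates by
    independent fair signs, so its law is a product of two one-dimensional ones. *)
Definition walk2 n (w : int * int) : R :=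
  walk1 n (w.1 + w.2) * walk1 n (w.1 - w.2).

Lemma walk2_0 n : walk2 n 0 = walk1 n 0 * walk1 n 0.
Proof. by []. Qed.

Lemma walk2S n w : walk2 n.+1 w =
  (walk2 n (w - (1, 0)) + walk2 n (w - (-1, 0)) +
   walk2 n (w - (0, 1)) + walk2 n (w - (0, -1))) / 4%:R.
Proof.
case: w => x y; rewrite /walk2 /=.
have -> : x - 1 + (y - 0) = x + y - 1 by lia.
have -> : x - 1 - (y - 0) = x - y - 1 by lia.
have -> : x - (-1) + (y - 0) = x + y + 1 by lia.
have -> : x - (-1) - (y - 0) = x - y + 1 by lia.
have -> : x - 0 + (y - 1) = x + y - 1 by lia.
have -> : x - 0 - (y - 1) = x - y + 1 by lia.
have -> : x - 0 + (y - (-1)) = x + y + 1 by lia.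
have -> : x - 0 - (y - (-1)) = x - y - 1 by lia.
by field.
Qed.

(** With [b] the one-dimensional return probability at time [2 i], the product [b^2 (2 i + 1)] does
    not increase with [i], since [(2 i + 1) (2 i + 3) <= (2 i + 2)^2]. *)
Lemma walk2_return_le n : walk2 n 0 <= n.+1%:R^-1.
Proof.
rewrite walk2_0.
have [no|ne] := boolP (odd n).
  by rewrite walk1_odd ?mulr0.
have -> : n = n./2.*2 by lia.
elim: (n./2) => [|i IH]; first by rewrite /= mulr1 invr1.
rewrite walk1_returnS.
set b := walk1 i.*2 0 in IH *.
have -> : i.+1.*2.+1%:R = 2%:R * i%:R + 3%:R :> R.
  by rewrite -natrM -natrD; congr _%:R; lia.
have -> : i.*2.+2%:R = 2%:R * i%:R + 2%:R :> R.
  by rewrite -natrM -natrD; congr _%:R; lia.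
have e : i.*2.+1%:R = 2%:R * i%:R + 1 :> R.
  by rewrite -natrM natr1; congr _%:R; lia.
rewrite e in IH *.
have i0 : 0 <= i%:R :> R by [].
set z : R := i%:R in i0 IH *.
rewrite -[leRHS]mul1r ler_pdivlMr; last by lra.
rewrite -[_^-1]mul1r ler_pdivlMr in IH; last by lra.
have -> : b * ((2%:R * z + 1) / (2%:R * z + 2%:R)) *
   (b * ((2%:R * z + 1) / (2%:R * z + 2%:R))) * (2%:R * z + 3%:R) =
   (b * b * (2%:R * z + 1)) *
   ((2%:R * z + 1) * (2%:R * z + 3%:R) / (2%:R * z + 2%:R) ^+ 2).
  by field; lra.
rewrite mulr_ile1//.
- by rewrite !mulr_ge0 ?walk1_ge0//; lra.
- by rewrite divr_ge0 ?sqr_ge0// mulr_ge0; lra.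
by rewrite ler_pdivrMr ?exprn_gt0//; nra.
Qed.

(** Here [b^2 (4 i + 1)] does not decrease: [(2 i + 1)^2 (4 i + 5)] exceeds [(2 i + 2)^2 (4 i + 1)]
    by exactly 1. *)
Lemma walk2_return_ge n : ~~ odd n -> (n.*2.+1%:R)^-1 <= walk2 n 0.
Proof.
move=> ne; rewrite walk2_0.
have -> : n = n./2.*2 by lia.
elim: (n./2) => [|i IH]; first by rewrite /= mulr1 invr1.
rewrite walk1_returnS.
set b := walk1 i.*2 0 in IH *.
have -> : i.+1.*2.*2.+1%:R = 4%:R * i%:R + 5%:R :> R.
  by rewrite -natrM -natrD; congr _%:R; lia.
have -> : i.*2.+2%:R = 2%:R * i%:R + 2%:R :> R.
  by rewrite -natrM -natrD; congr _%:R; lia.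
have -> : i.*2.+1%:R = 2%:R * i%:R + 1 :> R.
  by rewrite -natrM natr1; congr _%:R; lia.
have e : i.*2.*2.+1%:R = 4%:R * i%:R + 1 :> R.
  by rewrite -natrM natr1; congr _%:R; lia.
rewrite e in IH *.
have i0 : 0 <= i%:R :> R by [].
set z : R := i%:R in i0 IH *.
rewrite -[leLHS]mul1r ler_pdivrMr; last by lra.
rewrite -[_^-1]mul1r ler_pdivrMr in IH; last by lra.
have -> : b * ((2%:R * z + 1) / (2%:R * z + 2%:R)) *
   (b * ((2%:R * z + 1) / (2%:R * z + 2%:R))) * (4%:R * z + 5%:R) =
   (b * b * (4%:R * z + 1)) *
   ((2%:R * z + 1) ^+ 2 * (4%:R * z + 5%:R) /
    ((2%:R * z + 2%:R) ^+ 2 * (4%:R * z + 1))).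
  by field; apply/andP; split; lra.
rewrite -[leLHS]mulr1 ler_pM//.
rewrite -[leLHS]mul1r ler_pdivlMr ?mul1r; first by nra.
by rewrite mulr_gt0 ?exprn_gt0//; lra.
Qed.

End Binomial.

Lemma avg6 (R : realType) (f : nat -> R) :
  avg (fun a : 'I_6 => f a)
  = (f 0%N + f 1%N + f 2%N + f 3%N + f 4%N + f 5%N) / 6%:R.
Proof.
by rewrite /avg -(big_mkord xpredT f) unlock /= addr0 !addrA.
Qed.

(** * The graph *)

Notation site := (int * int)%type.

(* [None] is the lattice point of a site, [Some (i, false)] its two neighbours
   within the site, and [Some (i, true)] the vertices at distance two: one
   behind each neighbour at sites of type [true], a single one, with
   [i = false], shared by both neighbours at sites of type [false]. *)
Notation mark := (option (bool * bool)).

Section Graph.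
Variable T : site -> bool.

Definition valid_mark (x : site * mark) := T x.1 || (x.2 != Some (true, true)).

Definition vtx := {x : site * mark | valid_mark x}.

HB.instance Definition _ := Countable.copy vtx {x : site * mark | valid_mark x}.

Notation mkv := (@exist _ (fun x => is_true (valid_mark x)) _).

Fact root_subproof v : valid_mark (v, None).
Proof. by rewrite /valid_mark orbT. Qed.

Definition root v : vtx := mkv (root_subproof v).

HB.instance Definition _ := isPointed.Build vtx (root 0).

Definition base_dir (k : nat) : site :=
  match k with 0%N => (1, 0) | 1%N => (-1, 0) | 2%N => (0, 1) | _ => (0, -1) end.

(* All degrees (6, 2 and 1) divide 6, so the walk moves by a uniform digit below 6,
   each neighbour being the image of equally many digits. *)
Definition raw_step (x : site * mark) (k : nat) : site * mark :=
  match x.2 with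
  | None =>
      if (k < 4)%N then (x.1 + base_dir k, None) else (x.1, Some (k == 5%N, false))
  | Some (i, false) =>
      (x.1, if odd k then Some (T x.1 && i, true) else None)
  | Some (i, true) => (x.1, Some (if T x.1 then i else odd k, false))
  end.

Fact raw_step_subproof (x : vtx) k : valid_mark (raw_step (val x) k).
Proof.
case: x => -[v [[i []]|]] /= vx; rewrite /valid_mark /raw_step /=.
- by rewrite (inj_eq Some_inj) xpair_eqE andbF orbT.
- by case: (T v); case: (odd k).
case: ifP => _ /=; first by rewrite orbT.
by rewrite (inj_eq Some_inj) xpair_eqE andbF orbT.
Qed.

Definition nstep (x : vtx) (k : nat) : vtx := mkv (raw_step_subproof x k).

Definition dstep (x : vtx) (a : 'I_6) : vtx := nstep x a.

Definition site_of (x : vtx) : site := (val x).1.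

(* Distance to the lattice point of the site. *)
Definition level (x : vtx) : nat :=
  if (val x).2 is Some (_, b) then (if b then 2 else 1)%N else 0%N.

Lemma level0P x : level x = 0%N -> x = root (site_of x).
Proof. by case: x => -[v [[i []]|]] //= vx _; apply: val_inj. Qed.

Lemma site_root v : site_of (root v) = v. Proof. by []. Qed.

Lemma root_inj : injective root.
Proof. by move=> v w /(congr1 site_of). Qed.

Lemma eq_rootE x v : (x == root v) = (site_of x == v) && (level x == 0%N).
Proof.
apply/eqP/andP => [->|[/eqP <- /eqP/level0P //]].
by rewrite site_root; split.
Qed.

Definition gadj (x y : vtx) := [exists a, dstep x a == y].

Lemma gadjP x y : reflect (exists2 k, (k < 6)%N & nstep x k = y) (gadj x y).
Proof.
apply: (iffP existsP) => [[a /eqP <-]|[k k6 <-]]; first by exists a.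
by exists (Ordinal k6).
Qed.

Lemma gadj_sym : symmetric gadj.
Proof.
suff h x y : gadj x y -> gadj y x by move=> x y; apply/idP/idP; apply: h.
move=> /gadjP[k k6 <-]; apply/gadjP.
case: x => -[v [[i []]|]] vx.
- exists 1%N => //; apply: val_inj; rewrite /= /raw_step /=.
  by move: vx; rewrite /valid_mark /=; case: (T v); case: i.
- exists (if odd k then nat_of_bool i else 4 + i)%N.
    by case: (odd k); case: (i).
  apply: val_inj; rewrite /= /raw_step /=.
  case: (odd k) => /=; first by case: (T v); case: (i).
  by case: (i).
(* The digit of the reverse edge: the opposite direction for 0 to 3, and otherwise 0, which leads
   from a neighbour within the site to the lattice point. *)
exists (nth 0 [:: 1; 0; 3; 2; 0; 0] k)%N.
  by move: k k6; do 6 (case=> //).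
apply: val_inj; rewrite /= {vx}; case: v => p q; move: k k6.
by do 6 (case=> [_|]; first (rewrite /= /raw_step //=; congr (_, _); congr pair; rewrite /=; lia)).
Qed.

Lemma gadj_irr : irreflexive gadj.
Proof.
move=> x; apply/negbTE/negP => /gadjP[k k6 /(congr1 val)].
case: x => -[[p q] [[i []]|]] vx; rewrite /= {vx} /raw_step /=.
- by case.
- by case: (odd k).
move: k k6; do 6 (case=> [_|]; first by case => //; lia).
by [].
Qed.

Definition graph := SimpleGraph gadj_sym gadj_irr.

Lemma graph_infinite : infinite_graph graph.
Proof.
move=> fV; apply: infinite_nat.
have -> : [set: nat] = (fun n : nat => root (n%:Z, 0)) @^-1` [set: graph] by [].
by apply: finite_preimage => // m n _ _ /root_inj[].
Qed.

Definition linked (x y : graph) := exists2 s : seq graph, path adj x s & last x s = y.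

Lemma linked_refl x : linked x x.
Proof. by exists [::]. Qed.

Lemma linked_adj x y : gadj x y -> linked x y.
Proof. by move=> xy; exists [:: y] => //=; rewrite andbT. Qed.

Lemma linked_trans y x z : linked x y -> linked y z -> linked x z.
Proof.
move=> [s xs <-] [t yt <-]; exists (s ++ t); last by rewrite last_cat.
by rewrite cat_path xs.
Qed.

Lemma linked_sym x y : linked x y -> linked y x.
Proof.
move=> [s + <-]; elim: s x => [|z s IH] x /=; first by exists [::].
move=> /andP[xz zs]; apply: linked_trans (IH z zs) _.
by apply: linked_adj; rewrite gadj_sym.
Qed.

Lemma linked_step x k : (k < 6)%N -> linked x (nstep x k).
Proof. by move=> k6; apply: linked_adj; apply/gadjP; exists k. Qed.

Lemma linked_shift (p q : int) (k : nat) : (k < 4)%N ->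
  linked (root (p, q)) (root ((p, q) + base_dir k)).
Proof.
move=> k4; suff -> : root ((p, q) + base_dir k) = nstep (root (p, q)) k.
  by apply: linked_step; lia.
by apply: val_inj; rewrite /= /raw_step /= k4.
Qed.

Lemma linked_origin p q : linked (root (0, 0)) (root (p, q)).
Proof.
have line (u v : int) k : (k < 4)%N -> forall n : nat,
    linked (root (u, v)) (root ((u, v) + base_dir k *+ n)).
  move=> k4; elim=> [|n IH]; first by rewrite mulr0n addr0; apply: linked_refl.
  apply: linked_trans IH _; rewrite mulrSr addrA.
  by case: (_ + base_dir k *+ n) => p' q'; apply: linked_shift.
have e (x : site) n : x *+ n = (x.1 *+ n, x.2 *+ n).
  by elim: n => [|n IH]; rewrite ?mulr0n// !mulrS IH.
apply: (@linked_trans (root (p, 0))).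
  case: (lerP 0 p) => p0.
    have := line 0 0 0%N isT `|p|%N; rewrite e /=.
    by rewrite (_ : _ + _ = (p, 0))//; congr pair; rewrite /= ?mul0rn ?mulNrn ?natz; lia.
  have := line 0 0 1%N isT `|p|%N; rewrite e /=.
  by rewrite (_ : _ + _ = (p, 0))//; congr pair; rewrite /= ?mul0rn ?mulNrn ?natz; lia.
case: (lerP 0 q) => q0.
  have := line p 0 2%N isT `|q|%N; rewrite e /=.
  by rewrite (_ : _ + _ = (p, q))//; congr pair; rewrite /= ?mul0rn ?mulNrn ?natz; lia.
have := line p 0 3%N isT `|q|%N; rewrite e /=.
by rewrite (_ : _ + _ = (p, q))//; congr pair; rewrite /= ?mul0rn ?mulNrn ?natz; lia.
Qed.

Lemma linked_root x : linked x (root (site_of x)).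
Proof.
have l1 (y : graph) : level y = 1%N -> linked y (root (site_of y)).
  case: y => -[v [[i []]|]] //= vy _.
  suff -> : root (site_of (mkv vy)) = nstep (mkv vy) 0%N.
    exact: linked_step.
  exact: val_inj.
case lx : (level x) => [|[|k]]; first by rewrite -level0P//; apply: linked_refl.
  exact: l1.
suff h : level (nstep x 0%N) = 1%N /\ site_of (nstep x 0%N) = site_of x.
  case: h => /l1 + e; rewrite e => h.
  exact: linked_trans (linked_step x (isT : (0 < 6)%N)) h.
by case: x lx => -[v [[i []]|]].
Qed.

Lemma graph_connected : connected_graph graph.
Proof.
move=> x y; change (linked x y); apply: linked_trans (linked_root x) _.
apply: linked_trans _ (linked_sym (linked_root y)).
case: (site_of x) => p q; case: (site_of y) => p' q'.
by apply: linked_trans _ (linked_origin p' q'); apply/linked_sym/linked_origin.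
Qed.

Definition nexts (x : graph) : seq graph := [seq nstep x k | k <- iota 0 6].

Lemma neighboursE (x : graph) : neighbours x = [set` seq_fset tt (nexts x)].
Proof.
apply/seteqP; split=> y.
  move=> /gadjP[k k6 <-]; rewrite /mkset seq_fsetE.
  by apply: map_f; rewrite mem_iota.
rewrite /mkset seq_fsetE => /mapP[k]; rewrite mem_iota => k6 ->.
by apply/gadjP; exists k.
Qed.

Lemma degE (x : graph) : deg x = size (undup (nexts x)).
Proof. by rewrite /deg neighboursE set_fsetK size_seq_fset. Qed.

Lemma graph_bounded_degree : bounded_degree graph.
Proof.
exists 6%N => x; split; first by rewrite neighboursE; exact: finite_fset.
by rewrite degE (leq_trans (size_undup _)).
Qed.

Lemma count_nexts (x y : graph) : y \in nexts x -> (count_mem y (nexts x) * deg x = 6)%N.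
Proof.
rewrite degE; case: x => -[v [[i []]|]] vx.
- have [Tv|Tv] := boolP (T v).
    have e k : nstep (mkv vx) k = nstep (mkv vx) 0%N.
      by apply: val_inj; rewrite /= /raw_step /= Tv.
    rewrite /nexts /= !(e 1%N) !(e 2%N) !(e 3%N) !(e 4%N) !(e 5%N).
    by rewrite !inE !orbb => /eqP ->; rewrite !eqxx /= ?inE ?eqxx.
  set u := nstep (mkv vx) 0%N; set w := nstep (mkv vx) 1%N.
  have uw : u != w.
    by apply/eqP => /(congr1 val); rewrite /= /raw_step /= (negbTE Tv).
  have e k : nstep (mkv vx) k = if odd k then w else u.
    by apply: val_inj; rewrite fun_if /= /raw_step /= (negbTE Tv); case: odd.
  rewrite /nexts /= !e /= !inE.
  rewrite (eq_sym w) !eqxx (negbTE uw) /=.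
  have [->|yu] := eqVneq y u; first by rewrite ?eqxx (eq_sym w) (negbTE uw).
  by have [yw|yw] := eqVneq y w.
- set u := nstep (mkv vx) 0%N; set w := nstep (mkv vx) 1%N.
  have uw : u != w by apply/eqP => /(congr1 val).
  have e k : nstep (mkv vx) k = if odd k then w else u.
    by apply: val_inj; rewrite fun_if /= /raw_step /=; case: odd.
  rewrite /nexts /= !e /= !inE.
  rewrite (eq_sym w) !eqxx (negbTE uw) /=.
  have [->|yu] := eqVneq y u; first by rewrite ?eqxx (eq_sym w) (negbTE uw).
  by have [yw|yw] := eqVneq y w.
move=> ynx; have un : uniq (nexts (mkv vx)).
  rewrite map_inj_in_uniq ?iota_uniq// => k l; rewrite !mem_iota => k6 l6.
  move=> /(congr1 val) /=; move: {y vx ynx} v => [p q].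
  move: k k6 l l6; do 6 (case=> [_|]; first
    by do 6 (case=> [_|]; first
    by rewrite /raw_step /=; first [by [] | by move=> [] /=; lia])).
  by [].
by rewrite count_uniq_mem// ynx undup_id.
Qed.

Lemma stepE (R : realType) (x y : graph) :
  step R x y = avg (fun a => (dstep x a == y)%:R).
Proof.
rewrite /avg; have -> : \sum_a (dstep x a == y)%:R = (count_mem y (nexts x))%:R :> R.
  rewrite -(big_mkord xpredT (fun k => (nstep x k == y)%:R)) /index_iota subn0.
  rewrite count_map -sum1_count natr_sum [RHS]big_mkcond; apply: eq_bigr => k _.
  by rewrite [preim _ _ _]/=; case: (nstep x k == y).
rewrite /step; have xyE : adj x y = (y \in nexts x).
  apply/idP/idP => [/gadjP[k k6 <-]|/mapP[k + ->]].
    by apply: map_f; rewrite mem_iota.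
  by rewrite mem_iota => k6; apply/gadjP; exists k.
rewrite xyE; case: ifPn => [/count_nexts e|]; last first.
  by move=> /count_memPn ->; rewrite mul0r.
have d0 : (deg x)%:R != 0 :> R by rewrite pnatr_eq0; move: e; case: deg => //; lia.
by rewrite -e natrM invfM mulrA mulfV ?mul1r// pnatr_eq0; apply/eqP => c0; rewrite c0 in e.
Qed.

End Graph.

(** * Heat kernel bounds *)

(* Chain of the level and of the number of steps made so far between different
   sites. *)
Definition lstep (lj : nat * nat) (k : nat) : nat * nat :=
  match lj.1 with
  | 0%N => if (k < 4)%N then (0%N, lj.2.+1) else (1%N, lj.2)
  | 1%N => (if odd k then 2%N else 0%N, lj.2)
  | _ => (1%N, lj.2)
  end.

Section LevelChain.
Variable R : realType.
Implicit Types f : nat * nat -> R.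

Definition lwalk n f lj : R :=
  iter_op (fun lj (a : 'I_6) => lstep lj a) n f lj.

Arguments lwalk : simpl never.

Lemma lwalk0S n f j : lwalk n.+1 f (0%N, j) =
  2%:R / 3%:R * lwalk n f (0%N, j.+1) + 3%:R^-1 * lwalk n f (1%N, j).
Proof.
rewrite {1}/lwalk /= (avg6 (fun k => lwalk n f (lstep (0%N, j) k))) /lstep /=.
by field.
Qed.

Lemma lwalk1S n f j :
  lwalk n.+1 f (1%N, j) = (lwalk n f (0%N, j) + lwalk n f (2%N, j)) / 2%:R.
Proof.
rewrite {1}/lwalk /= (avg6 (fun k => lwalk n f (lstep (1%N, j) k))) /lstep /=.
by field.
Qed.

Lemma lwalk2S n f l j : lwalk n.+1 f (l.+2, j) = lwalk n f (1%N, j).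
Proof.
rewrite {1}/lwalk /= (avg6 (fun k => lwalk n f (lstep (l.+2, j) k))) /lstep /=.
by field.
Qed.

Lemma lwalk_shift n f l j :
  lwalk n f (l, j.+1) = lwalk n (fun lj => f (lj.1, lj.2.+1)) (l, j).
Proof.
elim: n l j => [//|n IH] [|[|l]] j.
- by rewrite !lwalk0S !IH.
- by rewrite !lwalk1S !IH.
- by rewrite !lwalk2S IH.
Qed.

(* The drift of [6 j + height l] is 2, and the Lyapunov inequality below only
   uses half of it, which leaves room for the convexity of the inverse. *)
Definition height (l : nat) : R :=
  match l with 0%N => 6%:R | 1%N => 0 | _ => - 2%:R end.

Lemma lwalk_inverse n l j :
  lwalk n (fun lj => (6%:R * lj.2%:R + height lj.1 + 42%:R)^-1) (l, j)
    <= (6%:R * j%:R + height l + 42%:R + n%:R)^-1.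
Proof.
have inv_le (a b : R) : 0 < b -> 0 < a -> 1 <= a * b -> b^-1 <= a.
  by move=> b0 a0 ab; rewrite -[_^-1]mul1r ler_pdivrMr.
elim: n l j => [|n IH] l j; first by rewrite addr0.
have j0 : 0 <= j%:R :> R by []. have n0 : 0 <= n%:R :> R by [].
have jE : j.+1%:R = j%:R + 1 :> R by rewrite natr1.
case: l => [|[|l]].
- rewrite lwalk0S; have h0 := IH 0%N j.+1; have h1 := IH 1%N j.
  rewrite /= -[n.+1%:R]natr1 jE in h0 h1 *.
  set z : R := 6%:R * j%:R + 6%:R + 42%:R + (n%:R + 1).
  have z0 : 49%:R <= z by rewrite /z; lra.
  rewrite (_ : _ + n%:R = z + 5%:R) in h0; last by rewrite /z; ring.
  rewrite (_ : _ + n%:R = z - 7%:R) in h1; last by rewrite /z; ring.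
  (* After clearing denominators the claim is [35 <= z], and [15 <= z] in the next case; the offset
     42 provides for both. *)
  apply: (@le_trans _ _ (2%:R / 3%:R * (z + 5%:R)^-1 + 3%:R^-1 * (z - 7%:R)^-1)).
    by apply: lerD; rewrite ler_pM2l ?divr_gt0.
  have -> : 2%:R / 3%:R * (z + 5%:R)^-1 + 3%:R^-1 * (z - 7%:R)^-1 =
       (3%:R * z - 9%:R) / (3%:R * (z + 5%:R) * (z - 7%:R)).
    by field; apply/andP; split; lra.
  rewrite -[leRHS]mul1r ler_pdivrMr; last by rewrite !mulr_gt0//; lra.
  rewrite mulrAC ler_pdivlMr; last by lra.
  nra.
- rewrite lwalk1S; have h0 := IH 0%N j; have h1 := IH 2%N j.
  rewrite /= -[n.+1%:R]natr1 in h0 h1 *.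
  set z : R := 6%:R * j%:R + 0 + 42%:R + (n%:R + 1).
  have z0 : 43%:R <= z by rewrite /z; lra.
  rewrite (_ : _ + n%:R = z + 5%:R) in h0; last by rewrite /z; ring.
  rewrite (_ : _ + n%:R = z - 3%:R) in h1; last by rewrite /z; ring.
  apply: (@le_trans _ _ (((z + 5%:R)^-1 + (z - 3%:R)^-1) / 2%:R)).
    by rewrite ler_pM2r ?invr_gt0// lerD.
  have -> : ((z + 5%:R)^-1 + (z - 3%:R)^-1) / 2%:R =
       (z + 1) / ((z + 5%:R) * (z - 3%:R)).
    by field; apply/andP; split; lra.
  rewrite -[leRHS]mul1r ler_pdivrMr; last by rewrite !mulr_gt0//; lra.
  rewrite mulrAC ler_pdivlMr; last by lra.
  nra.
rewrite lwalk2S; apply: (le_trans (IH _ _)).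
by rewrite /= lef_pV2 ?posrE -?[n.+1%:R]natr1; lra.
Qed.

Lemma lwalk_le n f g lj : (forall z, f z <= g z) -> lwalk n f lj <= lwalk n g lj.
Proof. exact: ler_iter_op. Qed.

(** As [height] lies between -2 and 6, [6 j + height + 42] is at most [48 (j + 1)], and at least 40
    at the start. Hence [walk2], which is at most [1 / (j + 1)], is dominated by 48 times the
    function in [lwalk_inverse]. *)
Lemma lwalk_return_le n l :
  lwalk n (fun lj => walk2 R lj.2 0) (l, 0%N) <= 48%:R / (n%:R + 40%:R).
Proof.
apply: (@le_trans _ _ (lwalk n
    (fun lj => 48%:R * (6%:R * lj.2%:R + height lj.1 + 42%:R)^-1) (l, 0%N))).
  apply: lwalk_le => -[l' j] /=; apply: (le_trans (walk2_return_le _ _)).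
  have j0 : 0 <= j%:R :> R by [].
  have hl : - 2%:R <= height l' <= 6%:R by case: l' => [|[|l']] /=; lra.
  rewrite -[leLHS]mul1r ler_pdivrMr// mulrAC ler_pdivlMr; last by lra.
  by rewrite -natr1; lra.
rewrite /lwalk iter_opZ ler_wpM2l//.
apply: (le_trans (lwalk_inverse _ _ _)).
have n0 : 0 <= n%:R :> R by [].
have hl : - 2%:R <= height l <= 6%:R by case: l => [|[|l']] /=; lra.
by rewrite lef_pV2 ?posrE; lra.
Qed.

(** From levels 0, 1 and at least 2 the probabilities after two steps are 11/18, 1/3 and 1/2;
    averaging over a first step preserves their minimum as a lower bound. *)
Lemma lwalk_level0_ge n l j : (2 <= n)%N ->
  3%:R^-1 <= lwalk n (fun lj => (lj.1 == 0%N)%:R) (l, j).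
Proof.
case: n => [//|[//|n]] _; elim: n l j => [|n IH] l j.
  case: l => [|[|l]].
  - by rewrite !(lwalk0S, lwalk1S, lwalk2S) /lwalk /=; lra.
  - by rewrite !(lwalk0S, lwalk1S, lwalk2S) /lwalk /=; lra.
  by rewrite !(lwalk0S, lwalk1S, lwalk2S) /lwalk /=; lra.
case: l => [|[|l]].
- by rewrite lwalk0S; have := IH 0%N j.+1; have := IH 1%N j; lra.
- by rewrite lwalk1S; have := IH 0%N j; have := IH 2%N j; lra.
by rewrite lwalk2S; have := IH 1%N j; lra.
Qed.

(* [j + l + n] keeps its parity, and [j + n] does not increase with time. *)
Lemma lwalk_return_ge n l j : (l <= 2)%N -> ~~ odd (n + l + j) ->
  lwalk n (fun lj => (lj.1 == 0%N)%:R) (l, j) / (2%:R * (n%:R + j%:R) + 1)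
    <= lwalk n (fun lj => (lj.1 == 0%N)%:R * walk2 R lj.2 0) (l, j).
Proof.
have mono (p : R) m i m' i' : 0 <= p -> (m + i <= m' + i')%N ->
    p / (2%:R * (m'%:R + i'%:R) + 1) <= p / (2%:R * (m%:R + i%:R) + 1).
  move=> p0 mi; rewrite ler_wpM2l// lef_pV2 ?posrE -?natrD.
  - by rewrite lerD2r ler_pM2l// ler_nat.
  - by rewrite ltr_wpDl ?mulr_ge0.
  - by rewrite ltr_wpDl ?mulr_ge0.
have p0 m lj : 0 <= lwalk m (fun lj => (lj.1 == 0%N)%:R) lj.
  by apply: iter_op_ge0 => z.
elim: n l j => [|n IH] l j l2 par.
  rewrite /lwalk /= add0r; case: eqP par => [->|_ _]; last by rewrite !mul0r.
  rewrite !mul1r => par; apply: le_trans (walk2_return_ge _ _).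
    by rewrite -[_.*2.+1%:R]natr1 -mul2n natrM.
  by move: par; rewrite !add0n.
pose f0 (lj : nat * nat) : R := (lj.1 == 0%N)%:R.
pose f1 (lj : nat * nat) : R := (lj.1 == 0%N)%:R * walk2 R lj.2 0.
rewrite -/f0 -/f1; set d : R := 2%:R * (n.+1%:R + j%:R) + 1.
case: l l2 par => [|[|l]] l2 par.
- rewrite !lwalk0S.
  have h0 : lwalk n f0 (0%N, j.+1) / d <= lwalk n f1 (0%N, j.+1).
    by apply: le_trans (IH 0%N j.+1 _ _); [apply: mono => //; lia| |lia].
  have h1 : lwalk n f0 (1%N, j) / d <= lwalk n f1 (1%N, j).
    by apply: le_trans (IH 1%N j _ _); [apply: mono => //; lia| |lia].
  rewrite mulrDl -[2%:R / 3%:R * _ * _]mulrA -[3%:R^-1 * _ * _]mulrA.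
  by apply: lerD; rewrite ler_pM2l ?divr_gt0 ?invr_gt0.
- rewrite !lwalk1S mulrAC ler_pM2r ?invr_gt0// mulrDl.
  have h0 : lwalk n f0 (0%N, j) / d <= lwalk n f1 (0%N, j).
    by apply: le_trans (IH 0%N j _ _); [apply: mono => //; lia| |lia].
  have h1 : lwalk n f0 (2%N, j) / d <= lwalk n f1 (2%N, j).
    by apply: le_trans (IH 2%N j _ _); [apply: mono => //; lia| |lia].
  exact: lerD.
rewrite !lwalk2S.
by apply: le_trans (IH 1%N j _ _); [apply: mono => //; lia| |lia].
Qed.

End LevelChain.
Arguments lwalk : simpl never.

Section HeatKernel.
Variables (R : realType) (T : site -> bool).
Implicit Types x y z : vtx T.
Local Notation F := (@dstep T).

(** Given the levels, the sites entered in turn form a planar walk, of which [j] steps have been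
    made. The right-hand side does not mention [T], whence bounds uniform in the types. *)
Lemma site_law n (phi : nat -> R) x v :
  iter_op F n (fun z => (site_of z == v)%:R * phi (level z)) x =
  lwalk n (fun lj => phi lj.1 * walk2 R lj.2 (v - site_of x)) (level x, 0%N).
Proof.
elim: n x => [|n IH] x.
  rewrite /lwalk /= mulrC; congr (_ * _); rewrite /walk2 /= -natrM mulnb.
  congr (_%:R); congr nat_of_bool; case: v (site_of x) => p q [p' q'] /=.
  by apply/eqP/andP => [[-> ->]|[/eqP h1 /eqP h2]];
    [split; apply/eqP; lia | congr pair; lia].
pose psi v0 (lj : nat * nat) : R := phi lj.1 * walk2 R lj.2 (v - v0).
rewrite /= (avg6 (fun k => iter_op F n _ (nstep x k))) !IH.
case: x => -[v0 [[i []]|]] vx; rewrite /site_of /level /= /raw_step /=.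
- by rewrite lwalk2S; field.
- by rewrite lwalk1S; field.
rewrite lwalk0S.
suff s4 : lwalk n (psi (v0 + (1, 0))) (0%N, 0%N) +
          lwalk n (psi (v0 + (-1, 0))) (0%N, 0%N) +
          lwalk n (psi (v0 + (0, 1))) (0%N, 0%N) +
          lwalk n (psi (v0 + (0, -1))) (0%N, 0%N) =
          4%:R * lwalk n (psi v0) (0%N, 1%N).
  by rewrite s4; field.
rewrite lwalk_shift /lwalk -iter_opZ -!iter_opD; apply: eq_iter_op => lj.
rewrite /psi /= walk2S !opprD !addrA; by field.
Qed.

Lemma trp_rootE n x v : trp R F n x (root T v) =
  lwalk n (fun lj => (lj.1 == 0%N)%:R * walk2 R lj.2 (v - site_of x))
    (level x, 0%N).
Proof.
rewrite /trp -(site_law n (fun l => (l == 0%N)%:R)); apply: eq_iter_op => z.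
by rewrite eq_rootE -natrM mulnb.
Qed.

(** The return to [x] is relaxed to being at the site of [x], at any level. *)
Lemma trp_return_le n x : trp R F n x x <= 48%:R / (n%:R + 40%:R).
Proof.
apply: le_trans (lwalk_return_le _ n (level x)).
rewrite (_ : (fun lj => _) = (fun lj : nat * nat => 1 * walk2 R lj.2 (site_of x - site_of x))).
  rewrite -(site_law n (fun=> 1)); apply: ler_iter_op => z.
  by case: (eqVneq z x) => [->|_]; rewrite ?eqxx mulr1.
by apply/funext => lj; rewrite mul1r subrr.
Qed.

Lemma trp_root_return_ge m v : ~~ odd m ->
  (3%:R * (2%:R * m%:R + 1))^-1 <= trp R F m (root T v) (root T v).
Proof.
move=> em; rewrite trp_rootE subrr.
apply: le_trans (lwalk_return_ge R _ _); rewrite ?addn0//.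
rewrite addr0 invfM ler_wpM2r ?invr_ge0 ?addr_ge0 ?mulr_ge0//.
case: m em => [_|[//|m] _]; last exact: lwalk_level0_ge.
by rewrite /lwalk /=; lra.
Qed.

Lemma trp1_ge x k : (k < 6)%N -> 6%:R^-1 <= trp R F 1 x (nstep x k).
Proof.
move=> k6; rewrite /trp /=.
apply: le_trans (avg_ge_term (g := fun a => (dstep x a == nstep x k)%:R)
  (Ordinal k6) _); last by [].
by rewrite eqxx mul1r.
Qed.

Lemma trp_return_step m x k y : (k < 6)%N -> gadj y x -> y = nstep x k ->
  trp R F m y y / 36%:R <= trp R F m.+2 x x.
Proof.
move=> k6 /gadjP[l l6 ylx] yx.
rewrite -[m.+2]add1n -[m.+1]addn1.
apply: le_trans (trp_chain _ _ 1 (m + 1) x y x).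
apply: le_trans (ler_wpM2l (trp_ge0 _ _ _ _ _) (trp_chain _ _ m 1 y y x)).
have h1 : 6%:R^-1 <= trp R F 1 x y by rewrite yx trp1_ge.
have h2 : 6%:R^-1 <= trp R F 1 y x by rewrite -ylx trp1_ge.
rewrite mulrCA ler_wpM2l ?trp_ge0//.
by rewrite (_ : 36%:R^-1 = 6%:R^-1 * 6%:R^-1); [rewrite ler_pM|field].
Qed.

(** Step to the neighbour nearer to the lattice point, return there, and step back. Each level costs
    two steps, which keeps the parity, and a factor 36, since each of them has probability at least
    1/6. *)
Lemma trp_return_ge m x : ~~ odd m ->
  (3%:R * 36%:R * 36%:R * (2%:R * m%:R + 1))^-1 <= trp R F m x x.
Proof.
have weaken (a b c d : R) : 0 < a -> a <= b -> 0 <= c -> (a * (2%:R * c + 1))^-1 <= d ->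
    (b * (2%:R * c + 1))^-1 <= d.
  move=> a0 ab c0; apply: le_trans; have b0 := lt_le_trans a0 ab.
  have c1 : 0 < 2%:R * c + 1 by lra.
  by rewrite lef_pV2 ?posrE ?mulr_gt0// ler_wpM2r// ltW.
have down k (a b : R) : 0 < b -> (b * (2%:R * k%:R + 1))^-1 / 36%:R <= a ->
    ((b * 36%:R) * (2%:R * k.+2%:R + 1))^-1 <= a.
  move=> b0; apply: le_trans; have k0 : 0 <= k%:R :> R by [].
  rewrite -[k.+2%:R]natr1 -[k.+1%:R]natr1 -invfM mulrAC.
  by rewrite lef_pV2 ?posrE ?mulr_gt0 ?ler_pM2l//; lra.
have l0 k y : ~~ odd k -> level y = 0%N ->
    (3%:R * (2%:R * k%:R + 1))^-1 <= trp R F k y y.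
  by move=> ek /level0P ->; apply: trp_root_return_ge.
have triv y (b : R) : 1 <= b -> (b * (2%:R * 0%:R + 1))^-1 <= trp R F 0 y y.
  move=> b1; rewrite mulr0 add0r mulr1 /trp /= eqxx invf_le1//.
  exact: lt_le_trans b1.
have l1 k y : ~~ odd k -> level y = 1%N ->
    (3%:R * 36%:R * (2%:R * k%:R + 1))^-1 <= trp R F k y y.
  case: k => [_ _|[//|k] ek ly]; first by apply: triv; lra.
  have sy : level (nstep y 0) = 0%N.
    by case: y ly => -[v [[i []]|]].
  apply: down; first by lra.
  apply: le_trans (@trp_return_step k y 0 _ isT _ erefl).
    by rewrite ler_wpM2r ?invr_ge0// l0//; lia.
  by rewrite gadj_sym; apply/gadjP; exists 0%N.
have m0 : 0 <= m%:R :> R by [].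
move=> em; case lx : (level x) => [|[|l]].
- by apply: weaken (l0 _ _ em lx); lra.
- by apply: weaken (l1 _ _ em lx); lra.
case: m em {m0} => [_|[//|k] ek]; first by apply: triv; lra.
have sx : level (nstep x 0) = 1%N.
  by case: x lx => -[v [[i []]|]].
apply: down; first by lra.
apply: le_trans (@trp_return_step k x 0 _ isT _ erefl).
  by rewrite ler_wpM2r ?invr_ge0// l1//; lia.
by rewrite gadj_sym; apply/gadjP; exists 0%N.
Qed.

(** The even one among [n] and [n + 1] supplies the lower bound, with [2 (n + 1) + 1 <= 5 n]. For
    the upper bound both terms are at most [48 / n]. *)
Lemma trp_recurrent n x : (1 <= n)%N ->
  (3%:R * 36%:R * 36%:R * 5%:R)^-1 <= n%:R * (trp R F n x x + trp R F n.+1 x x) <= 96%:R.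
Proof.
move=> n1; have n1' : 1 <= n%:R :> R by rewrite ler1n.
have u0 := trp_return_le n x; have u1 := trp_return_le n.+1 x.
rewrite -[n.+1%:R]natr1 in u1; apply/andP; split; last first.
  have w : 48%:R / (n%:R + 40%:R) <= 48%:R / n%:R :> R.
    by rewrite ler_wpM2l// lef_pV2 ?posrE; lra.
  have w' : 48%:R / (n%:R + 1 + 40%:R) <= 48%:R / n%:R :> R.
    by rewrite ler_wpM2l// lef_pV2 ?posrE; lra.
  apply: (@le_trans _ _ (n%:R * (48%:R / n%:R + 48%:R / n%:R))).
    by rewrite ler_wpM2l//; lra.
  rewrite mulrDr (_ : n%:R * (48%:R / n%:R) = 48%:R); first by lra.
  by rewrite mulrCA mulfV ?mulr1//; lra.
have t0 m := trp_ge0 R F m x x.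
apply: (@le_trans _ _ (n%:R * (3%:R * 36%:R * 36%:R * (2%:R * (n%:R + 1) + 1))^-1)).
  rewrite -[leLHS]mul1r ler_pdivrMr; last by lra.
  rewrite mulrAC ler_pdivlMr; lra.
rewrite ler_wpM2l//; case: (boolP (odd n)) => on.
  apply: (@le_trans _ _ (trp R F n.+1 x x)); last by rewrite lerDr.
  by rewrite natr1; apply: trp_return_ge; rewrite /= on.
apply: (@le_trans _ _ (trp R F n x x)); last by rewrite lerDl.
apply: le_trans (trp_return_ge x on); rewrite lef_pV2 ?posrE; lra.
Qed.

End HeatKernel.

(** * The walk as a random path *)

Section Digits.
Variable R : realType.

Fixpoint digits n (j : nat) : seq 'I_6 :=
  if n is m.+1 then rcons (digits m (j %/ 6)) (inord (j %% 6)) else [::].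

Lemma sum_blocks6 (m : nat) (f : nat -> R) :
  \sum_(i < m * 6) f i = \sum_(j < m) \sum_(a < 6) f (j * 6 + a)%N.
Proof.
elim: m => [|m IH]; first by rewrite !big_ord0.
rewrite [RHS]big_ord_recr /= -IH mulSn addnC big_split_ord /=.
by congr (_ + _); apply: eq_bigr => a _; rewrite mulnC.
Qed.

Lemma mean_digits n (f : seq 'I_6 -> R) :
  mean n f = (\sum_(j < 6 ^ n) f (digits n j)) / 6%:R ^+ n.
Proof.
elim: n f => [|n IH] f; first by rewrite /= expn0 big_ord1 expr0 divr1.
rewrite mean_rcons IH expnSr (sum_blocks6 _ (fun i => f (digits n.+1 i))) exprS.
rewrite invfM mulrA; congr (_ / _); rewrite mulr_suml.
apply: eq_bigr => j _; rewrite /avg; congr (_ / _); apply: eq_bigr => a _ /=.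
by rewrite divnMDl// modnMDl divn_small// addn0 modn_small// inord_val.
Qed.

Definition unif01 := mrestr (@lebesgue_measure R) (measurable_itv `[0, 1[).

HB.instance Definition _ := Measure.on unif01.

Fact unif01_setT : unif01 [set: _] = 1%E.
Proof.
by rewrite /unif01 /mrestr /= setTI lebesgue_measure_itv /= lte_fin ltr01 oppr0 adde0.
Qed.

HB.instance Definition _ :=
  Measure_isProbability.Build _ _ R unif01 unif01_setT.

Definition scale6 n (u : R) : nat := Num.truncn (6%:R ^+ n * u).

(** Division by 6 drops the last digit, so the digit strings of one [u] extend each other and define
    a single infinite path. *)
Lemma scale6S n u : (scale6 n.+1 u %/ 6)%N = scale6 n u.
Proof.
rewrite /scale6 exprS -mulrA; set y := _ * u.
have [y0|y0] := ltP y 0.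
  (* [Num.truncn] is 0 on negative numbers. *)
  by rewrite !truncn_floor !lt_geF// pmulr_rlt0.
have /andP[h1 h2] := truncn_itv y0.
set k := Num.truncn y in h1 h2 *.
have /andP[g1 g2] : (k * 6)%N%:R <= 6%:R * y < (k.+1 * 6)%N%:R.
  by rewrite !natrM ![_ * 6%:R]mulrC ler_pM2l// ltr_pM2l// h1.
have y60 : 0 <= 6%:R * y by rewrite mulr_ge0.
rewrite -truncn_ge_nat// in g1; rewrite -truncn_lt_nat// in g2.
lia.
Qed.

Lemma scale6_fiber n j : (j < 6 ^ n)%N ->
  [set u | scale6 n u = j] `&` `[0, 1[ =
  `[j%:R / 6%:R ^+ n, j.+1%:R / 6%:R ^+ n[%classic.
Proof.
move=> jn; have n0 : 0 < 6%:R ^+ n :> R by rewrite exprn_gt0.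
have jn' : j.+1%:R <= 6%:R ^+ n :> R by rewrite -natrX ler_nat.
apply/seteqP; split=> u; rewrite /= !in_itv /= ler_pdivrMr// ltr_pdivlMr//.
  move=> [<- /andP[u0 u1]]; rewrite mulrC /scale6.
  by apply: truncn_itv; rewrite mulr_ge0// ltW.
move=> /andP[h1 h2]; have u0 : 0 <= u.
  by rewrite -(pmulr_lge0 _ n0) (le_trans _ h1).
split; last by rewrite u0 -(ltr_pM2r n0) mul1r (lt_le_trans h2).
by apply: truncn_def; rewrite mulrC h1.
Qed.

Lemma measurable_scale6 n (Q : set nat) : measurable [set u | Q (scale6 n u)].
Proof.
have mf : measurable_fun setT (fun u : R => 6%:R ^+ n * u).
  exact: mulrl_measurable.
have h j : measurable [set u | (j <= scale6 n u)%N].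
  case: j => [|j].
    by rewrite (_ : [set u | _] = setT)//; apply/seteqP; split.
  rewrite (_ : [set u | _] = (fun u : R => 6%:R ^+ n * u) @^-1` `[j.+1%:R, +oo[).
    by rewrite -[X in measurable X]setTI; apply: mf => //; exact: measurable_itv.
  by apply/seteqP; split=> u; rewrite /= in_itv /= andbT /scale6 truncn_gt_nat.
rewrite (_ : [set u | _] = \bigcup_(j in Q)
    ([set u | (j <= scale6 n u)%N] `\` [set u | (j.+1 <= scale6 n u)%N])).
  by apply: bigcup_measurable => j _; apply: measurableD.
apply/seteqP; split=> u /=.
  by move=> Qu; exists (scale6 n u) => //=; split => //; rewrite ltnn.
by move=> [j Qj /= [ju /negP uj]]; rewrite (_ : scale6 n u = j)//; lia.
Qed.

Lemma unif01_scale6 n (Q : pred nat) :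
  unif01 [set u | Q (scale6 n u)] =
  ((\sum_(j < 6 ^ n) (Q j)%:R) / 6%:R ^+ n)%:E.
Proof.
have n0 : 0 < 6%:R ^+ n :> R by rewrite exprn_gt0.
have mF (j : nat) : measurable [set u | scale6 n u = j].
  exact: (measurable_scale6 n [set j]).
have -> : unif01 [set u | Q (scale6 n u)] =
    unif01 (\big[setU/set0]_(j < 6 ^ n | Q j) [set u | scale6 n u = j]).
  rewrite /unif01 /mrestr /=; congr (lebesgue_measure _).
  rewrite big_mkcond.
  rewrite -(bigcup_mkord _ (fun j => if Q j then [set u | scale6 n u = j] else set0)).
  apply/seteqP; split=> u [/= Qu u01]; split=> //=.
    exists (scale6 n u) => /=; last by rewrite Qu.
    move: u01; rewrite /= in_itv /= => /andP[u0 u1].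
    have y0 : 0 <= 6%:R ^+ n * u by rewrite mulr_ge0// ltW.
    by rewrite /scale6 truncn_lt_nat// natrX -[ltRHS]mulr1 ltr_pM2l.
  by case: Qu => [j _]; case: ifPn => // Qj /= ->.
rewrite measure_bigsetU_ord//; last first.
  by apply/trivIsetP => i j _ _ ij; rewrite -subset0 => u /= [-> /val_inj /eqP]; rewrite (negbTE ij).
  by move=> i; exact: (mF i).
rewrite mulr_suml -sumEFin [RHS]big_mkcond [LHS]big_mkcond /=.
apply: eq_bigr => j _; case: (Q j); last by rewrite mul0r.
rewrite mul1r /unif01 /mrestr /= scale6_fiber// lebesgue_measure_itv /=.
rewrite lte_fin ltr_pM2r ?invr_gt0// ltr_nat leqnn -EFinB -mulrBl.
by rewrite -natrB// subSnn mul1r.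
Qed.

End Digits.
Arguments unif01 : clear implicits.

Section WalkMeasure.
Variables (R : realType) (T : site -> bool).
Local Notation G := (graph T).
Local Notation F := (@dstep T).

(* The walk is driven by the base 6 digits of a uniform point of [0, 1[. *)
Definition sample (x : vtx T) (u : measurableTypeR R) : path_space G :=
  fun n => foldl F x (digits n (scale6 n u)).

Lemma mkseq_sample x u n :
  mkseq (sample x u) n.+1 = trace F x (digits n (scale6 n u)).
Proof.
elim: n => [//|n IH]; rewrite mkseqS IH /= trace_rcons scale6S.
by rewrite /sample /= foldl_rcons scale6S.
Qed.

Lemma measurable_coordinate (n : nat) (A : set G) :
  measurable ([set w | A (w n)] : set (path_space G)).
Proof. by apply: sub_sigma_algebra; exists n, A. Qed.

Lemma measurable_prefix n (Q : set (seq G)) :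
  measurable ([set w | Q (mkseq w n)] : set (path_space G)).
Proof.
have h (p : seq G) : measurable ([set w | mkseq w n = p] : set (path_space G)).
  elim: n p => [|n IH] p.
    case: p => [|x p].
      by rewrite (_ : [set w | _] = setT)//; apply/seteqP; split.
    by rewrite (_ : [set w | _] = set0)//; apply/seteqP; split.
  case/lastP: p => [|p x].
    rewrite (_ : [set w | _] = set0)//; apply/seteqP; split; last by [].
    by move=> w /(congr1 size); rewrite size_mkseq.
  rewrite (_ : [set w | _] =
      [set w | mkseq w n = p] `&` [set w | [set x] (w n)]).
    by apply: measurableI => //; exact: measurable_coordinate.
  apply/seteqP; split=> w; rewrite /mkset mkseqS; first by move=> /rcons_inj[].
  by move=> [-> ->].
rewrite (_ : [set w | _] = \bigcup_(p : seq G)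
    ([set w | mkseq w n = p] `&` [set w | Q p])).
  apply: countable_bigcupT_measurable.
    exact: (@countableP (seq (vtx T))).
  move=> p; apply: measurableI => //.
  have [Qp|nQp] := pselect (Q p).
    by rewrite (_ : [set w | _] = setT)//; apply/seteqP; split.
  by rewrite (_ : [set w | _] = set0)//; apply/seteqP; split.
apply/seteqP; split=> w /=; first by move=> Qw; exists (mkseq w n).
by move=> [p _ [-> ]].
Qed.

Fact measurable_sample x : measurable_fun setT (sample x).
Proof.
apply: (@measurability _ _ (measurableTypeR R) (path_space G) setT (sample x) (coordinate_events G) erefl).
move=> _ [_ [n [A ->]] <-]; rewrite setTI.
rewrite (_ : _ @^-1` _ = [set u | [set j | A (foldl F x (digits n j))] (scale6 n u)]).
  exact: measurable_scale6.
by [].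
Qed.

HB.instance Definition _ x :=
  isMeasurableFun.Build _ _ (measurableTypeR R) (path_space G) (sample x)
    (measurable_sample x).

Definition walk_law (x : G) : probability (path_space G) R :=
  @distribution _ _ (measurableTypeR R) (path_space G) R (unif01 R) (sample x).

Lemma walk_lawE x n (Q : pred (seq G)) :
  walk_law x [set w | Q (mkseq w n.+1)] =
  (mean n (fun s => (Q (trace F x s))%:R : R))%:E.
Proof.
rewrite /walk_law /distribution /pushforward /= /preimage /=.
under eq_fun do rewrite mkseq_sample.
by rewrite (unif01_scale6 R n (fun j => Q (trace F x (digits n j)))) mean_digits.
Qed.

End WalkMeasure.

(** * Green function and visited lattice points *)

Section Occupation.
Variable R : realType.

Lemma lwalk_level0_sum n l j :
  n.+1%:R / 2%:R - 2%:R
    <= \sum_(k < n.+1) lwalk k (fun lj => (lj.1 == 0%N)%:R : R) (l, j)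
    <= n.+1%:R / 2%:R + 2%:R.
Proof.
(* [phi] solves the Poisson equation [1_{l = 0} + avg phi = phi + 1 / 2]. *)
pose phi l : R := match l with 0%N => 3%:R / 2%:R | 1%N => 0 | _ => - 2%:R^-1 end.
have phi2 m : - 2%:R^-1 <= phi m <= 3%:R / 2%:R by case: m => [|[|m]] /=; lra.
suff : n.+1%:R / 2%:R + phi l - 3%:R / 2%:R
    <= \sum_(k < n.+1) lwalk k (fun lj => (lj.1 == 0%N)%:R) (l, j)
    <= n.+1%:R / 2%:R + phi l + 2%:R^-1 by have := phi2 l; lra.
elim: n l j => [|n IH] l j.
  by rewrite big_ord1 /lwalk /=; case: l => [|[|l]] /=; lra.
rewrite big_ord_recl.
have -> : lwalk (@ord0 n.+1) (fun lj => (lj.1 == 0%N)%:R : R) (l, j) = (l == 0%N)%:R.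
  by [].
have e := @natr1 R n.+1; have j0 : 0 <= n.+1%:R :> R by [].
case: l => [|[|l]].
- under eq_bigr => k _ do rewrite lift0 lwalk0S.
  rewrite big_split /= -!mulr_sumr.
  have /= := IH 0%N j.+1; have /= := IH 1%N j; lra.
- under eq_bigr => k _ do rewrite lift0 lwalk1S.
  rewrite -mulr_suml big_split /=.
  have /= := IH 0%N j; have /= := IH 2%N j; lra.
under eq_bigr => k _ do rewrite lift0 lwalk2S.
by have /= := IH 1%N j; lra.
Qed.

(** The Green function at any lattice point ([green_rootE]), in a form where the types do not
    occur. *)
Definition rgreen n : R :=
  \sum_(k < n.+1) lwalk k (fun lj => (lj.1 == 0%N)%:R * walk2 R lj.2 0) (0%N, 0%N).

End Occupation.

Definition snorm (v : site) : nat := maxn `|v.1| `|v.2|.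

Definition box (M : nat) : seq site :=
  [seq (i%:Z - M%:Z, j%:Z - M%:Z) | i <- iota 0 M.*2.+1, j <- iota 0 M.*2.+1].

Lemma mem_box M v : (v \in box M) = (snorm v <= M)%N.
Proof.
case: v => p q; rewrite /snorm geq_max; apply/allpairsP/andP.
  move=> [[i j]]; rewrite !mem_iota => -[/= iM jM [-> ->]]; split; lia.
move=> [+ +]; rewrite ![(_, _).1]/= ![(_, _).2]/= => pM qM; exists (absz (p + M%:Z), absz (q + M%:Z)).
by rewrite !mem_iota /=; split; [lia|lia|congr pair; lia].
Qed.

Lemma box_uniq M : uniq (box M).
Proof.
apply: allpairs_uniq; rewrite ?iota_uniq// => -[i j] [i' j'] _ _ /= [].
by move=> h1 h2; congr pair; lia.
Qed.

Section Moments.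
Variables (R : realType) (T : site -> bool).
Implicit Types x y z : vtx T.
Local Notation F := (@dstep T).
Local Notation rg := (rgreen R).

Lemma level_nstep x k j : level (nstep x k) = (lstep (level x, j) k).1.
Proof.
by case: x => -[v [[i []]|]] vx; rewrite /level /= /raw_step /lstep /=;
  [|case: (odd k)|case: ifP].
Qed.

Lemma snorm_nstep x k : (snorm (site_of (nstep x k)) <= (snorm (site_of x)).+1)%N.
Proof.
case: x => -[[p q] [[i []]|]] vx; rewrite /site_of /= /raw_step /snorm /=; try lia.
by case: ltnP => k4 /=; [|lia]; move: k k4; do 4 (case=> [_ /=|]; first lia).
Qed.

Lemma snorm_trace x s z : z \in trace F x s ->
  (snorm (site_of z) <= snorm (site_of x) + size s)%N.
Proof.
elim: s x => [|a s IH] x /=; rewrite inE; first by move=> /eqP ->; rewrite addn0.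
move=> /orP[/eqP ->|/IH]; first exact: leq_addr.
by move=> h; apply: leq_trans h _; rewrite addnS -addSn leq_add2r snorm_nstep.
Qed.

Lemma iter_op_level n (phi : nat -> R) x j :
  iter_op F n (fun z => phi (level z)) x =
  lwalk n (fun lj => phi lj.1) (level x, j).
Proof.
elim: n x j => [//|n IH] x j.
rewrite /lwalk /=; apply: eq_avg => a; rewrite /dstep.
by case e : (lstep _ _) => [l' j']; rewrite (IH _ j') (level_nstep x a j) e.
Qed.

Lemma green_rootE n v : green R F n (root T v) (root T v) = rg n.
Proof.
by apply: eq_bigr => k _; rewrite trp_rootE site_root subrr.
Qed.

Lemma rgreen_ge1 n : 1 <= rg n.
Proof. by rewrite -(green_rootE n 0); apply: green_ge1. Qed.

Lemma le_rgreen m n : (m <= n)%N -> rg m <= rg n.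
Proof. by rewrite -!(green_rootE _ 0); apply: le_green. Qed.

Lemma sum_roots_le1 (r : seq site) z : uniq r ->
  \sum_(v <- r) (z == root T v)%:R <= (level z == 0%N)%:R :> R.
Proof.
move=> ur; case: eqP => lz; last first.
  rewrite big1// => v _; rewrite eq_rootE; case: (level z =P 0%N) => //.
  by rewrite andbF.
rewrite (eq_bigr (fun v => (v == site_of z)%:R)); last first.
  by move=> v _; rewrite eq_rootE lz eqxx andbT eq_sym.
rewrite -natr_sum (eq_bigr (fun v => if v == site_of z then 1%N else 0%N)).
  by rewrite -big_mkcond /= sum1_count count_uniq_mem// lern1 leq_b1.
by move=> v _; case: eqP.
Qed.

Lemma sum_trp_roots_le n x (r : seq site) : uniq r ->
  \sum_(v <- r) trp R F n x (root T v) <=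
  iter_op F n (fun z => (level z == 0%N)%:R) x.
Proof.
move=> ur; rewrite /trp -iter_op_sum; apply: ler_iter_op => z.
exact: sum_roots_le1.
Qed.

Lemma sum_trp_roots n x M : (snorm (site_of x) + n <= M)%N ->
  \sum_(v <- box M) trp R F n x (root T v) =
  iter_op F n (fun z => (level z == 0%N)%:R) x.
Proof.
elim: n x => [|n IH] x xM.
  apply/eqP; rewrite eq_le sum_trp_roots_le ?box_uniq//= /trp /=.
  case: eqP => lx; last by apply: sumr_ge0.
  rewrite (bigD1_seq (site_of x)) ?box_uniq ?mem_box//=; last by rewrite -(addn0 (snorm _)).
  by rewrite eq_rootE lx !eqxx lerDl sumr_ge0.
rewrite /trp /= -avg_sum; apply: eq_avg => a; apply: IH.
by apply: leq_trans xM; rewrite addnS -addSn leq_add2r snorm_nstep.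
Qed.

Lemma sum_green_roots_le n x (r : seq site) : uniq r ->
  \sum_(v <- r) green R F n x (root T v) <= n.+1%:R / 2%:R + 2%:R.
Proof.
move=> ur; rewrite exchange_big /=.
apply: (@le_trans _ _
  (\sum_(k < n.+1) iter_op F k (fun z => (level z == 0%N)%:R) x)).
  by apply: ler_sum => k _; apply: sum_trp_roots_le.
under eq_bigr do rewrite (iter_op_level _ (fun l => (l == 0%N)%:R) _ 0).
by have /andP[] := lwalk_level0_sum R n (level x) 0.
Qed.

Lemma sum_green_roots_ge n x M : (snorm (site_of x) + n <= M)%N ->
  n.+1%:R / 2%:R - 2%:R <= \sum_(v <- box M) green R F n x (root T v).
Proof.
move=> xM; rewrite exchange_big /=.
have -> : \sum_(k < n.+1) \sum_(v <- box M) trp R F k x (root T v) =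
    \sum_(k < n.+1) lwalk k (fun lj => (lj.1 == 0%N)%:R) (level x, 0%N).
  apply: eq_bigr => k _; rewrite sum_trp_roots.
    exact: (iter_op_level _ (fun l => (l == 0%N)%:R)).
  by apply: leq_trans xM; rewrite leq_add2l -ltnS.
by have /andP[] := lwalk_level0_sum R n (level x) 0.
Qed.

(** A point visited by time [n] receives at least [rg h] expected visits by time [n + h], and
    lattice points are occupied for about half of that time. The bound is sharp when [h] is small
    compared with [n] but [rg h] is close to [rg n], so [h] is left free. *)
Lemma sum_hit_le n h x (r : seq site) : uniq r ->
  \sum_(v <- r) hit R F n x (root T v)
    <= (2%:R * rg h)^-1 * (n%:R + (h%:R + 5%:R)).
Proof.
move=> ur; have g1 := rgreen_ge1 h.
rewrite -[leRHS]mulrC ler_pdivlMr; last by lra.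
rewrite mulrCA mulr_suml.
have := sum_green_roots_le (n + h) x ur.
have : \sum_(v <- r) hit R F n x (root T v) * rg h <=
       \sum_(v <- r) green R F (n + h) x (root T v).
  by apply: ler_sum => v _; rewrite -(green_rootE h v) hit_green_le.
rewrite -natr1 natrD; lra.
Qed.

Lemma sum_hit_ge n x M : (snorm (site_of x) + n <= M)%N ->
  (n%:R - 3%:R) / (2%:R * rg n) <= \sum_(v <- box M) hit R F n x (root T v).
Proof.
move=> xM; have g1 := rgreen_ge1 n.
rewrite ler_pdivrMr; last by lra.
rewrite mulrCA mulr_suml.
have := sum_green_roots_ge xM.
have : \sum_(v <- box M) green R F n x (root T v) <=
       \sum_(v <- box M) hit R F n x (root T v) * rg n.
  by apply: ler_sum => v _; rewrite -(green_rootE n v) green_le_hit.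
rewrite -natr1; lra.
Qed.

Definition nroots (r : seq site) x (s : seq 'I_6) : R :=
  \sum_(v <- r) (root T v \in trace F x s)%:R.

Lemma mean_nroots n r x :
  mean n (nroots r x) = \sum_(v <- r) hit R F n x (root T v).
Proof. by rewrite mean_sum; apply: eq_bigr => v _; rewrite mean_mem_trace. Qed.

(** Pairs of visited points are split by the order of their first visits. The leading term [b^2 n^2]
    is the square of that of the bound [b (n + c)] on the mean; this exact constant is what makes
    Chebyshev's inequality effective. *)
Lemma mean_nroots_sqr n h r x : uniq r ->
  mean n (fun s => nroots r x s ^+ 2)
    <= (2%:R * rg h)^-1 ^+ 2 * (n%:R + 2%:R * (h%:R + 5%:R)) ^+ 2.
Proof.
move=> ur; set b := _^-1; set c : R := h%:R + 5%:R.
have b0 : 0 <= b by rewrite invr_ge0; have := rgreen_ge1 h; lra.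
have c0 : 0 <= c by rewrite addr_ge0.
have hb m y : \sum_(v <- r) hit R F m y (root T v) <= b * (m%:R + c).
  exact: sum_hit_le.
apply: (@le_trans _ _ (2%:R * \sum_(v <- r) \sum_(w <- r)
    hit_then R F n x (root T v) (root T w))).
  rewrite [leLHS](_ : _ = \sum_(v <- r) \sum_(w <- r) mean n (fun s =>
      ((root T v \in trace F x s) && (root T w \in trace F x s))%:R : R)).
    rewrite mulr_natl mulr2n [X in _ <= _ + X]exchange_big -big_split /=; apply: ler_sum => v _.
    rewrite -big_split /=; apply: ler_sum => w _; exact: mean_mem_trace2.
  under [RHS]eq_bigr do rewrite -mean_sum.
  rewrite -mean_sum; apply: eq_mean => s _; rewrite expr2 mulr_suml.
  apply: eq_bigr => v _; rewrite mulr_sumr; apply: eq_bigr => w _.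
  by rewrite -natrM mulnb.
apply: (@le_trans _ _ (2%:R * \sum_(v <- r)
    b * (c * hit R F n x (root T v) + \sum_(m < n) hit R F m x (root T v)))).
  rewrite ler_wpM2l//; apply: ler_sum => v _.
  have -> : \sum_(w <- r) hit_then R F n x (root T v) (root T w) =
      \sum_(z <- [seq root T w | w <- r]) hit_then R F n x (root T v) z.
    by rewrite big_map.
  by apply: sum_hit_then_le => m _; rewrite big_map.
rewrite -mulr_sumr big_split /= -mulr_sumr exchange_big /=.
have h1 : \sum_(m < n) \sum_(v <- r) hit R F m x (root T v) <=
    b * (n%:R ^+ 2 / 2%:R + n%:R * c).
  apply: (@le_trans _ _ (\sum_(m < n) b * (m%:R + c))); first by apply: ler_sum.
  rewrite -mulr_sumr ler_wpM2l// big_split /= sumr_const card_ord -[c *+ n]mulr_natl.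
  rewrite lerD2r; elim: (n) => [|k IH]; first by rewrite big_ord0 expr0n mul0r.
  by rewrite big_ord_recr /= -[k.+1%:R]natr1; have k0 : 0 <= k%:R :> R by []; nra.
have h2 := hb n x; have n0 : 0 <= n%:R :> R by [].
set H := \sum_(v <- r) _ in h2 *; set K := \sum_(m < n) _ in h1 *.
apply: (@le_trans _ _ (2%:R * (b * (c * (b * (n%:R + c)) +
    b * (n%:R ^+ 2 / 2%:R + n%:R * c))))).
  by rewrite ler_wpM2l// ler_wpM2l// lerD// ler_wpM2l.
rewrite [leLHS](_ : _ = b ^+ 2 * (n%:R ^+ 2 + 4%:R * (n%:R * c) + 2%:R * c ^+ 2)).
  by rewrite ler_wpM2l ?sqr_ge0//; have := sqr_ge0 c; lra.
by field.
Qed.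

End Moments.

(** * Logarithmic growth of the Green function *)

Section GreenGrowth.
Variable R : realType.

(** The lower constant of [trp_recurrent]. *)
Definition kappa : R := (3%:R * 36%:R * 36%:R * 5%:R)^-1.

Lemma kappa_gt0 : 0 < kappa. Proof. by rewrite invr_gt0; lra. Qed.

Variable T : site -> bool.
Local Notation F := (@dstep T).

Lemma green_double n (y : vtx T) : green R F n.*2 y y =
  green R F n y y + \sum_(i < n) trp R F (n.+1 + i) y y.
Proof. by rewrite /green -addnn -addSn big_split_ord. Qed.

(** The new times form [n - 1] pairs of consecutive ones, each contributing at least
    [kappa / (2 n)], in total at least [kappa / 4]; every time is counted at most twice. *)
Lemma green_double_ge n (y : vtx T) : (2 <= n)%N ->
  green R F n y y + kappa / 8%:R <= green R F n.*2 y y.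
Proof.
move=> n2; rewrite green_double lerD2l; have k0 := kappa_gt0.
pose t i := trp R F (n.+1 + i) y y.
have t0 i : 0 <= t i by apply: trp_ge0.
have n2' : 2%:R <= n%:R :> R by rewrite ler_nat.
have h : \sum_(i < n.-1) (t i + t i.+1) <= 2%:R * \sum_(i < n) t i.
  rewrite big_split /= mulr_natl mulr2n; apply: lerD.
    case: (n) n2 => [//|m] _; rewrite big_ord_recr /= lerDl; exact: t0.
  case: (n) n2 => [//|m] _; rewrite [leRHS]big_ord_recl /=.
  by rewrite lerDr; exact: t0.
have g : kappa / 4%:R <= \sum_(i < n.-1) (t i + t i.+1).
  apply: (@le_trans _ _ (\sum_(i < n.-1) kappa / (2%:R * n%:R))).
    rewrite sumr_const card_ord -[_ *+ n.-1]mulr_natl -subn1 natrB; last by lia.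
    have q : 4%:R^-1 <= (n%:R - 1) / (2%:R * n%:R) :> R.
      by rewrite ler_pdivlMr; lra.
    by rewrite mulrCA ler_wpM2l// ltW.
  apply: ler_sum => -[i /= i_n] _.
  have := trp_recurrent R y (ltn0Sn (n + i)); rewrite -/kappa => /andP[+ _].
  rewrite -addSn -addnS => tk.
  have s0 : 0 <= t i + t i.+1 by apply: addr_ge0.
  have m2 : (n.+1 + i)%N%:R <= 2%:R * n%:R :> R by rewrite -natrM ler_nat; lia.
  rewrite ler_pdivrMr; last by lra.
  apply: (le_trans tk); rewrite mulrC -/(t i) -/(t i.+1).
  by rewrite ler_wpM2l.
lra.
Qed.

Lemma green_pow_ge k (y : vtx T) :
  k%:R * (kappa / 8%:R) <= green R F (2 ^ k.+1) y y.
Proof.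
elim: k => [|k IH]; first by rewrite mul0r; apply: green_ge0.
rewrite expnS mul2n -natr1 mulrDl mul1r.
apply: le_trans (@green_double_ge _ y _); last by rewrite -[2%N]expn1 leq_exp2l.
by rewrite lerD2r.
Qed.

End GreenGrowth.

Section RootGreen.
Variable R : realType.
Local Notation T0 := ((fun=> true) : site -> bool).

Definition gpow k : R := rgreen R (2 ^ k).

Lemma gpow_ge1 k : 1 <= gpow k. Proof. exact: (rgreen_ge1 R T0). Qed.

Lemma gpow_gt0 k : 0 < gpow k. Proof. exact: lt_le_trans (gpow_ge1 k). Qed.

Lemma le_gpow m n : (m <= n)%N -> gpow m <= gpow n.
Proof. by move=> mn; apply: (le_rgreen R T0); rewrite leq_exp2l. Qed.

Lemma gpow_ge k : k%:R * (kappa R / 8%:R) <= gpow k.+1.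
Proof. by rewrite /gpow -(green_rootE R T0 _ 0); apply: green_pow_ge. Qed.

(** Doubling the time adds [2 ^ k] return probabilities, each at most 48 divided by [2 ^ k]. *)
Lemma gpow_leS k : gpow k.+1 <= gpow k + 48%:R.
Proof.
rewrite /gpow -!(green_rootE R T0 _ 0) expnS mul2n green_double lerD2l.
set n := (2 ^ k)%N; have n1 : 1 <= n%:R :> R by rewrite ler1n expn_gt0.
apply: (@le_trans _ _ (\sum_(i < n) 48%:R / n%:R)).
  apply: ler_sum => i _; apply: (le_trans (trp_return_le _ _ _)).
  rewrite ler_wpM2l// lef_pV2 ?posrE; [|by apply: ltr_wpDl|by lra].
  by rewrite ler_wpDr// ler_nat; lia.
by rewrite sumr_const card_ord -[_ *+ n]mulr_natl mulrCA mulfV ?mulr1//; lra.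
Qed.

Lemma gpow_sub_le k s : (s <= k)%N -> gpow k <= gpow (k - s) + 48%:R * s%:R.
Proof.
elim: s => [|s IH] sk; first by rewrite subn0 mulr0 addr0.
apply: (le_trans (IH (ltnW sk))); have := gpow_leS (k - s.+1).
by rewrite subnSK// -natr1; lra.
Qed.

Lemma gpow_le k : gpow k <= 50%:R * k.+1%:R.
Proof.
have := gpow_sub_le (leqnn k); rewrite subnn.
have : gpow 0 <= 2%:R.
  rewrite /gpow -(green_rootE R T0 _ 0) expn0 /green !big_ord_recl big_ord0 addr0.
  have h m : trp R (@dstep T0) m (root T0 0) (root T0 0) <= 1.
    by rewrite -(iter_op_cst (@dstep T0) m 1 (root T0 0));
      apply: ler_iter_op => z; case: eqP.
  by apply: lerD.
have k0 : 0 <= k%:R :> R by []. rewrite -[k.+1%:R]natr1; lra.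
Qed.

End RootGreen.

(** * Moments and tails of the range *)

Section Range.
Variable T : site -> bool.
Implicit Types x y z : vtx T.
Local Notation F := (@dstep T).

Definition range_of x (s : seq 'I_6) : nat := size (undup (trace F x s)).

Lemma range_of_catl x s t : (range_of x s <= range_of x (s ++ t))%N.
Proof.
apply: uniq_leq_size; rewrite ?undup_uniq// => y.
by rewrite !mem_undup mem_trace_cat inE => ->.
Qed.

Lemma range_of_catr x s t :
  (range_of (foldl F x s) t <= range_of x (s ++ t))%N.
Proof.
apply: uniq_leq_size; rewrite ?undup_uniq// => y.
by rewrite !mem_undup mem_trace_cat inE orbC => ->.
Qed.

Lemma range_of_cat_le x s t :
  (range_of x (s ++ t) <= range_of x s + range_of (foldl F x s) t)%N.
Proof.
rewrite -size_cat; apply: uniq_leq_size; rewrite ?undup_uniq// => y.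
by rewrite mem_cat !mem_undup mem_trace_cat inE.
Qed.

Lemma sum_mem_le (S : eqType) (r p : seq S) : uniq r ->
  (\sum_(u <- r) (u \in p) <= size (undup p))%N.
Proof.
move=> ur; rewrite (eq_bigr (fun u => if u \in p then 1%N else 0%N)); last first.
  by move=> u _; case: (u \in p).
rewrite -big_mkcond /= sum1_count -size_filter.
apply: uniq_leq_size; first exact: filter_uniq.
by move=> u; rewrite mem_filter mem_undup => /andP[].
Qed.

(** [insub] discards the fifth candidate exactly where [T v] is false. *)
Definition fiber (v : site) : seq (vtx T) :=
  pmap insub [:: (v, None); (v, Some (false, false)); (v, Some (true, false));
                 (v, Some (false, true)); (v, Some (true, true))].

Lemma mem_fiber v y : (y \in fiber v) = (site_of y == v).
Proof.
rewrite mem_pmap_sub; case: y => -[w m] vy; rewrite /site_of /=.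
apply/idP/eqP => [e0|e].
  by move: e0; rewrite !inE => /or4P[|||/orP[]] /eqP/(congr1 fst).
by rewrite !inE !xpair_eqE e eqxx; move: m {vy} => [[[] []]|].
Qed.

Lemma fiber_uniq v : uniq (fiber v).
Proof. by apply: pmap_sub_uniq; rewrite /= !inE !xpair_eqE !andbF. Qed.

Lemma size_fiber v : size (fiber v) = (4 + T v)%N.
Proof.
rewrite size_pmap_sub /= /valid_mark /=.
by case: (T v).
Qed.

Lemma range_of_le_sites x s (r : seq site) :
  (forall y, y \in trace F x s -> site_of y \in r) ->
  (range_of x s <= \sum_(v <- r) (4 + T v))%N.
Proof.
move=> hr.
have -> : (\sum_(v <- r) (4 + T v) = size (flatten [seq fiber v | v <- r]))%N.
  rewrite size_flatten /shape -map_comp sumnE big_map.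
  by apply: eq_bigr => v _; rewrite -size_fiber.
apply: uniq_leq_size; first exact: undup_uniq.
move=> y; rewrite mem_undup => /hr yr.
by apply/flattenP; exists (fiber (site_of y)); rewrite ?map_f// mem_fiber.
Qed.

(** A site other than the initial one can only be entered through its lattice point. *)
Lemma root_in_trace x s y : y \in trace F x s ->
  site_of y = site_of x \/ root T (site_of y) \in trace F x s.
Proof.
elim: s x => [|a s IH] x /=; rewrite !inE; first by move=> /eqP ->; left.
move=> /orP[/eqP ->|]; first by left.
move=> /IH[->|ys]; last by right; rewrite ys orbT.
have [->|sx] := eqVneq (site_of (dstep x a)) (site_of x); first by left.
right; suff <- : dstep x a = root T (site_of (dstep x a)) by rewrite mem_trace_head orbT.
move: sx; rewrite /dstep; case: x => -[v [[i []]|]] vx; rewrite /site_of /= ?eqxx//.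
  rewrite /raw_step /=; case: ltnP => //=; last by rewrite eqxx.
by move=> a4 _; apply: val_inj; rewrite /= /raw_step /= a4.
Qed.

Lemma range_of_le_roots x s M : (snorm (site_of x) + size s <= M)%N ->
  (range_of x s <= 5 + \sum_(v <- box M) (4 + T v) * (root T v \in trace F x s))%N.
Proof.
move=> xM; pose r := [seq v <- box M | root T v \in trace F x s].
apply: (@leq_trans (\sum_(v <- site_of x :: r) (4 + T v))).
  apply: range_of_le_sites => y ys; rewrite inE.
  have [->|yr] := root_in_trace ys; first by rewrite eqxx.
  rewrite mem_filter yr mem_box orbC.
  by rewrite (leq_trans (snorm_trace ys)).
rewrite big_cons big_filter leq_add//; first by case: (T _).
rewrite big_mkcond /=; apply: leq_sum => v _.
by case: ifP; rewrite ?muln1.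
Qed.

Lemma range_of_root_le v s M : (snorm v + size s <= M)%N ->
  (range_of (root T v) s <=
   \sum_(w <- box M) (4 + T w) * (root T w \in trace F (root T v) s))%N.
Proof.
move=> vM; pose r := [seq w <- box M | root T w \in trace F (root T v) s].
apply: (@leq_trans (\sum_(w <- r) (4 + T w))).
  apply: range_of_le_sites => y ys.
  rewrite mem_filter mem_box (leq_trans (snorm_trace ys))// andbT.
  by have [->|//] := root_in_trace ys; rewrite site_root mem_trace_head.
rewrite big_filter big_mkcond /=; apply: leq_sum => w _.
by case: ifP; rewrite ?muln1.
Qed.

Lemma nroots_le_range (R : realType) r x s : uniq r ->
  nroots R r x s <= (range_of x s)%:R.
Proof.
move=> ur; rewrite /nroots -natr_sum ler_nat.
rewrite (_ : \sum_(v <- r) _ = \sum_(y <- map (root T) r) (y \in trace F x s))%N.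
  by apply: sum_mem_le; rewrite map_inj_uniq//; exact: root_inj.
by rewrite big_map.
Qed.

End Range.

Section Tails.
Variables (R : realType) (T : site -> bool).
Implicit Types x y z : vtx T.
Local Notation F := (@dstep T).
Local Notation g := (gpow R).

Lemma pow2_ge (k : nat) : k.+1%:R <= (2 ^ k)%:R :> R.
Proof. by rewrite ler_nat ltn_expl. Qed.

(** Over [s] doublings [g] grows by at most [48 s], while [g k] is at least [k] times
    [kappa / 16]. *)
Lemma gpow_ratio k s : (2 <= k)%N -> (s <= k)%N ->
  1 - g (k - s) / g k <= 48%:R * 16%:R / kappa R * (s%:R / k%:R).
Proof.
move=> k2 sk; have g0 := gpow_gt0 R k; have k0 := kappa_gt0 R.
have kk : 0 < k%:R :> R by rewrite ltr0n; lia.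
have s0 : 0 <= s%:R :> R by [].
have h1 := gpow_sub_le R sk.
have h2 : k%:R * (kappa R / 16%:R) <= g k.
  case: k k2 {sk g0 h1} kk => [//|k] k2 kk.
  apply: le_trans (gpow_ge R k); have k1 : 1 <= k%:R :> R by rewrite ler1n; lia.
  by rewrite -natr1; nra.
rewrite -{1}[1](divff (lt0r_neq0 g0)) -mulrBl ler_pdivrMr//.
apply: (@le_trans _ _ (48%:R * s%:R)); first by lra.
apply: (@le_trans _ _ (48%:R * 16%:R / kappa R * (s%:R / k%:R) * (k%:R * (kappa R / 16%:R)))).
  rewrite [leRHS](_ : _ = 48%:R * s%:R)//.
  by field; rewrite !gt_eqF.
by rewrite ler_wpM2l// !mulr_ge0// ?invr_ge0 ltW.
Qed.

(** The 4 comes from Chebyshev's inequality at half the mean. In units of [1 / s], the terms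
    [2 (1 - q)], [4 d], [4 d^2] and [6 q / n] of the variance estimate below contribute
    [2 * 48 * 16 / kappa], 24, 144 and 6. *)
Definition dev_cst : R := 4%:R * (2%:R * (48%:R * 16%:R) / kappa R + 6%:R * 29%:R).

(* Chebyshev's inequality, with the moments of [nroots] at time [2 ^ k]
   estimated through the Green function at time [2 ^ (k - s)]. *)
Lemma nroots_deviation k s x M : (2 <= k)%N -> (0 < s)%N -> (s * s <= k)%N ->
  (snorm (site_of x) + 2 ^ k <= M)%N ->
  mean (2 ^ k) (fun t => (nroots R (box M) x t <= (2 ^ k)%:R / (4%:R * g k))%R%:R : R)
    <= dev_cst / s%:R.
Proof.
move=> k2 s1 ssk xM; have sk : (s <= k)%N by nia.
set n := (2 ^ k)%N; set h := (2 ^ (k - s))%N.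
have gk := gpow_ge1 R k; have gh := gpow_ge1 R (k - s).
have ghk : g (k - s) <= g k by apply: le_gpow; exact: leq_subr.
have n0 : 0 < n%:R :> R by rewrite ltr0n expn_gt0.
have s0 : 1 <= s%:R :> R by rewrite ler1n.
pose b := (2%:R * g (k - s))^-1; have b0 : 0 < b by rewrite invr_gt0; lra.
pose c : R := h%:R + 5%:R.
have m2 := mean_nroots_sqr R n h x (box_uniq M); rewrite -/b -/c in m2.
have m1 : (n%:R - 3%:R) / (2%:R * g k) <= mean n (nroots R (box M) x).
  by rewrite mean_nroots; apply: sum_hit_ge.
pose q := g (k - s) / g k.
have q0 : 0 < q by rewrite divr_gt0// (lt_le_trans ltr01).
have q1 : q <= 1 by rewrite ler_pdivrMr ?mul1r// (lt_le_trans ltr01).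
have var : mean n (fun t => (nroots R (box M) x t - b * n%:R) ^+ 2) <=
    b ^+ 2 * ((n%:R + 2%:R * c) ^+ 2 - 2%:R * n%:R * (n%:R - 3%:R) * q + n%:R ^+ 2).
  have -> : mean n (fun t => (nroots R (box M) x t - b * n%:R) ^+ 2) =
      mean n (fun t => nroots R (box M) x t ^+ 2)
      - 2%:R * (b * n%:R) * mean n (nroots R (box M) x) + (b * n%:R) ^+ 2.
    rewrite -[X in _ + X](mean_cst n) -meanZ -meanB -meanD.
    by apply: eq_mean => t _; ring.
  have e : (n%:R - 3%:R) / (2%:R * g k) = b * ((n%:R - 3%:R) * q).
    by rewrite /b /q; field; apply/andP; split; lra.
  rewrite e in m1.
  have : 2%:R * (b * n%:R) * (b * ((n%:R - 3%:R) * q)) <=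
         2%:R * (b * n%:R) * mean n (nroots R (box M) x).
    by rewrite ler_wpM2l// !mulr_ge0// ltW.
  have -> : b ^+ 2 * ((n%:R + 2%:R * c) ^+ 2 - 2%:R * n%:R * (n%:R - 3%:R) * q + n%:R ^+ 2)
    = b ^+ 2 * (n%:R + 2%:R * c) ^+ 2 - 2%:R * (b * n%:R) * (b * ((n%:R - 3%:R) * q))
      + (b * n%:R) ^+ 2 by ring.
  by move: m2; lra.
(* The threshold is at most half of the centring value [b n], so a path counted here deviates from
   it by at least [b n / 2]. *)
have thr : n%:R / (4%:R * g k) <= b * n%:R / 2%:R.
  rewrite [leRHS](_ : _ = n%:R / (4%:R * g (k - s))); last by rewrite /b; field; lra.
  by rewrite ler_wpM2l// lef_pV2 ?posrE; lra.
apply: (@le_trans _ _ (mean n (fun t =>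
    (4%:R / (b * n%:R) ^+ 2) * (nroots R (box M) x t - b * n%:R) ^+ 2))).
  apply: ler_mean => t _; have [tle|_] := leP (nroots _ _ _ _) _; last first.
    by rewrite mulr_ge0 ?sqr_ge0// divr_ge0 ?sqr_ge0.
  have bn0 : 0 < b * n%:R by rewrite mulr_gt0.
  rewrite mulrAC ler_pdivlMr ?exprn_gt0// mul1r.
  have : 0 <= nroots R (box M) x t by apply: sumr_ge0.
  move: (nroots _ _ _ _) tle => N tle N0; nra.
rewrite meanZ; apply: (@le_trans _ _ (4%:R / (b * n%:R) ^+ 2 * (b ^+ 2 *
   ((n%:R + 2%:R * c) ^+ 2 - 2%:R * n%:R * (n%:R - 3%:R) * q + n%:R ^+ 2)))).
  by rewrite ler_wpM2l// divr_ge0// sqr_ge0.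
pose d := c / n%:R.
rewrite [leLHS](_ : _ = 4%:R * (2%:R * (1 - q) + 4%:R * d + 4%:R * d ^+ 2 + 6%:R * (q / n%:R))); last first.
  by rewrite /d; field; rewrite !gt_eqF.
have sV : 0 < s%:R^-1 :> R by rewrite invr_gt0; lra.
have hn : h%:R / n%:R <= s%:R^-1 :> R.
  rewrite ler_pdivrMr// mulrC ler_pdivlMr; last by lra.
  rewrite -natrM ler_nat /n -{1}(subnK sk) expnD leq_mul2l.
  by rewrite (leq_trans _ (ltn_expl s (ltnSn 1))) ?orbT.
have nV : n%:R^-1 <= s%:R^-1 :> R.
  rewrite lef_pV2 ?posrE ?ler_nat; [|by []|by lra].
  by rewrite (leq_trans sk)// ltnW// ltn_expl.
have c0 : 0 <= c by rewrite addr_ge0.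
have d0 : 0 <= d by apply: divr_ge0.
have d1 : d <= 6%:R * s%:R^-1.
  by rewrite /d /c mulrDl; lra.
have sV1 : s%:R^-1 <= 1 :> R by rewrite invf_le1//; lra.
have d2 : d ^+ 2 <= 36%:R * s%:R^-1 by nra.
have q3 : q / n%:R <= s%:R^-1.
  by apply: le_trans nV; rewrite -[leRHS]mul1r ler_wpM2r// invr_ge0 ltW.
have q4 : 1 - q <= 48%:R * 16%:R / kappa R * s%:R^-1.
  apply: le_trans (gpow_ratio k2 sk) _; rewrite ler_wpM2l//.
    by rewrite divr_ge0// ltW// kappa_gt0.
  have kk : 0 < k%:R :> R by rewrite ltr0n (leq_trans _ k2).
  have ss : 0 < s%:R :> R by rewrite ltr0n.
  by rewrite ler_pdivrMr// mulrC ler_pdivlMr// -natrM ler_nat.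
rewrite /dev_cst; move: q4; rewrite -[2%:R * _ / _]mulrA; set K := _ / kappa R.
lra.
Qed.

Lemma range_lower_dev k s x : (2 <= k)%N -> (0 < s)%N -> (s * s <= k)%N ->
  mean (2 ^ k) (fun t => ((range_of x t)%:R <= (2 ^ k)%:R / (4%:R * g k))%R%:R : R)
    <= dev_cst / s%:R.
Proof.
move=> k2 s1 ssk.
apply: le_trans (nroots_deviation k2 s1 ssk (leqnn (snorm (site_of x) + 2 ^ k))).
apply: ler_mean => t _; have [h1|_] := leP ((range_of x t)%:R : R) _; last by [].
by rewrite (le_trans (nroots_le_range _ _ _ (box_uniq _)) h1).
Qed.

(* The range of a walk is at least the range of any of its pieces, and pieces
   are independent given their starting points. *)
Lemma range_le_block (b p q : R) m n x : 0 <= q ->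
  (forall y, mean n (fun t => ((range_of y t)%:R <= b)%R%:R : R) <= q) ->
  mean m (fun t => ((range_of x t)%:R <= b)%R%:R : R) <= p ->
  mean (m + n) (fun t => ((range_of x t)%:R <= b)%R%:R : R) <= p * q.
Proof.
move=> q0 hq hp; rewrite mean_cat.
apply: (@le_trans _ _ (mean m (fun t => ((range_of x t)%:R <= b)%R%:R * q))).
  apply: ler_mean => s _.
  apply: (@le_trans _ _ (mean n (fun t =>
      ((range_of x s)%:R <= b)%R%:R * ((range_of (foldl F x s) t)%:R <= b)%R%:R))).
    apply: ler_mean => t _; have [h|_] := leP ((range_of x (s ++ t))%:R : R) b; last by rewrite mulr_ge0.
    have h1 : (range_of x s)%:R <= b.
      by apply: le_trans h; rewrite ler_nat range_of_catl.
    have h2 : (range_of (foldl F x s) t)%:R <= b.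
      by apply: le_trans h; rewrite ler_nat range_of_catr.
    by rewrite h1 h2 mul1r.
  by rewrite meanZ ler_wpM2l.
by rewrite meanZr ler_wpM2r.
Qed.

(** Four consecutive blocks of length [2 ^ k] must all have a small range. With [s] of order the
    square root of [k], the bound is of order [k ^ (-2)], hence summable. *)
Lemma range_lower_tail k s x : (2 <= k)%N -> (0 < s)%N -> (s * s <= k)%N ->
  mean (2 ^ k.+2) (fun t => ((range_of x t)%:R <= (2 ^ k)%:R / (4%:R * g k))%R%:R : R)
    <= (dev_cst / s%:R) ^+ 4.
Proof.
move=> k2 s1 ssk; have hq y := range_lower_dev y k2 s1 ssk.
have p0 : 0 <= dev_cst / s%:R.
  by rewrite divr_ge0// mulr_ge0// addr_ge0// divr_ge0// ltW// kappa_gt0.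
rewrite (_ : 2 ^ k.+2 = 2 ^ k + 2 ^ k + 2 ^ k + 2 ^ k)%N; last by rewrite !expnS; lia.
by rewrite !exprSr expr0 mul1r; do 3 apply: range_le_block => //.
Qed.

(** Put [a = 2 ^ k / g k], so that [1 <= 50 a]. Then [300 a] covers the mean of the range, at most
    [5 (4 + 50) a], and [2 (300 a)^2] its second moment, at most [50 ((13/2)^2 + 50^2) a^2]. *)
Definition range_scale k : R := 15%:R * 20%:R * ((2 ^ k)%:R / g k).

Lemma range_scale_gt0 k : 0 < range_scale k.
Proof. by rewrite mulr_gt0// divr_gt0 ?gpow_gt0// ltr0n expn_gt0. Qed.

Lemma range_le_nroots x t M : (snorm (site_of x) + size t <= M)%N ->
  (range_of x t)%:R <= 5%:R * (nroots R (box M) x t + 1).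
Proof.
move=> xM; apply: (@le_trans _ _ (5 + \sum_(v <- box M)
    (4 + T v) * (root T v \in trace F x t))%N%:R).
  by rewrite ler_nat; apply: range_of_le_roots.
rewrite natrD mulrDr mulr1 addrC lerD2r natr_sum /nroots mulr_sumr.
apply: ler_sum => v _; rewrite natrM ler_wpM2r// ler_nat.
by case: (T v).
Qed.

Lemma range_moments k x :
  mean (2 ^ k) (fun t => (range_of x t)%:R : R) <= range_scale k /\
  mean (2 ^ k) (fun t => (range_of x t)%:R ^+ 2 : R) <= 2%:R * range_scale k ^+ 2.
Proof.
set n := (2 ^ k)%N; set M := (snorm (site_of x) + n)%N.
have hr t : size t = n -> (range_of x t)%:R <= 5%:R * (nroots R (box M) x t + 1).
  by move=> tn; apply: range_le_nroots; rewrite tn.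
have g1 := gpow_ge1 R k; have g0 := gpow_gt0 R k.
pose a : R := n%:R / g k.
have n1 : k.+1%:R <= n%:R :> R by apply: pow2_ge.
have n2 : 1 <= n%:R :> R by rewrite ler1n expn_gt0.
have a50 : 1 <= 50%:R * a.
  rewrite /a mulrA ler_pdivlMr// mul1r.
  by apply: (le_trans (gpow_le R k)); rewrite ler_wpM2l.
have aV : (2%:R * g k)^-1 * n%:R = a / 2%:R by rewrite /a; field; rewrite gt_eqF.
have b5 : (2%:R * g k)^-1 * 5%:R <= 5%:R * a / 2%:R.
  rewrite -mulrA -aV mulrCA; apply: ler_wpM2l; first by rewrite invr_ge0; lra.
  by lra.
have m1 : mean n (nroots R (box M) x) <= 4%:R * a.
  rewrite mean_nroots; apply: (le_trans (sum_hit_le R n n x (box_uniq M))).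
  rewrite -/(gpow R k) !mulrDr aV; lra.
have m2 : mean n (fun t => nroots R (box M) x t ^+ 2) <= (13%:R / 2%:R * a) ^+ 2.
  apply: (le_trans (mean_nroots_sqr R n n x (box_uniq M))).
  rewrite -exprMn -/(gpow R k).
  have e : (2%:R * g k)^-1 * (n%:R + 2%:R * (n%:R + 5%:R)) <= 13%:R / 2%:R * a.
    by rewrite mulrDr aV mulrCA mulrDr aV; lra.
  have e0 : 0 <= (2%:R * g k)^-1 * (n%:R + 2%:R * (n%:R + 5%:R)).
    by apply: mulr_ge0; [rewrite invr_ge0; lra|lra].
  by rewrite ler_pXn2r ?nnegrE//; lra.
split.
  apply: (le_trans (ler_mean hr)); rewrite meanZ meanD mean_cst /range_scale -/a; lra.
apply: (@le_trans _ _ (mean n (fun t => 50%:R * (nroots R (box M) x t ^+ 2 + 1)))).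
  apply: ler_mean => t tn; have := hr t tn.
  have : 0 <= nroots R (box M) x t by apply: sumr_ge0.
  have : 0 <= (range_of x t)%:R :> R by [].
  move: (nroots _ _ _ _) ((range_of x t)%:R : R) => N r r0 N0 rN.
  have := ler_pM r0 r0 rN rN; have := sqr_ge0 (N - 1); rewrite !expr2; lra.
rewrite meanZ meanD mean_cst /range_scale -/a.
have a2 : 1 <= (50%:R * a) ^+ 2 by rewrite expr_ge1//; lra.
have := sqr_ge0 a; move: m2 a2; rewrite !exprMn; lra.
Qed.

(** Let [W] be the positive excess so far. By subadditivity a new block with range [C] changes it to
    at most the positive part of [W + C - U]. The cross term has mean at most 0 because [C] has mean
    at most [U], and the mean of [(C - U)^2] is at most [3 U^2]. The subtracted 1 is the range of
    the path without steps. *)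
Lemma range_excess k m x :
  mean (2 ^ k * m) (fun t => Num.max 0 ((range_of x t)%:R - 1 - m%:R * range_scale k) ^+ 2)
    <= m%:R * (3%:R * range_scale k ^+ 2).
Proof.
set n := (2 ^ k)%N; set U := range_scale k; have U0 : 0 < U := range_scale_gt0 k.
elim: m x => [|m IH] x.
  rewrite muln0 /= mul0r mul0r subr0.
  by rewrite /range_of /= subrr maxxx expr0n.
rewrite mulnS addnC mean_cat -[m.+1%:R]natr1 [(_ + 1) * U]mulrDl.
rewrite [(_ + 1) * (3%:R * _)]mulrDl !mul1r.
apply: (@le_trans _ _ (mean (n * m) (fun t =>
    Num.max 0 ((range_of x t)%:R - 1 - m%:R * U) ^+ 2) + 3%:R * U ^+ 2)); last first.
  by rewrite lerD2r; apply: IH.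
rewrite -[X in _ <= _ + X](mean_cst (n * m)) -meanD; apply: ler_mean => s _.
set W := Num.max 0 _; have W0 : 0 <= W by rewrite le_max lexx.
have [e1 e2] := range_moments k (foldl F x s); rewrite -/n -/U in e1 e2.
apply: (@le_trans _ _ (mean n (fun t => W ^+ 2 +
    2%:R * W * ((range_of (foldl F x s) t)%:R - U) +
    ((range_of (foldl F x s) t)%:R - U) ^+ 2))).
  apply: ler_mean => t _.
  have : (range_of x (s ++ t))%:R <= (range_of x s)%:R + (range_of (foldl F x s) t)%:R :> R.
    by rewrite -natrD ler_nat range_of_cat_le.
  have : (range_of x s)%:R - 1 - m%:R * U <= W by rewrite le_max lexx orbT.
  move: ((range_of x (s ++ t))%:R : R) ((range_of x s)%:R : R)
    ((range_of (foldl F x s) t)%:R : R) => A B C BW ABC.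
  have [d0|d0] := leP 0 (A - 1 - (m%:R * U + U)).
    have : A - 1 - (m%:R * U + U) <= W + (C - U) by lra.
    by move: (A - 1 - _) d0 => z; nra.
  by rewrite expr0n /= [leRHS](_ : _ = (W + (C - U)) ^+ 2) ?sqr_ge0//; ring.
rewrite !meanD mean_cst meanZ meanB mean_cst.
have -> : mean n (fun t => ((range_of (foldl F x s) t)%:R - U) ^+ 2) =
    mean n (fun t => (range_of (foldl F x s) t)%:R ^+ 2) -
    2%:R * U * mean n (fun t => (range_of (foldl F x s) t)%:R : R) + U ^+ 2.
  rewrite -[X in _ + X](mean_cst n) -meanZ -meanB -meanD.
  by apply: eq_mean => t _; ring.
have r0 : 0 <= mean n (fun t => (range_of (foldl F x s) t)%:R : R) by apply: mean_ge0.
set E1 := mean n (fun t => (range_of (foldl F x s) t)%:R) in e1 r0 *.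
set E2 := mean n (fun t => (range_of (foldl F x s) t)%:R ^+ 2) in e2 *.
have h1 : 2%:R * W * (E1 - U) <= 0.
  by rewrite mulr_ge0_le0 ?mulr_ge0//; lra.
have h2 : 0 <= 2%:R * U * E1.
  by apply: mulr_ge0 => //; apply: mulr_ge0 => //; apply: ltW.
lra.
Qed.

Lemma range_upper_tail k m x : (0 < m)%N ->
  mean (2 ^ k * m) (fun t => (3%:R * m%:R * range_scale k <= (range_of x t)%:R)%R%:R : R)
    <= 3%:R / m%:R.
Proof.
move=> m0; set U := range_scale k; have U0 : 0 < U := range_scale_gt0 k.
have m1 : 1 <= m%:R :> R by rewrite ler1n.
have U1 : 1 <= U.
  rewrite /U /range_scale mulrA ler_pdivlMr ?gpow_gt0// mul1r.
  have := gpow_le R k; have := pow2_ge k; have : 0 <= k.+1%:R :> R by []; lra.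
have mU : 0 < m%:R * U by rewrite mulr_gt0//; lra.
apply: (@le_trans _ _ (mean (2 ^ k * m) (fun t =>
  Num.max 0 ((range_of x t)%:R - 1 - m%:R * U) ^+ 2 * (m%:R * U) ^- 2))).
  apply: ler_mean => t _; have [h|_] := leP _ ((range_of x t)%:R : R); last first.
    by rewrite mulr_ge0 ?sqr_ge0// invr_ge0 sqr_ge0.
  rewrite ler_pdivlMr ?exprn_gt0// mul1r ler_sqr ?nnegrE ?le_max ?lexx// ?(ltW mU)//.
  by apply/orP; right; nra.
rewrite meanZr ler_pdivrMr ?exprn_gt0//.
apply: (le_trans (range_excess k m x)).
rewrite [leRHS](_ : _ = m%:R * (3%:R * U ^+ 2))//; field; lra.
Qed.

End Tails.

(** * Markov property, return probabilities and expectations under the path measure *)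

Section WalkLaw.
Variables (R : realType) (T : site -> bool).
Local Notation G := (graph T).
Local Notation F := (@dstep T).
Local Notation P := (@walk_law R T).

Lemma nth_trace x0 (x : vtx T) s : nth x0 (trace F x s) (size s) = foldl F x s.
Proof. by elim: s x => [//|a s IH] x /=. Qed.

Lemma walk_law_coord x n (A : pred (vtx T)) :
  P x [set w | A (w n)] = (iter_op F n (fun z => (A z)%:R : R) x)%:E.
Proof.
transitivity (P x [set w | A (nth x (mkseq w n.+1) n)]).
  by congr (P x _); apply/seteqP; split=> w; rewrite /mkset nth_mkseq.
rewrite (walk_lawE R x n (fun p => A (nth x p n))) -mean_foldl; congr (_%:E).
by apply: eq_mean => s sn; rewrite -sn nth_trace.
Qed.

Lemma trans_probE n x y : trans_prob P n x y = trp R F n x y.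
Proof.
rewrite /trans_prob (_ : [set w | w n = y] = [set w | pred1 y (w n)]).
  by rewrite walk_law_coord.
by apply/seteqP; split=> w /= /eqP.
Qed.

Lemma walk_law_recurrent : uniformly_weakly_recurrent P.
Proof.
exists (kappa R), 96%:R; split => //; first exact: kappa_gt0.
by move=> n x n1; rewrite !trans_probE; apply: trp_recurrent.
Qed.

Lemma mkseq_eqP (w h : nat -> G) n :
  (forall k, (k <= n)%N -> w k = h k) <-> mkseq w n.+1 = mkseq h n.+1.
Proof.
split=> [wh|e k kn].
  by apply/eq_in_map => k; rewrite mem_iota => kn; apply: wh.
by have := congr1 (nth point ^~ k) e; rewrite !nth_mkseq.
Qed.

Lemma walk_law_srw : is_srw P.
Proof.
move=> x; split.
  rewrite (_ : [set w | w 0%N = x] = [set w | pred1 x (w 0%N)]).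
    by rewrite walk_law_coord /= eqxx.
  by apply/seteqP; split=> w /= /eqP.
move=> n h y.
have -> : [set w : path_space G | forall k, (k <= n)%N -> w k = h k] =
    [set w | mkseq w n.+1 == mkseq h n.+1].
  by apply/seteqP; split=> w /=; [move=> /mkseq_eqP ->|move=> /eqP/mkseq_eqP].
have -> : [set w : path_space G |
      (forall k, (k <= n)%N -> w k = h k) /\ w n.+1 = y] =
    [set w | mkseq w n.+2 == rcons (mkseq h n.+1) y].
  apply/seteqP; split=> w; rewrite /mkset (mkseqS w n.+1) eqseq_rcons.
    by move=> [/mkseq_eqP -> ->]; rewrite !eqxx.
  by move=> /andP[/eqP/mkseq_eqP wh /eqP].
rewrite (walk_lawE R x n.+1 (pred1 (rcons (mkseq h n.+1) y))).
rewrite (walk_lawE R x n (pred1 (mkseq h n.+1))) -EFinM; congr (_%:E).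
rewrite mean_rcons -meanZr; apply: eq_mean => s sn.
transitivity (avg (fun a => (trace F x s == mkseq h n.+1)%:R *
    (F (foldl F x s) a == y)%:R : R)).
  apply: eq_avg => a.
  rewrite (_ : pred1 _ _ = (trace F x (rcons s a) == rcons (mkseq h n.+1) y))//.
  by rewrite trace_rcons eqseq_rcons -natrM mulnb.
rewrite avgZ (_ : pred1 _ _ = (trace F x s == mkseq h n.+1))//; case: eqP => [e|_]; last by rewrite !mul0r.
by rewrite stepE -(nth_trace point) e sn nth_mkseq.
Qed.

(** A bounded natural number is the sum of the indicators of [k < f], so its expectation is a finite
    sum of probabilities of prefix events. *)
Lemma expectation_prefix x n (f : seq G -> nat) :
  (forall p, (f p <= size p)%N) ->
  ('E_(P x)[fun w => (f (mkseq w n.+1))%:R] =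
   (mean n (fun s => (f (trace F x s))%:R : R))%:E)%E.
Proof.
move=> fs; pose A k : set (path_space G) := [set w | (k < f (mkseq w n.+1))%N].
have mA k : measurable (A k) by apply: (measurable_prefix n.+1 (fun p => (k < f p)%N)).
have count_lt m b : (m <= b)%N -> \sum_(k < b) (k < m)%:R = m%:R :> R.
  move=> mb; rewrite -natr_sum; congr _%:R; rewrite -{2}(minn_idPr mb).
  elim: (b) => [|c IH]; first by rewrite big_ord0 min0n.
  by rewrite big_ord_recr /= IH; case: ltnP; lia.
rewrite unlock.
transitivity (\int[P x]_w \sum_(k < n.+1) (\1_(A k) w)%:E)%E.
  apply: eq_integral => w _; rewrite sumEFin; congr (_%:E).
  rewrite -(count_lt (f (mkseq w n.+1)) n.+1); last by rewrite -[leqRHS](size_mkseq w) fs.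
  by apply: eq_bigr => k _; rewrite indicE; congr (nat_of_bool _)%:R; apply/idP/idP; rewrite in_setE.
rewrite (@ge0_integral_sum _ _ _ (P x) setT measurableT _
  (fun (k : 'I_n.+1) w => (\1_(A k) w)%:E)).
- transitivity (\sum_(k < n.+1) P x (A k))%E.
    by apply: eq_bigr => k _; rewrite integral_indic// setIT.
  under eq_bigr => k _ do rewrite (walk_lawE R x n (fun p => (k < f p)%N)).
  rewrite sumEFin -mean_sum; congr (_%:E); apply: eq_mean => s sn.
  by rewrite count_lt// -sn -(size_trace F x).
- by move=> k; apply/measurable_EFinP; exact: measurable_indic.
- by move=> k w _; rewrite lee_fin.
Qed.

End WalkLaw.

(** * Zero-one law and almost sure limits *)

Section ZeroOne.
Variables (R : realType) (T : site -> bool).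
Local Notation G := (graph T).
Local Notation F := (@dstep T).
Local Notation P := (@walk_law R T).

Lemma take_mkseq (w : nat -> G) m n : (m <= n)%N -> take m (mkseq w n) = mkseq w m.
Proof. by move=> mn; rewrite /mkseq -map_take take_iota (minn_idPl mn). Qed.

(** Prefix events are stable under intersection and generate the sigma-algebra. Prefixes with at
    least two states suffice, and they contain a step, which [one_step] splits off. *)
Lemma prefix_measure_unique (m1 m2 : {measure set (path_space G) -> \bar R}) :
  (m1 setT < +oo)%E ->
  (forall n (Q : pred (seq G)),
    m1 [set w | Q (mkseq w n.+2)] = m2 [set w | Q (mkseq w n.+2)]) ->
  forall A, measurable A -> m1 A = m2 A.
Proof.
move=> m1T m12.
pose C : set (set (path_space G)) :=
  [set E | exists n (Q : pred (seq G)), E = [set w | Q (mkseq w n.+2)]].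
apply: (measure_unique C (fun=> setT)) => //.
- apply/seteqP; split.
    apply: smallest_sub; first exact: smallest_sigma_algebra.
    move=> _ [n [A ->]]; apply: sub_sigma_algebra.
    exists n, (fun p => `[< A (nth point p n) >]).
    by apply/seteqP; split=> w; rewrite /mkset nth_mkseq ?ltnS ?leqnSn// => /asboolP.
  apply: smallest_sub; first exact: sigma_algebra_measurable.
  by move=> _ [n [Q ->]]; apply: (measurable_prefix n.+2 (fun p => Q p)).
- move=> _ _ [n [Q ->]] [m [Q' ->]].
  exists (maxn n m), (fun p => Q (take n.+2 p) && Q' (take m.+2 p)).
  apply/seteqP; split=> w; rewrite /mkset /setI /mkset !take_mkseq ?ltnS ?leq_maxl ?leq_maxr//.
    by move=> [-> ->].
  by move=> /andP.
- by move=> _; exists 0%N, predT; apply/seteqP; split.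
- exact: bigcup_const.
- by move=> _ [n [Q ->]]; exact: m12.
Qed.

Definition pcons (x : G) (w : path_space G) : path_space G :=
  fun n => if n is m.+1 then w m else x.
Arguments pcons : simpl never.

Lemma mkseq_pcons x w n : mkseq (pcons x w) n.+1 = x :: mkseq w n.
Proof.
rewrite /mkseq /= -[1%N]addn0 iotaDl -map_comp; congr (_ :: _).
Qed.

Fact measurable_pcons x : measurable_fun setT (pcons x).
Proof.
apply: (@measurability _ _ (path_space G) (path_space G) setT (pcons x)
  (coordinate_events G) erefl).
move=> _ [_ [n [A ->]] <-]; rewrite setTI; case: n => [|n].
  have [Ax|nAx] := pselect (A x).
    by rewrite (_ : _ @^-1` _ = setT)//; apply/seteqP; split.
  by rewrite (_ : _ @^-1` _ = set0)//; apply/seteqP; split.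
exact: (@measurable_coordinate T n A).
Qed.

HB.instance Definition _ x := isMeasurableFun.Build _ _
  (path_space G) (path_space G) (pcons x) (measurable_pcons x).

Lemma one_step x (E : set (path_space G)) : measurable E ->
  P x E = (\sum_(k < 6) 6%:R^-1%:E * P (nstep x k) (pcons x @^-1` E))%E.
Proof.
have i6 : 0 <= 6%:R^-1 :> R by rewrite invr_ge0.
pose m2 := msum (fun k => mscale (NngNum i6)
  (@distribution _ _ (path_space G) (path_space G) R (P (nstep x k)) (pcons x))) 6.
apply: (@prefix_measure_unique (P x) m2); first exact: le_lt_trans (probability_le1 (P x) measurableT) (ltry 1).
move=> n Q; rewrite -[LHS]/(P x [set w | Q (mkseq w n.+2)]).
rewrite (walk_lawE R x n.+1 Q) /m2 /msum /mscale /=.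
transitivity (\sum_(k < 6) (6%:R^-1 *
    mean n (fun s => (Q (x :: trace F (nstep x k) s))%:R : R))%:E)%E.
  by rewrite sumEFin -mulr_sumr mulrC.
apply: eq_bigr => k _; rewrite EFinM; congr (_ * _)%E.
rewrite /distribution /pushforward /preimage /=.
rewrite -(walk_lawE R (nstep x k) n (fun p => Q (x :: p))).
by congr (P _ _); apply/seteqP; split=> w; rewrite /preimage /mkset mkseq_pcons.
Qed.

Lemma hit_near1 (e : R) : 0 < e ->
  exists n, forall (y : vtx T) a, 1 - e <= hit R F n (F y a) y.
Proof.
move=> e0; have k0 := kappa_gt0 R.
(* Chosen so that the Green function at time [2 ^ k.+1], at least [k kappa / 8], exceeds [6 / e];
   then [escape_le] applies. *)
pose k := (Num.truncn (48%:R / (kappa R * e))).+1.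
exists (2 ^ k.+1).-1 => y a; set n := (2 ^ k.+1).-1.
have nE : n.+1 = (2 ^ k.+1)%N by rewrite prednK// expn_gt0.
have := escape_le R F n y a; rewrite nE => h1.
have h2 := green_pow_ge R k y.
have h3 : 48%:R < k%:R * (kappa R * e).
  by rewrite -ltr_pdivrMr ?mulr_gt0// truncnS_gt.
rewrite lerBlDr -lerBlDl leNgt; apply/negP => eh.
have h4 : 6%:R < e * green R F (2 ^ k.+1) y y.
  apply: (@lt_le_trans _ _ (e * (k%:R * (kappa R / 8%:R)))); last by rewrite ler_pM2l.
  by lra.
have : e * green R F (2 ^ k.+1) y y <= (1 - hit R F n (F y a) y) * green R F (2 ^ k.+1) y y.
  by rewrite ler_wpM2r ?green_ge0// ltW.
lra.
Qed.

(** The probability of [B] is a bounded harmonic function of the starting point. Recurrence makes it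
    constant: from a neighbour of [y] the walk hits [y] almost surely. Then [B] is independent of
    every prefix event, hence of itself. *)
Theorem zero_one (B : set (path_space G)) : measurable B ->
  (forall x w, B (pcons x w) <-> B w) ->
  exists2 p : R, p = 0 \/ p = 1 & forall x, P x B = p%:E.
Proof.
move=> mB invB.
have preB x : pcons x @^-1` B = B by apply/seteqP; split=> w Bw; apply/(invB x w).
pose h x := fine (P x B).
have hE x : P x B = (h x)%:E by rewrite fineK// fin_num_measure.
have h01 x : 0 <= h x <= 1.
  by rewrite -!lee_fin -hE measure_ge0 probability_le1.
have harm x : h x = avg (fun a => h (F x a)).
  apply: EFin_inj; rewrite -hE (one_step x mB) preB /avg mulr_suml -sumEFin.
  by apply: eq_bigr => k _; rewrite hE -EFinM mulrC.
have hadj y a : h (F y a) <= h y.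
  apply/ler_addgt0Pr => e e0; have [n hn] := hit_near1 e0.
  apply: (le_trans (harmonic_hit (F := F) n (F y a) y h01 harm)).
  have := hn y a; have /andP[h1 h2] := h01 y.
  have := hit_le1 R F n (F y a) y; have := hit_ge0 R F n (F y a) y; nra.
have hcst x y : h x <= h y.
  have [s + <-] := graph_connected y x; clear -hadj.
  elim: s y => [//|z s IH] y /= /andP[/gadjP[k k6 <-] zs].
  by apply: (le_trans (IH _ zs)); exact: (hadj y (Ordinal k6)).
pose p := h (root T 0).
have hp x : P x B = p%:E.
  by rewrite hE; congr (_%:E); apply/eqP; rewrite eq_le !hcst.
have /andP[p0 p1] := h01 (root T 0); rewrite -/p in p0 p1.
have indep n (Q : pred (seq G)) x :
    P x (B `&` [set w | Q (mkseq w n.+1)]) =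
    (p%:E * P x [set w | Q (mkseq w n.+1)])%E.
  elim: n Q x => [|n IH] Q x.
    have mQ := measurable_prefix 1 (fun p => Q p).
    rewrite !one_step//; last exact: measurableI.
    rewrite ge0_sume_distrr; last by move=> k _; rewrite mule_ge0// lee_fin.
    apply: eq_bigr => k _; rewrite muleCA; congr (_ * _)%E.
    rewrite preimage_setI preB.
    have e : pcons x @^-1` [set w | Q (mkseq w 1)] = [set w | Q [:: x]].
      by apply/seteqP; split=> w; rewrite /preimage /mkset mkseq_pcons.
    rewrite e; case: (Q [:: x]).
      rewrite (_ : [set w | _] = setT); last by apply/seteqP; split.
      by rewrite setIT hp (probability_setT (P (nstep x k))) mule1.
    rewrite (_ : [set w | _] = set0) ?setI0 ?measure0 ?mule0//.
    by apply/seteqP; split.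
  have mQ := measurable_prefix n.+2 (fun p => Q p).
  rewrite !one_step//; last exact: measurableI.
  rewrite ge0_sume_distrr; last by move=> k _; rewrite mule_ge0// lee_fin.
  apply: eq_bigr => k _; rewrite muleCA; congr (_ * _)%E.
  rewrite preimage_setI preB.
  have -> : pcons x @^-1` [set w | Q (mkseq w n.+2)] =
      [set w | Q (x :: mkseq w n.+1)].
    by apply/seteqP; split=> w; rewrite /preimage /mkset mkseq_pcons.
  exact: (IH (fun p => Q (x :: p))).
(* The measures of [E] given by the probability of [E] intersected with [B] and by [p] times that of
   [E] agree on prefix events, hence at [E = B]. *)
have pp : p = p * p.
  apply: EFin_inj; rewrite EFinM -{1}(hp (root T 0)) -{2}(hp (root T 0)).
  rewrite -{1}[B]setIid.
  apply: (@prefix_measure_unique (mrestr (P (root T 0)) mB)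
    (mscale (NngNum p0) (P (root T 0))) _ _ B mB).
    exact: (le_lt_trans (probability_le1 (P (root T 0))
      (measurableI _ _ measurableT mB)) (ltry 1)).
  move=> n Q; have := indep n.+1 Q (root T 0).
  by rewrite setIC.
exists p => //.
have : p * (1 - p) = 0 by rewrite mulrBr mulr1 -pp subrr.
move/eqP; rewrite mulf_eq0 subr_eq0 => /orP[/eqP ->|/eqP <-]; [by left|by right].
Qed.

End ZeroOne.

(** * Upper and lower limits in the extended reals *)

Section LimSup.
Variable R : realType.
Implicit Types (u v : (\bar R)^nat) (a b : \bar R).
Local Open Scope ereal_scope.

Lemma limn_esup_le u a (N : nat) :
  (forall n, (N <= n)%N -> u n <= a) -> limn_esup u <= a.
Proof.
move=> ua; rewrite limn_esup_lim (cvg_lim (@ereal_hausdorff R) (@cvg_esups_inf _ u)).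
apply: (@le_trans _ _ (esups u N)).
  by apply: ereal_inf_lbound; exists N.
by apply: ge_ereal_sup => _ [n /= Nn <-]; apply: ua.
Qed.

Lemma limn_esup_ge u a :
  (forall N, exists2 n, (N <= n)%N & a <= u n) -> a <= limn_esup u.
Proof.
move=> ua; rewrite limn_esup_lim (cvg_lim (@ereal_hausdorff R) (@cvg_esups_inf _ u)).
apply: le_ereal_inf_tmp => _ [N _ <-]; have [n Nn an] := ua N.
by apply: (le_trans an); apply: ereal_sup_ubound; exists n.
Qed.

Lemma limn_esup_lt u a : limn_esup u < a ->
  exists N, forall n, (N <= n)%N -> u n < a.
Proof.
move=> ua; apply: contrapT => h; move: ua; rewrite ltNge => /negP; apply.
apply: limn_esup_ge => N; apply: contrapT => h'; apply: h; exists N => n Nn.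
by rewrite ltNge; apply/negP => an; apply: h'; exists n.
Qed.

Lemma limn_einf_ge u a (N : nat) :
  (forall n, (N <= n)%N -> a <= u n) -> a <= limn_einf u.
Proof.
move=> ua; rewrite /limn_einf leeNr; apply: (@limn_esup_le _ _ N) => n Nn.
by rewrite leeN2 ua.
Qed.

Lemma limn_einf_le u a :
  (forall N, exists2 n, (N <= n)%N & u n <= a) -> limn_einf u <= a.
Proof.
move=> ua; rewrite /limn_einf leeNl; apply: limn_esup_ge => N.
by have [n Nn na] := ua N; exists n => //; rewrite leeN2.
Qed.

Lemma le_ereal_real a b : (forall r : R, b < r%:E -> a <= r%:E) -> a <= b.
Proof.
case: b => [r| |] h; last 1 first.
- case: a h => [s| |] h //; last by have := h 0%R (ltNyr 0).
  have := h (s - 1)%R; rewrite ltNyr lee_fin => /(_ isT) hs; exfalso; move: hs; lra.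
- apply/lee_addgt0Pr => e e0; rewrite -EFinD; apply: h.
  by rewrite lte_fin ltrDl.
by rewrite leey.
Qed.

Lemma limn_esup_perturb (f g d : R^nat) :
  (forall n, f n <= g n + d n)%R -> d @ \oo --> (0 : R)%R ->
  limn_esup (EFin \o f) <= limn_esup (EFin \o g).
Proof.
move=> fg d0; apply: le_ereal_real => r /limn_esup_lt[N gN].
apply/lee_addgt0Pr => e e0.
have [M _ dM] : \forall n \near \oo, (d n < e)%R.
  by apply: (cvgr_lt (0 : R)%R).
apply: (@limn_esup_le _ _ (maxn N M)) => n; rewrite geq_max => /andP[Nn Mn].
rewrite /= -EFinD lee_fin; apply: (le_trans (fg n)); apply: lerD.
  by have := gN n Nn; rewrite /= lte_fin => /ltW.
by apply: ltW; apply: dM.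
Qed.

Lemma eq_limn_esup (f g d : R^nat) :
  (forall n, `|f n - g n| <= d n)%R -> d @ \oo --> (0 : R)%R ->
  limn_esup (EFin \o f) = limn_esup (EFin \o g).
Proof.
move=> fg d0; apply/eqP; rewrite eq_le; apply/andP; split;
  apply: (limn_esup_perturb _ d0) => n; have := fg n; rewrite ler_norml => /andP[]; lra.
Qed.

End LimSup.

Section Constants.
Variables (R : realType) (T : site -> bool).
Local Notation G := (graph T).
Local Notation P := (@walk_law R T).

(** Each event [a <= L] has probability 0 or 1 by [zero_one]; the constant is the supremum of the
    [a] with probability 1. *)
Lemma ae_invariant_cst (L : path_space G -> \bar R) (lo hi : R) :
  measurable_fun setT L -> (forall x w, L (pcons x w) = L w) ->
  (\forall w \ae P (root T 0), (lo%:E <= L w <= hi%:E)%E) ->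
  exists2 c : R, lo <= c <= hi & \forall w \ae P (root T 0), L w = c%:E.
Proof.
move=> mL invL Llh; set o := root T 0.
pose B a := [set w | (a%:E <= L w)%E].
have mB a : measurable (B a).
  by rewrite -[B a]setTI; apply: emeasurable_fun_c_infty.
have zo a : P o (B a) = 0%:E \/ P o (B a) = 1%:E.
  have [x w|p p01 pP] := @zero_one R T (B a) (mB a); first by rewrite /B /= invL.
  by rewrite pP; case: p01 => ->; [left|right].
have ae1 a : P o (B a) = 1%:E -> \forall w \ae P o, (a%:E <= L w)%E.
  move=> Pa; exists (~` B a); split; [exact: measurableC| |by []].
  by rewrite probability_setC// Pa subee.
have ae0 a : P o (B a) = 0%:E -> \forall w \ae P o, (L w < a%:E)%E.
  move=> Pa; exists (B a); split => // w /= /negP; rewrite -leNgt //.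
have ne (Q : set (path_space G)) : (\forall w \ae P o, Q w) -> exists w, Q w.
  move=> [N [mN PN NQ]]; apply: contrapT => nQ.
  have NT : N = setT.
    by apply/seteqP; split=> // w _; apply: NQ => Qw; apply: nQ; exists w.
  by move: PN; rewrite NT probability_setT => /eqP; rewrite onee_eq0.
pose A := [set a : R | P o (B a) = 1%:E].
have Alo : A lo.
  have [/ae0 h|//] := zo lo.
  have [w [/andP[h1 _] h2]] : exists w, (lo%:E <= L w <= hi%:E)%E /\ (L w < lo%:E)%E.
    by apply: ne; apply: filterS2 Llh h => w.
  by move: h2; rewrite ltNge h1.
have Ahi a : A a -> a <= hi.
  move=> /ae1 h.
  have [w [/andP[_ h1] h2]] : exists w, (lo%:E <= L w <= hi%:E)%E /\ (a%:E <= L w)%E.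
    by apply: ne; apply: filterS2 Llh h => w.
  by rewrite -lee_fin (le_trans h2 h1).
have supA : has_sup A by split; [exists lo|exists hi => a /Ahi].
exists (sup A).
  apply/andP; split; first by apply: ub_le_sup => //; exact: supA.2.
  by apply: ge_sup; [exists lo|move=> a /Ahi].
have low k : \forall w \ae P o, ((sup A - k.+1%:R^-1)%:E <= L w)%E.
  have k0 : 0 < k.+1%:R^-1 :> R by rewrite invr_gt0.
  have [a Aa ka] := sup_adherent k0 supA.
  by apply: filterS (ae1 _ Aa) => w; apply: le_trans; rewrite lee_fin ltW.
have up k : \forall w \ae P o, (L w < (sup A + k.+1%:R^-1)%:E)%E.
  have [|h] := zo (sup A + k.+1%:R^-1); first exact: ae0.
  have := ub_le_sup supA.2 h; rewrite gerDl leNgt invr_gt0 ltr0n //.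
apply: filterS2 (ae_foralln low) (ae_foralln up) => w lw uw; apply/eqP; rewrite eq_le; apply/andP; split.
  apply/lee_addgt0Pr => e e0.
  have := uw (Num.truncn e^-1); move=> /ltW h; apply: (le_trans h).
  rewrite -EFinD lee_fin lerD2l -[leRHS]invrK lef_pV2 ?posrE ?invr_gt0//.
  by rewrite ltW// truncnS_gt.
apply/lee_subgt0Pr => e e0.
have h := lw (Num.truncn e^-1); apply: le_trans h.
rewrite -EFinB lee_fin lerB// -[leRHS]invrK lef_pV2 ?posrE ?invr_gt0//.
by rewrite ltW// truncnS_gt.
Qed.

End Constants.

Section Rate.
Variable R : realType.

Definition rate (n : nat) : R := ln n%:R / n%:R.

Lemma ln2_gt0 : 0 < ln 2%:R :> R. Proof. by rewrite ln_gt0// ltr1n. Qed.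

Lemma rate_ge0 n : 0 <= rate n.
Proof.
case: n => [|n]; first by rewrite /rate ln0// mul0r.
by rewrite divr_ge0// ln_ge0// ler1n.
Qed.

Lemma rate_pow2 k : rate (2 ^ k) = k%:R * ln 2%:R / (2 ^ k)%:R.
Proof. by rewrite /rate natrX lnXn// mulr_natl. Qed.

Lemma rate_bounds n k : (2 ^ k <= n < 2 ^ k.+1)%N ->
  k%:R * ln 2%:R / (2 ^ k.+1)%:R <= rate n <= k.+1%:R * ln 2%:R / (2 ^ k)%:R.
Proof.
move=> /andP[kn nk]; have k0 : (0 < 2 ^ k)%N by rewrite expn_gt0.
have n0 : 0 < n%:R :> R by rewrite ltr0n (leq_trans k0).
have lnk m : ln (2 ^ m)%:R = m%:R * ln 2%:R :> R by rewrite natrX lnXn// mulr_natl.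
have p0 m : 0 < (2 ^ m)%:R :> R by rewrite ltr0n expn_gt0.
have h1 : (2 ^ k)%:R <= n%:R :> R by rewrite ler_nat.
have h2 : n%:R <= (2 ^ k.+1)%:R :> R by rewrite ler_nat ltnW.
have l0 := ln2_gt0; rewrite /rate -!lnk; apply/andP; split; apply: ler_pM.
- by rewrite lnk mulr_ge0// ltW.
- by rewrite invr_ge0 ltW.
- by rewrite ler_ln ?posrE.
- by rewrite lef_pV2 ?posrE.
- by rewrite ln_ge0// (le_trans _ h1)// ler1n.
- by rewrite invr_ge0 ltW.
- by rewrite ler_ln ?posrE.
- by rewrite lef_pV2 ?posrE.
Qed.

Lemma rate_cvg0 : rate @ \oo --> (0 : R).
Proof.
(* [ln n] is twice the logarithm of the square root of [n]. *)
have sq n : rate n <= 2%:R / Num.sqrt n%:R.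
  case: n => [|n]; first by rewrite /rate ln0// mul0r divr_ge0.
  have n0 : 0 < n.+1%:R :> R by [].
  have s0 : 0 < Num.sqrt n.+1%:R :> R by rewrite sqrtr_gt0.
  set s := Num.sqrt _ in s0 *.
  have nE : n.+1%:R = s ^+ 2 by rewrite sqr_sqrtr// ltW.
  rewrite /rate nE lnXn// (_ : 2%:R / s = (s *+ 2) / s ^+ 2); last by field; rewrite gt_eqF.
  by rewrite ler_pM2r ?invr_gt0 ?exprn_gt0// lerMn2r ltW// ln_sublinear.
apply/cvgrPdist_le => e e0; near=> n.
rewrite sub0r normrN ger0_norm ?rate_ge0//; apply: (le_trans (sq n)).
have n0 : (4%:R / e ^+ 2) <= n%:R by near: n; exact: nbhs_infty_ger.
have e2 : 0 < e ^+ 2 by rewrite exprn_gt0.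
have n1 : 0 < n%:R :> R by apply: lt_le_trans n0; rewrite divr_gt0.
have s0 : 0 < Num.sqrt n%:R :> R by rewrite sqrtr_gt0.
rewrite ler_pdivrMr// -(@ler_pXn2r _ 2) ?nnegrE//; last by rewrite mulr_ge0// ltW.
rewrite exprMn sqr_sqrtr ?(ltW n1)//.
by move: n0; rewrite ler_pdivrMr// mulrC => h; apply: le_trans h; lra.
Unshelve. all: by end_near. Qed.

End Rate.

(** * Almost sure bounds on the rescaled range *)

Section BorelCantelli.
Variables (R : realType) (T : site -> bool).
Local Notation G := (graph T).
Local Notation P := (@walk_law R T).

Lemma inverse_squares n : \sum_(k < n) (k.+1%:R ^- 2) <= 2%:R :> R.
Proof.
apply: (@le_trans _ _ (2%:R * (1 - n.+1%:R^-1))); last first.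
  by rewrite ler_piMr// gerBl.
elim: n => [|n IH]; first by rewrite big_ord0 invr1 subrr mulr0.
rewrite big_ord_recr /=; apply: (le_trans (lerD IH (lexx _))).
rewrite -[n.+2%:R]natr1; set m : R := n.+1%:R.
have m1 : 1 <= m by rewrite ler1n.
rewrite -lerBrDl (_ : _ - _ = 2%:R / (m * (m + 1))).
  by rewrite -[leLHS]mul1r ler_pdivrMr ?exprn_gt0; [|lra..];
     rewrite mulrAC ler_pdivlMr ?mulr_gt0; [|lra..]; nra.
by field; apply/andP; split; lra.
Qed.

Lemma borel_cantelli_sqr x (A : nat -> set (path_space G)) (K : R) : 0 <= K ->
  (forall k, measurable (A k)) ->
  (forall k, (P x (A k) <= (K / k.+1%:R ^+ 2)%:E)%E) ->
  \forall w \ae P x, exists N, forall k, (N <= k)%N -> ~ A k w.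
Proof.
move=> K0 mA PA.
exists (lim_sup_set A); split.
- apply: bigcap_measurable => [|n _]; first by exists 0%N.
  by apply: bigcup_measurable => k _.
- apply: lim_sup_set_cvg0 => //.
  apply: (@le_lt_trans _ _ (K * 2%:R)%:E); last exact: ltry.
  apply: lime_le; first by apply: is_cvg_nneseries.
  apply: nearW => n; rewrite big_mkord.
  apply: (@le_trans _ _ (\sum_(k < n) (K / k.+1%:R ^+ 2)%:E)%E).
    by apply: lee_sum => k _; exact: PA.
  rewrite sumEFin lee_fin -mulr_sumr ler_wpM2l//; exact: inverse_squares.
move=> w /= h n _; apply: contrapT => h'; apply: h; exists n => k nk Ak.
by apply: h'; exists k.
Qed.

Lemma walk_law_range x n (Q : pred nat) :
  P x [set w | Q (range_size n w)] =
  (mean n (fun s => (Q (range_of x s))%:R : R))%:E.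
Proof. exact: (walk_lawE R x n (fun p => Q (size (undup p)))). Qed.

Lemma measurable_range n (Q : set nat) :
  measurable ([set w | Q (range_size n w)] : set (path_space G)).
Proof. exact: (measurable_prefix n.+1 (fun p => Q (size (undup p)))). Qed.

Lemma le_range_size m n (w : path_space G) : (m <= n)%N ->
  (range_size m w <= range_size n w)%N.
Proof.
move=> mn; apply: uniq_leq_size; rewrite ?undup_uniq// => y; rewrite !mem_undup.
move=> /mapP[i]; rewrite mem_iota => im ->; apply: map_f.
by rewrite mem_iota; lia.
Qed.

Lemma exists_sqrt k : exists s, (s * s <= k < s.+1 * s.+1)%N.
Proof.
elim: k => [|k [s /andP[h1 h2]]]; first by exists 0%N.
have [h|h] := leqP (s.+1 * s.+1) k.+1.
  by exists s.+1; rewrite h /=; nia.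
by exists s; rewrite h andbT; lia.
Qed.

Lemma ae_range_lower x : \forall w \ae P x, exists N, forall k, (N <= k)%N ->
  (2 ^ k)%:R / (4%:R * gpow R k) < (range_size (2 ^ k.+2) w)%:R.
Proof.
pose C := dev_cst R; have C0 : 0 <= C.
  by rewrite mulr_ge0// addr_ge0// divr_ge0// ltW// kappa_gt0.
pose A k : set (path_space G) := [set w |
  (range_size (2 ^ k.+2) w)%:R <= (2 ^ k)%:R / (4%:R * gpow R k)].
(* With [s] the integer part of the square root of [k], [k + 1 <= (2 s)^2] gives [16 C^4]; the 4
   covers [k < 2], where the probability is bounded by 1. *)
pose K : R := 16%:R * C ^+ 4 + 4%:R.
have C4 : 0 <= C ^+ 4 by rewrite exprn_ge0.
have K0 : 0 <= K by rewrite /K; lra.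
have : \forall w \ae P x, exists N, forall k, (N <= k)%N -> ~ A k w.
  apply: (@borel_cantelli_sqr x A K K0) => k.
    by apply: (measurable_range _ (fun m => m%:R <= _)).
  have [k2|k2] := ltnP k 2.
    apply: (@le_trans _ _ 1%:E).
      apply: probability_le1.
      by apply: (measurable_range _ (fun m => m%:R <= _)).
    rewrite lee_fin ler_pdivlMr ?exprn_gt0// mul1r.
    by case: k k2 => [|[|//]] _; rewrite /K; lra.
  have [s /andP[s1 s2]] := exists_sqrt k.
  have s0 : (0 < s)%N by case: s s1 s2 => //; lia.
  rewrite (walk_law_range x _ (fun m => m%:R <= _)) lee_fin.
  apply: (le_trans (range_lower_tail R x k2 s0 s1)).
  rewrite ler_pdivlMr ?exprn_gt0//.
  have s0' : 1 <= s%:R :> R by rewrite ler1n.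
  have ks : k.+1%:R ^+ 2 <= (2%:R * s%:R) ^+ 4 :> R.
    rewrite (_ : (2%:R * s%:R) ^+ 4 = ((2%:R * s%:R) ^+ 2) ^+ 2); last by rewrite -exprM.
    rewrite ler_pXn2r ?nnegrE ?sqr_ge0//.
    rewrite -natrM -natrX ler_nat expnS expn1; nia.
  have e0 : 0 <= (C / s%:R) ^+ 4 by rewrite exprn_ge0// divr_ge0.
  apply: (le_trans (ler_wpM2l e0 ks)).
  rewrite -exprMn (_ : C / s%:R * (2%:R * s%:R) = 2%:R * C); last by field; lra.
  by rewrite exprMn /K (_ : 2%:R ^+ 4 = 16%:R); [lra|rewrite -natrX].
apply: filterS => w [N hN]; exists N => k Nk.
by rewrite ltNge; apply/negP; apply: hN.
Qed.

Lemma pow2_sqr j : ((j.+1) ^ 2 <= 8 * 2 ^ j)%N.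
Proof.
apply: (@leq_trans (j * j + 4 * j + 6)); first by rewrite expnS expn1; lia.
elim: j => [//|j IH]; rewrite expnS; lia.
Qed.

(** The path is cut into [2 ^ k./2] pieces. This makes the failure probability exponentially small
    in [k], while the Green function at the length of a piece is still of order [k]. *)
Lemma ae_range_upper x : \forall w \ae P x, exists N, forall k, (N <= k)%N ->
  (range_size (2 ^ k) w)%:R < 3%:R * (2 ^ k./2)%:R * range_scale R (k - k./2).
Proof.
pose A k : set (path_space G) := [set w |
  3%:R * (2 ^ k./2)%:R * range_scale R (k - k./2) <= (range_size (2 ^ k) w)%:R].
have : \forall w \ae P x, exists N, forall k, (N <= k)%N -> ~ A k w.
  apply: (@borel_cantelli_sqr x A (3%:R * 32%:R)) => // k.
    by apply: (measurable_range _ (fun m => _ <= m%:R)).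
  rewrite (walk_law_range x _ (fun m => _ <= m%:R)) lee_fin.
  have -> : (2 ^ k = 2 ^ (k - k./2) * 2 ^ k./2)%N.
    by rewrite -expnD subnK// leq_half_double; lia.
  apply: (le_trans (range_upper_tail R _ x _)); first by rewrite expn_gt0.
  rewrite -mulrA ler_pM2l// ler_pdivlMr ?exprn_gt0// mulrC ler_pdivrMr ?ltr0n ?expn_gt0//.
  rewrite -natrX -natrM ler_nat.
  have h := pow2_sqr k./2; apply: (@leq_trans ((2 * (k./2).+1) ^ 2)).
    by rewrite leq_exp2r//; lia.
  by rewrite expnMn; lia.
apply: filterS => w [N hN]; exists N => k Nk.
by rewrite ltNge; apply/negP; apply: hN.
Qed.

(** Between dyadic times the range is monotone. For the lower constant, [32 = 8 * 4]: a factor 8 for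
    comparing [2 ^ k.+3] with [2 ^ k], and 4 from the threshold; 50 is from [gpow_le]. For the upper
    one, a dyadic step costs 2, and [32 / kappa] combines [16 / kappa] with a piece exponent [b] of
    at least half the total exponent. *)
Definition rate_lo : R := ln 2%:R / (32%:R * 50%:R).
Definition rate_hi : R := ln 2%:R * (2%:R * (3%:R * 15%:R * 20%:R)) * (32%:R / kappa R).

Lemma ae_rate_bounds x : \forall w \ae P x, exists N, forall n, (N <= n)%N ->
  rate_lo <= rate R n * (range_size n w)%:R <= rate_hi.
Proof.
apply: filterS2 (ae_range_lower x) (ae_range_upper x) => w [N1 h1] [N2 h2].
exists (2 ^ (maxn N1 N2).+3)%N => n Nn.
have n0 : (0 < n)%N by rewrite (leq_trans _ Nn)// expn_gt0.
have [k kn] : exists k, (2 ^ k <= n < 2 ^ k.+1)%N.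
  by exists (trunc_log 2 n); rewrite trunc_logP// trunc_log_ltn.
have kN : ((maxn N1 N2).+3 <= k)%N.
  rewrite -ltnS -(@ltn_exp2l 2)//; case/andP: kn => _; exact: leq_ltn_trans.
have /andP[r1 r2] := rate_bounds R kn; case/andP: kn => kn nk.
have l0 := ln2_gt0 R; have kap := kappa_gt0 R.
have p0 m : 0 < (2 ^ m)%:R :> R by rewrite ltr0n expn_gt0.
case: k kN kn nk r1 r2 => [//|[//|k]] kN kn nk r1 r2; apply/andP; split.
  have gk := gpow_gt0 R k; have gk1 := gpow_le R k.
  have := h1 k; rewrite (_ : N1 <= k)%N; last by lia.
  move=> /(_ isT) hk.
  have hk' : (2 ^ k)%:R / (4%:R * gpow R k) <= (range_size n w)%:R.
    by apply: (le_trans (ltW hk)); rewrite ler_nat le_range_size.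
  apply: (@le_trans _ _ (k.+2%:R * ln 2%:R / (2 ^ k.+3)%:R * ((2 ^ k)%:R / (4%:R * gpow R k)))).
    rewrite (_ : (2 ^ k.+3)%:R = 8%:R * (2 ^ k)%:R); last by rewrite -natrM !expnS !mulnA.
    rewrite (_ : _ * _ = ln 2%:R * k.+2%:R / (32%:R * gpow R k)); last first.
      by field; rewrite !gt_eqF.
    rewrite /rate_lo ler_pdivlMr ?mulr_gt0// -!mulrA ler_pM2l//.
    rewrite ler_pdivrMl; last by lra.
    by rewrite -[k.+2%:R]natr1; lra.
  apply: ler_pM => //; first by rewrite divr_ge0// mulr_ge0// ltW.
  by rewrite divr_ge0// mulr_ge0// ltW.
have := h2 k.+3; rewrite (_ : N2 <= k.+3)%N; last by lia.
move=> /(_ isT) hk; set b := (k.+3 - k.+3./2)%N in hk.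
have b2 : (2 <= b)%N by rewrite /b; lia.
have gb := gpow_gt0 R b.
have gb1 : b%:R * (kappa R / 16%:R) <= gpow R b.
  have := gpow_ge R b.-1; rewrite prednK; last by lia.
  apply: le_trans; have b2' : 2%:R <= b%:R :> R by rewrite ler_nat.
  rewrite -[b in X in _ <= X](@prednK b); last by lia.
  have e : b%:R = b.-1%:R + 1 :> R by rewrite natr1 prednK//; lia.
  by rewrite e in b2' *; rewrite /=; nra.
have hk' : (range_size n w)%:R <= 3%:R * (15%:R * 20%:R) * ((2 ^ k.+3)%:R / gpow R b).
  apply: (@le_trans _ _ (range_size (2 ^ k.+3) w)%:R).
    by rewrite ler_nat le_range_size// ltnW.
  apply: (le_trans (ltW hk)); rewrite /range_scale -/b.
  have -> : (2 ^ k.+3)%:R = (2 ^ k.+3./2)%:R * (2 ^ b)%:R :> R.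
    by rewrite -natrM -expnD /b subnKC// leq_half_double; lia.
  by rewrite [leLHS](_ : _ = 3%:R * (15%:R * 20%:R) * ((2 ^ k.+3./2)%:R * (2 ^ b)%:R / gpow R b))//; ring.
apply: (@le_trans _ _ (k.+3%:R * ln 2%:R / (2 ^ k.+2)%:R *
    (3%:R * (15%:R * 20%:R) * ((2 ^ k.+3)%:R / gpow R b)))).
  by apply: ler_pM => //; exact: rate_ge0.
rewrite (_ : (2 ^ k.+3)%:R = 2%:R * (2 ^ k.+2)%:R); last by rewrite -natrM -expnS.
rewrite [leLHS](_ : _ = ln 2%:R * (2%:R * (3%:R * 15%:R * 20%:R)) * (k.+3%:R / gpow R b)); last first.
  by field; rewrite !gt_eqF.
rewrite /rate_hi ler_pM2l ?mulr_gt0//.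
rewrite ler_pdivrMr// mulrAC ler_pdivlMr//.
have kb : k.+3%:R <= 2%:R * b%:R :> R by rewrite -natrM ler_nat /b; lia.
have := ler_wpM2r (ltW kap) kb; lra.
Qed.

End BorelCantelli.

(** * Oscillation of the expected range *)

Section ExpectedRange.
Variables (R : realType) (T : site -> bool).
Local Notation F := (@dstep T).
Local Notation o := (root T 0).
Local Notation E n := (mean n (fun s => (range_of o s)%:R : R)).

Lemma sum_box_le (p : pred site) M r : (forall v, v \in box M -> p v -> (snorm v <= r)%N) ->
  (\sum_(v <- box M) p v <= size (box r))%N.
Proof.
move=> pr; rewrite -(undup_id (box_uniq r)).
apply: leq_trans (sum_mem_le (box r) (box_uniq M)).
rewrite !big_seq; apply: leq_sum => v vM.
by case pv : (p v) => //; rewrite mem_box pr.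
Qed.

(** Starting at a lattice point, the walk visits the lattice point of every site it visits. Each
    such site counts for 4 vertices, and a fifth one occurs only within radius [r]. *)
Lemma mean_range_upper n r :
  (forall v, (r < snorm v <= n)%N -> T v = false) ->
  E n <= 4%:R * \sum_(v <- box n) hit R F n o (root T v) + (size (box r))%:R.
Proof.
move=> Tr; apply: (@le_trans _ _ (mean n (fun s =>
    4%:R * nroots R (box n) o s + (size (box r))%:R))); last first.
  by rewrite meanD mean_cst meanZ mean_nroots.
apply: ler_mean => s sn.
have h : (snorm (0%R : site) + size s <= n)%N by rewrite sn.
apply: (@le_trans _ _ (4 * \sum_(v <- box n) (root T v \in trace F o s) +
    size (box r))%N%:R); last first.
  by rewrite natrD natrM natr_sum.
rewrite ler_nat; apply: (leq_trans (range_of_root_le T h)).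
rewrite big_distrr /=.
apply: (@leq_trans (\sum_(v <- box n) 4 * (root T v \in trace F o s) +
    \sum_(v <- box n) T v)).
  rewrite -big_split /=; apply: leq_sum => v _.
  by rewrite mulnDl leq_add2l; case: (T v); case: (_ \in _).
rewrite leq_add2l; apply: sum_box_le => v; rewrite mem_box => vn Tv.
by rewrite leqNgt; apply/negP => rv; rewrite Tr ?rv in Tv.
Qed.

(** Digit 0 leads from [y] towards the lattice point. Each edge of this path, at most two, is
    traversed backwards with probability at least [1 - e] by recurrence. *)
Lemma hit_fiber (e : R) : 0 < e <= 1 ->
  exists m, forall v y, y \in fiber T v -> 1 - 2%:R * e <= hit R F m (root T v) y.
Proof.
move=> /andP[e0 e1]; have [m hm] := @hit_near1 R T e e0.
exists (m + m)%N => v y; rewrite mem_fiber => /eqP <- {v}.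
have near (z : vtx T) : 1 - e <= hit R F m (nstep z 0) z := hm z ord0.
have le2 (z z' : vtx T) : hit R F m z z' <= hit R F (m + m) z z'.
  by apply: le_hit; exact: leq_addl.
case ly : (level y) => [|[|l]].
- by rewrite -(level0P ly) hit_refl; lra.
- have <- : nstep y 0 = root T (site_of y).
    by apply: val_inj; case: y ly => -[v [[i []]|]].
  by have := near y; have := le2 (nstep y 0) y; lra.
have <- : nstep (nstep y 0) 0 = root T (site_of y).
  by apply: val_inj; case: y ly => -[v [[i []]|]].
have h1 := near y; have h2 := near (nstep y 0).
have := hit_trans R F m m (nstep (nstep y 0) 0) y (nstep y 0).
have : (1 - e) * (1 - e) <= hit R F m (nstep (nstep y 0) 0) (nstep y 0) *
    hit R F m (nstep y 0) y by rewrite ler_pM//; lra.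
nra.
Qed.

Lemma sum_pred_count (S : Type) (r : seq S) (p : pred S) :
  (\sum_(u <- r) p u = count p r)%N.
Proof. by elim: r => [|u r IH]; rewrite ?big_nil// big_cons IH. Qed.

Lemma sum_fibers_le M s :
  (\sum_(v <- box M) \sum_(y <- fiber T v) (y \in trace F o s) <= range_of o s)%N.
Proof.
apply: (@leq_trans (\sum_(v <- box M) \sum_(y <- undup (trace F o s)) (site_of y == v))).
  apply: leq_sum => v _.
  rewrite !sum_pred_count -!size_filter.
  apply: uniq_leq_size; first by rewrite filter_uniq// fiber_uniq.
  by move=> y; rewrite !mem_filter mem_undup mem_fiber => /andP[-> ->].
rewrite exchange_big /= /range_of -[leqRHS]sum1_size; apply: leq_sum => y _.
rewrite sum_pred_count (eq_count (a2 := pred1 (site_of y))).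
  by rewrite count_uniq_mem ?box_uniq// leq_b1.
by move=> v; rewrite /= eq_sym.
Qed.

(** A lattice point visited by time [n - m] leaves [m] steps, enough to visit any given vertex of
    its site with probability at least [1 - e]. Sites of type [false] are estimated by 0 and lie
    within radius [r]. *)
Lemma mean_range_lower (e : R) m n r : 0 <= e <= 1 -> (m <= n)%N ->
  (forall v y, y \in fiber T v -> 1 - e <= hit R F m (root T v) y) ->
  (forall v, (r < snorm v <= n)%N -> T v = true) ->
  5%:R * (1 - e) * (\sum_(v <- box n) hit R F (n - m) o (root T v) - (size (box r))%:R)
    <= E n.
Proof.
move=> /andP[e0 e1] mn hm Tr.
apply: (@le_trans _ _ (\sum_(v <- box n) \sum_(y <- fiber T v) hit R F n o y)); last first.
  rewrite [leLHS](_ : _ = mean n (fun s =>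
      (\sum_(v <- box n) \sum_(y <- fiber T v) (y \in trace F o s))%N%:R : R)).
    by apply: ler_mean => s _; rewrite ler_nat; apply: sum_fibers_le.
  rewrite (eq_mean (g := fun s => \sum_(v <- box n) \sum_(y <- fiber T v)
      (y \in trace F o s)%:R)); last first.
    by move=> s _; rewrite natr_sum; apply: eq_bigr => v _; rewrite natr_sum.
  rewrite mean_sum; apply: eq_bigr => v _; rewrite mean_sum; apply: eq_bigr => y _.
  by rewrite mean_mem_trace.
apply: (@le_trans _ _ (\sum_(v <- box n)
    5%:R * (1 - e) * (hit R F (n - m) o (root T v) - (~~ T v)%:R))).
  rewrite -mulr_sumr ler_wpM2l ?mulr_ge0 ?subr_ge0// sumrB lerB// -natr_sum ler_nat.
  apply: sum_box_le => v; rewrite mem_box => vn nTv.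
  by rewrite leqNgt; apply/negP => rv; rewrite Tr ?rv in nTv.
apply: ler_sum => v _; case Tv : (T v) => /=; last first.
  apply: (@le_trans _ _ 0); last by apply: sumr_ge0 => y _; exact: hit_ge0.
  rewrite mulr_ge0_le0 ?mulr_ge0 ?subr_ge0// subr_le0; exact: hit_le1.
rewrite subr0; set H := hit R F (n - m) o (root T v).
apply: (@le_trans _ _ (\sum_(y <- fiber T v) H * (1 - e))).
  rewrite big_const_seq count_predT size_fiber Tv iter_addr_0.
  by rewrite -[leRHS]mulr_natr -mulrA mulrC [(1 - e) * H]mulrC.
rewrite big_seq [leRHS]big_seq; apply: ler_sum => y yv.
apply: (@le_trans _ _ (H * hit R F m (root T v) y)).
  by rewrite ler_wpM2l ?hit_ge0// hm.
have := hit_trans R F (n - m) m o y (root T v); rewrite subnK//.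
Qed.

End ExpectedRange.

(** * Choice of times and annuli *)

Section GoodTimes.
Variable R : realType.
Local Notation g := (gpow R).

Definition inv_green k : R := k%:R / g k.

Lemma inv_green_bounds k : (2 <= k)%N ->
  100%:R^-1 <= inv_green k <= 16%:R / kappa R.
Proof.
move=> k2; have gk := gpow_gt0 R k; have kap := kappa_gt0 R.
have k2' : 2%:R <= k%:R :> R by rewrite ler_nat.
apply/andP; split.
  rewrite ler_pdivlMr// ler_pdivrMl; last by lra.
  by have := gpow_le R k; rewrite -[k.+1%:R]natr1; lra.
rewrite ler_pdivrMr// mulrAC ler_pdivlMr//.
have := gpow_ge R k.-1; rewrite prednK; last by lia.
have e : k%:R = k.-1%:R + 1 :> R by rewrite natr1 prednK//; lia.
by rewrite e in k2' *; nra.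
Qed.

(** The upper limit of [inv_green] is [sup A]. A value slightly below it is exceeded infinitely
    often, while eventually [inv_green] stays below a number slightly above it. *)
Lemma frequent_value : exists2 Y : R, 0 < Y & forall N, exists2 k, (N <= k)%N &
  Y <= inv_green k <= (1 + 50%:R^-1) * Y.
Proof.
pose A := [set y : R | forall N, exists2 k, (N <= k)%N & y <= inv_green k].
have A0 : A 100%:R^-1.
  move=> N; exists (maxn N 2); first exact: leq_maxl.
  by have /andP[] := @inv_green_bounds (maxn N 2) (leq_maxr _ _).
have Aub y : A y -> y <= 16%:R / kappa R.
  move=> /(_ 2) [k k2 yk]; apply: (le_trans yk).
  by have /andP[] := inv_green_bounds k2.
have supA : has_sup A by split; [exists 100%:R^-1|exists (16%:R / kappa R)].
have S0 : 100%:R^-1 <= sup A by apply: ub_le_sup => //; exact: supA.2.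
have Spos : 0 < sup A by apply: lt_le_trans S0; rewrite invr_gt0.
(* The resulting [y] exceeds 101/102 of the supremum, and [(102/101)^2 <= 1 + 1/50]. *)
have [|y Ay yS] := sup_adherent (eps := sup A / 102%:R) _ supA; first by rewrite divr_gt0.
have yS' : 101%:R / 102%:R * sup A < y by apply: le_lt_trans yS; lra.
have y0 : 0 < y by apply: lt_trans yS'; rewrite mulr_gt0// divr_gt0.
exists y => // N.
have nA : ~ A (102%:R / 101%:R * sup A + 0).
  move=> /(ub_le_sup supA.2); lra.
have [M hM] : exists M, forall k, (M <= k)%N -> inv_green k < 102%:R / 101%:R * sup A.
  apply: contrapT => h; apply: nA; rewrite addr0 => N'; apply: contrapT => h'; apply: h.
  exists N' => k Nk; rewrite ltNge; apply/negP => hk; apply: h'; by exists k.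
have [k Nk yk] := Ay (maxn N M); rewrite geq_max in Nk; case/andP: Nk => Nk Mk.
exists k => //; rewrite yk /=; apply: ltW; apply: (lt_le_trans (hM k Mk)).
lra.
Qed.

End GoodTimes.

Section Schedule.
Variable R : realType.
Local Notation g := (gpow R).

Lemma rate_small (e : R) : 0 < e -> exists N, forall n, (N <= n)%N -> rate R n <= e.
Proof.
move=> e0; have [N _ hN] : \forall n \near \oo, rate R n < e.
  by apply: (cvgr_lt (0 : R)) => //; exact: rate_cvg0.
by exists N => n /hN /ltW.
Qed.

Lemma gpow_large (M : R) : exists N, forall k, (N <= k)%N -> M <= g k.
Proof.
have kap : 0 < kappa R / 8%:R by rewrite divr_gt0// kappa_gt0.
exists (Num.truncn (M / (kappa R / 8%:R))).+2 => k Nk.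
apply: le_trans (le_gpow R Nk); apply: le_trans (gpow_ge R _).
by rewrite -ler_pdivrMr// ltW// truncnS_gt.
Qed.

(** As [rate] tends to 0, the next good time can be taken so late that the number of sites in the
    current box is negligible after rescaling. *)
Lemma exists_schedule (Y d : R) : 0 < d ->
  (forall N, exists2 k, (N <= k)%N & Y <= inv_green R k <= (1 + 50%:R^-1) * Y) ->
  exists K : nat -> nat, forall i,
    [/\ (K i < K i.+1)%N, Y <= inv_green R (K i.+1) <= (1 + 50%:R^-1) * Y &
        rate R (2 ^ K i.+1) * (size (box (2 ^ K i)))%:R <= d].
Proof.
move=> d0 hY.
have next k : exists k', [/\ (k < k')%N, Y <= inv_green R k' <= (1 + 50%:R^-1) * Y &
    rate R (2 ^ k') * (size (box (2 ^ k)))%:R <= d].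
  set B : R := (size (box (2 ^ k)))%:R; have B0 : 0 < B + 1 by rewrite ltr_wpDl.
  have [N hN] := @rate_small (d / (B + 1)) (divr_gt0 d0 B0).
  have [k' Nk' Yk'] := hY (maxn N k.+1); rewrite geq_max in Nk'.
  case/andP: Nk' => Nk' kk'; exists k'; split => //.
  have r0 := rate_ge0 R (2 ^ k').
  apply: (@le_trans _ _ (rate R (2 ^ k') * (B + 1))).
    by rewrite ler_wpM2l// lerDl.
  by rewrite -ler_pdivlMr// hN// (leq_trans Nk')// ltnW// ltn_expl.
have [f hf] := choice next; exists (fun i => iter i f 0%N) => i.
exact: hf.
Qed.

End Schedule.

Section Oscillation.
Variable R : realType.
Local Notation g := (gpow R).

(** By time [2 ^ K i.+1] a walk from the origin has not left the outer radius of annulus [i], so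
    only the types within radius [2 ^ K i] can be wrong for it. *)
Definition osc_type (K : nat -> nat) (v : site) : bool :=
  `[< exists i, odd i /\ (2 ^ K i < snorm v <= 2 ^ K i.+1)%N >].

Lemma osc_typeE (K : nat -> nat) i v : (forall i, (K i < K i.+1)%N) ->
  (2 ^ K i < snorm v <= 2 ^ K i.+1)%N -> osc_type K v = odd i.
Proof.
move=> Kinc /andP[h1 h2].
have Kmono a b : (a <= b)%N -> (K a <= K b)%N.
  by move=> /subnKC <-; elim: (b - a)%N => [|c IH]; rewrite ?addn0// addnS (leq_trans IH)// ltnW.
have uniq_i a b : (a < b)%N -> ~ ((snorm v <= 2 ^ K a.+1)%N /\ (2 ^ K b < snorm v)%N).
  move=> ab [ha hb]; have := leq_trans hb ha.
  by rewrite ltn_exp2l// ltnNge Kmono.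
apply/asboolP/idP => [[j [oj /andP[j1 j2]]]|oi]; last by exists i; rewrite h1.
case: (ltngtP i j) => [ij|ji|-> //].
  by case: (uniq_i _ _ ij).
by case: (uniq_i _ _ ji).
Qed.

Lemma rate_sites_upper : exists N, forall k, (N <= k)%N ->
  rate R (2 ^ k) * ((2%:R * g (k - 7))^-1 *
    ((2 ^ k)%:R + ((2 ^ (k - 7))%:R + 5%:R)))
  <= ln 2%:R / 2%:R * inv_green R k * (1 + 30%:R^-1).
Proof.
(* The increment of [g] over 7 doublings is at most [48 * 7], thus one per cent of such a value. The
   extra time [h] is [n / 128], so [sum_hit_le] is nearly sharp. *)
have [N hN] := @gpow_large R (48%:R * 7%:R * 100%:R).
exists (N + 10)%N => k Nk; have k7 : (7 <= k)%N by lia.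
have h1 := hN (k - 7)%N; rewrite (_ : N <= k - 7)%N in h1; last by lia.
have {}h1 := h1 isT; have h2 := gpow_sub_le R k7.
have gk := gpow_gt0 R k; have gk7 := gpow_gt0 R (k - 7).
set n : R := (2 ^ k)%:R; set h : R := (2 ^ (k - 7))%:R.
have nh : n = 64%:R * 2%:R * h.
  by rewrite /n /h -!natrM; congr _%:R; rewrite -{1}(subnK k7) expnD mulnC.
have h0 : 8%:R <= h by rewrite /h ler_nat (@leq_exp2l 2 3)//; lia.
have l0 := ln2_gt0 R; have k0 : 0 <= k%:R :> R by [].
rewrite rate_pow2 -/n /inv_green.
rewrite [leLHS](_ : _ = ln 2%:R / 2%:R * (k%:R / g k) *
   (g k / g (k - 7) * ((n + (h + 5%:R)) / n))); last first.
  by field; rewrite !gt_eqF//; lra.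
rewrite ler_wpM2l//.
  by rewrite mulr_ge0// ?divr_ge0// ltW.
have r1 : g k / g (k - 7) <= 1 + 100%:R^-1 by rewrite ler_pdivrMr//; lra.
have r2 : (n + (h + 5%:R)) / n <= 1 + 70%:R^-1 by rewrite ler_pdivrMr; lra.
have r3 : 0 <= g k / g (k - 7) by rewrite divr_ge0// ltW.
have r4 : 0 <= (n + (h + 5%:R)) / n by rewrite divr_ge0; lra.
by apply: (le_trans (ler_pM r3 r4 r1 r2)); lra.
Qed.

Lemma rate_sites_lower m : exists N, forall k, (N <= k)%N -> (m <= 2 ^ k)%N /\
  ln 2%:R / 2%:R * inv_green R k * (1 - 100%:R^-1) <=
  rate R (2 ^ k) * (((2 ^ k - m)%N%:R - 3%:R) / (2%:R * rgreen R (2 ^ k - m))).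
Proof.
(* Makes the [m + 3] lost steps at most one per cent of [2 ^ k]. *)
exists (100 * (m + 3))%N => k Nk.
have kn := ltnW (ltn_expl k (ltnSn 1)).
have n1 : (100 * (m + 3) <= 2 ^ k)%N by exact: leq_trans kn.
have mn : (m <= 2 ^ k)%N by apply: leq_trans n1; clear; lia.
split => //; have gk := gpow_gt0 R k.
have rg1 := rgreen_ge1 R (fun=> true) (2 ^ k - m).
have rgk : rgreen R (2 ^ k - m) <= g k.
  by apply: (le_rgreen R (fun=> true)); exact: leq_subr.
have n1' : 100%:R * (m%:R + 3%:R) <= (2 ^ k)%:R :> R.
  by rewrite -natrD -natrM ler_nat.
rewrite natrB// rate_pow2 /inv_green.
move: n1'; set n : R := (2 ^ k)%:R => n1'.
have m0 : 0 <= m%:R :> R by [].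
have l0 := ln2_gt0 R; have k0 : 0 <= k%:R :> R by [].
apply: (@le_trans _ _ (k%:R * ln 2%:R / n * ((n - m%:R - 3%:R) / (2%:R * g k)))).
  rewrite [leRHS](_ : _ = ln 2%:R / 2%:R * (k%:R / g k) * ((n - m%:R - 3%:R) / n)); last first.
    by field; rewrite !gt_eqF//; lra.
  rewrite ler_wpM2l//; first by rewrite mulr_ge0// ?divr_ge0// ltW.
  by rewrite ler_pdivlMr; lra.
rewrite ler_wpM2l//.
  by rewrite divr_ge0 ?mulr_ge0// ?ltW//; lra.
rewrite ler_wpM2l//; first by lra.
by rewrite lef_pV2 ?posrE; lra.
Qed.

Lemma oscillation : exists (T : site -> bool) (a b : R), [/\ 0 < a, a < b,
  forall N, exists2 k, (N <= k)%N &
    rate R (2 ^ k) * mean (2 ^ k) (fun s => (range_of (root T 0) s)%:R) <= a &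
  forall N, exists2 k, (N <= k)%N &
    b <= rate R (2 ^ k) * mean (2 ^ k) (fun s => (range_of (root T 0) s)%:R)].
Proof.
have [Y Y0 hY] := frequent_value R.
have l0 := ln2_gt0 R; pose D := ln 2%:R / 2%:R * Y.
have D0 : 0 < D by rewrite mulr_gt0// divr_gt0.
have d0 : 0 < D / 50%:R by rewrite divr_gt0.
have [K hK] := exists_schedule d0 hY.
have Kinc i : (K i < K i.+1)%N by have [] := hK i.
have Ki i : (i <= K i)%N by elim: i => [//|i IH]; exact: leq_ltn_trans (Kinc i).
pose T := osc_type K.
have bnd i : ln 2%:R / 2%:R * inv_green R (K i.+1) <= (1 + 50%:R^-1) * D /\
             D <= ln 2%:R / 2%:R * inv_green R (K i.+1).
  have [_ /andP[y1 y2] _] := hK i.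
  have l2 : 0 <= ln 2%:R / 2%:R :> R by rewrite divr_ge0// ltW.
  have := ler_wpM2l l2 y1; have := ler_wpM2l l2 y2; rewrite /D; lra.
(* The upper estimate is [4 (1 + 1/30) (1 + 1/50) D + D / 50 < 4.3 D], the lower one [5 (1 - 2/100)
   (1 - 1/100 - 1/50) D > 4.7 D]. *)
exists T, (43%:R / 10%:R * D), (47%:R / 10%:R * D); split.
- by rewrite mulr_gt0// divr_gt0.
- by rewrite ltr_pM2r//; lra.
- move=> N; have [M hM] := rate_sites_upper.
  pose i := (maxn N M).*2; have iN : (maxn N M <= i)%N by rewrite /i; lia.
  move: iN; rewrite geq_max => /andP[iN iM].
  have iK := leq_trans (Ki i) (ltnW (Kinc i)).
  exists (K i.+1); first exact: leq_trans iK.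
  have [_ _ err] := hK i; have [b1 _] := bnd i.
  have up := hM (K i.+1) (leq_trans iM iK).
  set n := (2 ^ K i.+1)%N in err up *.
  have Tr v : (2 ^ K i < snorm v <= n)%N -> T v = false.
    by move=> h; rewrite /T (osc_typeE Kinc h) odd_double.
  have r0 := rate_ge0 R n.
  apply: (le_trans (ler_wpM2l r0 (mean_range_upper R Tr))).
  have s1 := sum_hit_le R n (2 ^ (K i.+1 - 7)) (root T 0) (box_uniq n).
  have s2 := le_trans (ler_wpM2l r0 s1) up.
  rewrite [leLHS]mulrDr [X in X + _ <= _]mulrCA; set S := rate R n * _ in s2 *; set B := rate R n * _ in err *.
  lra.
move=> N; have e01 : 0 < (100%:R^-1 : R) <= 1 by apply/andP; split; lra.
have [m hm] := @hit_fiber R T _ e01.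
have [M hM] := rate_sites_lower m.
pose i := (maxn N M).*2.+1; have iN : (maxn N M <= i)%N by rewrite /i; lia.
move: iN; rewrite geq_max => /andP[iN iM].
have iK := leq_trans (Ki i) (ltnW (Kinc i)).
exists (K i.+1); first exact: leq_trans iK.
have [_ _ err] := hK i; have [_ b2] := bnd i.
have [mn low] := hM (K i.+1) (leq_trans iM iK).
set n := (2 ^ K i.+1)%N in err mn low *.
have Tr v : (2 ^ K i < snorm v <= n)%N -> T v = true.
  by move=> h; rewrite /T (osc_typeE Kinc h) /= odd_double.
have r0 := rate_ge0 R n.
have e02 : 0 <= 2%:R * (100%:R^-1 : R) <= 1 by apply/andP; split; lra.
apply: le_trans (ler_wpM2l r0 (mean_range_lower e02 mn hm Tr)).
have sM : (snorm (site_of (root T 0%R)) + (n - m) <= n)%N by rewrite add0n leq_subr.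
have Q1 := le_trans low (ler_wpM2l r0 (sum_hit_ge R sM)).
rewrite [leRHS]mulrCA [_ * (_ - _%:R)]mulrBr.
move: Q1 b2 err; set X := ln 2%:R / 2%:R * _; set S := rate R n * _; set B := rate R n * _.
move: X S B D D0 {bnd d0 hK low} => X S B D' D0 Q1 b2 err.
lra.
Qed.

End Oscillation.

(** * Almost sure limits of the rescaled range and their separation *)

Section RangeLimits.
Variables (R : realType) (T : site -> bool).
Local Notation G := (graph T).
Local Notation P := (@walk_law R T).
Local Notation o := (root T 0).

Definition scaled_range n (w : path_space G) : R :=
  ln n%:R / n%:R * (range_size n w)%:R.

Lemma range_size_pcons (x : G) n (w : path_space G) :
  `|(range_size n (pcons x w))%:R - (range_size n w)%:R| <= 1 :> R.
Proof.
have le_add1 (s t : seq G) (y : G) : {subset s <= y :: t} ->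
    (size (undup s) <= size (undup t) + 1)%N.
  move=> st; rewrite addn1; apply: (@uniq_leq_size _ _ (y :: undup t)).
    exact: undup_uniq.
  by move=> z; rewrite mem_undup inE mem_undup => /st; rewrite inE.
have h1 : (range_size n (pcons x w) <= range_size n w + 1)%N.
  apply: (le_add1 _ _ x) => z; rewrite mkseq_pcons mkseqS !inE mem_rcons inE.
  by move=> /orP[->//|->]; rewrite !orbT.
have h2 : (range_size n w <= range_size n (pcons x w) + 1)%N.
  apply: (le_add1 _ _ (w n)) => z; rewrite mkseq_pcons mkseqS !inE mem_rcons inE.
  by move=> /orP[->//|->]; rewrite !orbT.
move: h1 h2; rewrite -!(ler_nat R) !natrD => h1 h2.
by rewrite ler_norml; apply/andP; split; lra.
Qed.

Lemma scaled_range_pcons (x : G) n (w : path_space G) :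
  `|scaled_range n (pcons x w) - scaled_range n w| <= rate R n.
Proof.
rewrite /scaled_range -mulrBr normrM ger0_norm; last exact: rate_ge0.
by rewrite -[leRHS]mulr1 ler_wpM2l ?range_size_pcons//; exact: rate_ge0.
Qed.

Lemma expectation_range n : ('E_(P o)[fun w => (range_size n w)%:R])%E =
  (mean n (fun s => (range_of o s)%:R : R))%:E.
Proof.
exact: (expectation_prefix R o n (f := fun p => size (undup p)) (@size_undup _)).
Qed.

Definition sup_range (w : path_space G) : \bar R :=
  limn_esup (fun n => (scaled_range n w)%:E).

Definition inf_range (w : path_space G) : \bar R :=
  limn_einf (fun n => (scaled_range n w)%:E).

Lemma sup_range_pcons (x : G) (w : path_space G) : sup_range (pcons x w) = sup_range w.
Proof.
by apply: (eq_limn_esup (d := rate R)) => [n|]; [exact: scaled_range_pcons|exact: rate_cvg0].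
Qed.

Lemma inf_range_pcons (x : G) (w : path_space G) : inf_range (pcons x w) = inf_range w.
Proof.
rewrite /inf_range /limn_einf; congr (- _)%E.
apply: (eq_limn_esup (f := fun n => - scaled_range n (pcons x w))
  (g := fun n => - scaled_range n w) (d := rate R)) => [n|]; last exact: rate_cvg0.
by rewrite -opprD normrN; exact: scaled_range_pcons.
Qed.

Lemma measurable_scaled_range n (Q : set R) : measurable [set w | Q (scaled_range n w)].
Proof. exact: (measurable_range n (fun m => Q (ln n%:R / n%:R * m%:R))). Qed.

Lemma measurable_sup_range : measurable_fun setT sup_range.
Proof.
apply: measurable_fun_limn_esup => n _ Y mY; rewrite setTI.
exact: (measurable_scaled_range n (fun r => Y r%:E)).
Qed.

Lemma measurable_inf_range : measurable_fun setT inf_range.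
Proof.
apply: measurableT_comp => //; apply: measurable_fun_limn_esup => n _ Y mY.
rewrite setTI; exact: (measurable_scaled_range n (fun r => Y (- r%:E)%E)).
Qed.

Lemma ae_range_limits_bounds : \forall w \ae P o,
  ((rate_lo R)%:E <= inf_range w <= (rate_hi R)%:E)%E /\
  ((rate_lo R)%:E <= sup_range w <= (rate_hi R)%:E)%E.
Proof.
apply: filterS (ae_rate_bounds R o) => w [N hN].
have h1 : ((rate_lo R)%:E <= inf_range w)%E.
  by apply: (limn_einf_ge (N := N)) => n /hN /andP[? _]; rewrite lee_fin.
have h2 : (sup_range w <= (rate_hi R)%:E)%E.
  by apply: (limn_esup_le (N := N)) => n /hN /andP[_ ?]; rewrite lee_fin.
have h3 : (inf_range w <= sup_range w)%E by exact: limn_einf_sup.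
by rewrite h1 h2 (le_trans h3 h2) (le_trans h1 h3).
Qed.

(** The event that infinitely many [A k] occur has probability at least [p > 0], so it meets every
    almost sure event. *)
Lemma io_witness (A : nat -> set (path_space G)) (p : R) (Q : set (path_space G)) :
  0 < p -> (forall k, measurable (A k)) ->
  (forall N, exists2 k, (N <= k)%N & (p%:E <= P o (A k))%E) ->
  (\forall w \ae P o, Q w) ->
  exists w, Q w /\ forall N, exists2 k, (N <= k)%N & A k w.
Proof.
move=> p0 mA hA [B [mB PB QB]].
have mU n : measurable (\bigcup_(k in [set k | (n <= k)%N]) A k).
  by apply: bigcup_measurable => k _.
have mL : measurable (lim_sup_set A).
  by apply: bigcap_measurable => [|n _]; [exists 0%N|exact: mU].
have pL : (p%:E <= P o (lim_sup_set A))%E.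
  have cv := lim_sup_set_cvg (P o) A mA
    (le_lt_trans (probability_le1 (P o) (mU 0%N)) (ltry 1)).
  rewrite -(cvg_lim (@ereal_hausdorff R) cv).
  apply: lime_ge; first by apply/cvg_ex; exists (P o (lim_sup_set A)).
  apply: nearW => n; have [k nk pk] := hA n.
  by apply: (le_trans pk); apply: le_measure; rewrite ?inE//; apply: bigcup_sup.
apply: contrapT => nw; have LB : lim_sup_set A `<=` B.
  move=> w Lw; apply: QB => Qw; apply: nw; exists w; split => // N.
  by have [k /= Nk Ak] := Lw N I; exists k.
have : (P o (lim_sup_set A) <= P o B)%E by apply: le_measure; rewrite ?inE.
by rewrite PB => /(le_trans pL); rewrite lee_fin leNgt p0.
Qed.

Lemma scaled_moments k :
  mean (2 ^ k) (fun s => (rate R (2 ^ k) * (range_of o s)%:R) ^+ 2) =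
  rate R (2 ^ k) ^+ 2 * mean (2 ^ k) (fun s => (range_of o s)%:R ^+ 2).
Proof. by rewrite -meanZ; apply: eq_mean => s _; rewrite exprMn. Qed.

Lemma prob_scaled_range k (Q : pred R) :
  P o [set w | Q (scaled_range (2 ^ k) w)] =
  (mean (2 ^ k) (fun s => (Q (rate R (2 ^ k) * (range_of o s)%:R))%:R : R))%:E.
Proof. exact: (walk_law_range R o (2 ^ k) (fun m => Q (rate R (2 ^ k) * m%:R))). Qed.

Local Notation Ek k :=
  (rate R (2 ^ k) * mean (2 ^ k) (fun s => (range_of o s)%:R)).

Lemma inf_range_le (a a' c : R) : 0 < a -> a < a' ->
  (forall N, exists2 k, (N <= k)%N & Ek k <= a) ->
  (\forall w \ae P o, inf_range w = c%:E) -> c <= a'.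
Proof.
move=> a0 aa' hE hc; have a'0 := lt_trans a0 aa'.
have p0 : 0 < 1 - a / a' by rewrite subr_gt0 ltr_pdivrMr// mul1r.
have [|w [wc wA]] := @io_witness (fun k => [set w | scaled_range (2 ^ k) w <= a'])
  (1 - a / a') _ p0 (fun k => measurable_scaled_range _ (fun r => r <= a')) _ hc.
  move=> N; have [k Nk Ea] := hE N; exists k => //.
  rewrite (prob_scaled_range k (fun r => r <= a')) lee_fin.
  apply: (@le_trans _ _ (mean (2 ^ k) (fun s =>
      1 - rate R (2 ^ k) * (range_of o s)%:R * a'^-1))).
    by rewrite meanB mean_cst meanZr meanZ lerD2l lerN2 ler_wpM2r// invr_ge0 ltW.
  apply: ler_mean => s _; have [h|h] := leP (rate R (2 ^ k) * (range_of o s)%:R) a'.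
    by rewrite gerBl divr_ge0 ?(ltW a'0)// mulr_ge0 ?rate_ge0.
  by rewrite /= subr_le0 ler_pdivlMr// mul1r ltW.
rewrite -lee_fin -wc; apply: limn_einf_le => N; have [k Nk Ak] := wA N.
by exists (2 ^ k)%N; [rewrite (leq_trans Nk)// ltnW// ltn_expl|rewrite lee_fin].
Qed.

Lemma scaled_second_moment : exists2 S : R, 0 < S & forall k, (2 <= k)%N ->
  mean (2 ^ k) (fun s => (rate R (2 ^ k) * (range_of o s)%:R) ^+ 2) <= S.
Proof.
have kap := kappa_gt0 R; have l0 := ln2_gt0 R.
pose c : R := ln 2%:R * (15%:R * 20%:R) * (16%:R / kappa R).
have c0 : 0 < c by rewrite !mulr_gt0// invr_gt0.
exists (2%:R * c ^+ 2); first by rewrite mulr_gt0// exprn_gt0.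
move=> k k2; rewrite scaled_moments; have [_ m2] := range_moments R k o.
apply: (le_trans (ler_wpM2l (sqr_ge0 _) m2)).
rewrite mulrCA ler_pM2l// -exprMn.
have n0 : 0 < (2 ^ k)%:R :> R by rewrite ltr0n expn_gt0.
have gk := gpow_gt0 R k.
have e : rate R (2 ^ k) * range_scale R k = ln 2%:R * (15%:R * 20%:R) * inv_green R k.
  by rewrite rate_pow2 /range_scale /inv_green; field; rewrite !gt_eqF.
have /andP[i1 i2] := inv_green_bounds R k2.
have i0 : 0 <= inv_green R k by apply: le_trans i1; rewrite invr_ge0.
rewrite e ler_pXn2r ?nnegrE//; last first.
- exact: ltW.
- by apply: mulr_ge0 => //; apply: mulr_ge0 => //; exact: ltW.
by rewrite /c ler_pM2l// !mulr_gt0.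
Qed.

Lemma sup_range_ge (b b' c : R) : 0 < b' -> b' < b ->
  (forall N, exists2 k, (N <= k)%N & b <= Ek k) ->
  (\forall w \ae P o, sup_range w = c%:E) -> b' <= c.
Proof.
move=> b0 bb' hE hc; have [S S0 hS] := scaled_second_moment.
(* With this [l] the second moment costs at most [l * S], half of the gap [b - b']; the other half
   bounds the probability from below. *)
pose l := (b - b') / (2%:R * S).
have l0 : 0 < l by rewrite divr_gt0 ?subr_gt0// mulr_gt0.
have p0 : 0 < 4%:R * l * ((b - b') / 2%:R).
  by apply: mulr_gt0; [exact: mulr_gt0|rewrite divr_gt0// subr_gt0].
have [|w [wc wA]] := @io_witness (fun k => [set w | b' <= scaled_range (2 ^ k) w])
  _ _ p0 (fun k => measurable_scaled_range _ (fun r => b' <= r)) _ hc.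
  move=> N; have [k] := hE (maxn N 2); rewrite geq_max => /andP[Nk k2] Eb.
  exists k => //; rewrite (prob_scaled_range k (fun r => b' <= r)) lee_fin.
  set X := fun s => rate R (2 ^ k) * (range_of o s)%:R : R.
  have EX : b <= mean (2 ^ k) X by rewrite meanZ.
  have EX2 : mean (2 ^ k) (fun s => X s ^+ 2) <= S by exact: hS.
  (* [X <= b' + l X^2 + 1_{b' <= X} / (4 l)] by AM-GM on [b' <= X]. *)
  have h : mean (2 ^ k) (fun s => 4%:R * l * (X s - b' - l * X s ^+ 2)) <=
      mean (2 ^ k) (fun s => (b' <= X s)%R%:R : R).
    apply: ler_mean => s _; have X0 : 0 <= X s by rewrite /X mulr_ge0 ?rate_ge0.
    have [h|h] := leP b' (X s).
      have := sqr_ge0 (2%:R * l * X s - 1); have : 0 <= 4%:R * l * b'.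
        by rewrite ltW// mulr_gt0// mulr_gt0.
      by rewrite /=; lra.
    have : 0 <= 4%:R * l * (l * X s ^+ 2).
      by apply: mulr_ge0; [exact/ltW/mulr_gt0|rewrite mulr_ge0 ?sqr_ge0// ltW].
    have : 4%:R * l * (X s - b') <= 0.
      by apply: mulr_ge0_le0; [exact/ltW/mulr_gt0|rewrite subr_le0 ltW].
    by rewrite /=; lra.
  apply: le_trans h; rewrite meanZ meanB meanB mean_cst meanZ.
  rewrite ler_pM2l; last exact: mulr_gt0.
  have : l * mean (2 ^ k) (fun s => X s ^+ 2) <= l * S by rewrite ler_pM2l.
  have -> : l * S = (b - b') / 2%:R by rewrite /l; field; rewrite gt_eqF.
  lra.
rewrite -lee_fin -wc; apply: limn_esup_ge => N; have [k Nk Ak] := wA N.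
by exists (2 ^ k)%N; [rewrite (leq_trans Nk)// ltnW// ltn_expl|rewrite lee_fin].
Qed.

End RangeLimits.

Theorem theorem1p8 (R : realType) :
  exists (G : simple_graph) (P : G -> probability (path_space G) R) (o : G),
    [/\ infinite_graph G, connected_graph G & bounded_degree G] /\
    is_srw P /\
    uniformly_weakly_recurrent P /\
    (limn_einf (fun n : nat =>
        (ln n%:R / n%:R)%:E * 'E_(P o)[fun w => (range_size n w)%:R])
     < limn_esup (fun n : nat =>
        (ln n%:R / n%:R)%:E * 'E_(P o)[fun w => (range_size n w)%:R]))%E /\
    exists c_inf c_sup : R,
      0 < c_inf /\ c_inf < c_sup /\
      \forall w \ae P o,
        limn_einf (fun n : nat => (ln n%:R / n%:R * (range_size n w)%:R)%:E)
          = c_inf%:E /\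
        limn_esup (fun n : nat => (ln n%:R / n%:R * (range_size n w)%:R)%:E)
          = c_sup%:E.
Proof.
have [T [a [b [a0 ab hA hB]]]] := oscillation R.
exists (graph T), (@walk_law R T), (root T 0); split.
  by split; [exact: graph_infinite|exact: graph_connected|exact: graph_bounded_degree].
split; first exact: walk_law_srw.
split; first exact: walk_law_recurrent.
split.
  apply: (@le_lt_trans _ _ a%:E); last apply: (@lt_le_trans _ _ b%:E).
  - apply: limn_einf_le => N; have [k Nk Ek] := hA N; exists (2 ^ k)%N.
      by rewrite (leq_trans Nk)// ltnW// ltn_expl.
    by rewrite expectation_range -EFinM lee_fin.
  - by rewrite lte_fin.
  apply: limn_esup_ge => N; have [k Nk Ek] := hB N; exists (2 ^ k)%N.
    by rewrite (leq_trans Nk)// ltnW// ltn_expl.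
  by rewrite expectation_range -EFinM lee_fin.
have bnd := ae_range_limits_bounds R T.
have [ci /andP[ci1 _] hi] := ae_invariant_cst (@measurable_inf_range R T)
  (@inf_range_pcons R T) (filterS (fun _ => @proj1 _ _) bnd).
have [cs _ hs] := ae_invariant_cst (@measurable_sup_range R T)
  (@sup_range_pcons R T) (filterS (fun _ => @proj2 _ _) bnd).
exists ci, cs; split.
  by apply: lt_le_trans ci1; rewrite divr_gt0 ?ln2_gt0// mulr_gt0.
split; last by apply: filterS2 hi hs => w; split.
(* Each limit is placed within a third of the gap [b - a] from its bound, and the middle third
   separates them. *)
have h1 := @inf_range_le R T a (a + (b - a) / 3%:R) ci a0 _ hA hi.
have h2 := @sup_range_ge R T b (b - (b - a) / 3%:R) cs _ _ hB hs.
have {}h1 : ci <= a + (b - a) / 3%:R by apply: h1; lra.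
have {}h2 : b - (b - a) / 3%:R <= cs by apply: h2; lra.
lra.
Qed.
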